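(* Let $r\ge 2$, $\ell\ge 2$, let $p$ be a positive divisor of $r$, and suppose that $W=G(r,p,\ell)$ is irreducible on $V=\mathbb{C}^\ell$. Let $\mathcal{A}=\mathcal{A}(W)$ be its reflection arrangement, $h$ its Coxeter number, let $\omega:\mathcal{A}\to\mathbb{N}$ be given by $\omega(H)=e_H$, and let $m\in\mathbb{N}$. Then (i) the reflection multi-arrangement $(\mathcal{A},m\omega)$ is free with exponents $$\exp(\mathcal{A},m\omega)=\{mh,\ldots,mh\}\quad(\ell\text{ entries});$$ (ii) the reflection multi-arrangement $(\mathcal{A},m\omega+1)$ is free with exponents $$\exp(\mathcal{A},m\omega+1)=\{mh+n_1(\Psi^{-m}(V^* )),\ldots,mh+n_\ell(\Psi^{-m}(V^* ))\}.$$
   Context: $\mathbb{N}=\{0,1,2,\ldots\}$. The group $G(r,p,\ell)$ consists of all $\ell\times\ell$ monomial matrices whose non-zero entries are $r$-th roots of unity and for which the $(r/p)$-th power of the product of the non-zero entries is $1$. Multi-arrangements. Let $V\cong\mathbb{C}^\ell$, $S=S(V^* )\cong\mathbb{C}[x_1,\ldots,x_\ell]$, $\mathrm{Der}_S$ the $S$-module of $\mathbb{C}$-derivations of $S$. A derivation $\theta=\sum f_i\partial_{x_i}$ is homogeneous with $\mathrm{pdeg}\,\theta=p$ if all $f_i$ are homogeneous of degree $p$ (or zero). For a finite set $\mathcal{A}$ of hyperplanes $H=\ker(\alpha_H)$ ($\alpha_H\in V^*$) through $0$ and $\nu:\mathcal{A}\to\mathbb{N}$, the multi-arrangement $(\mathcal{A},\nu)$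 has module of derivations $\mathfrak{D}(\mathcal{A},\nu)=\{\theta\in\mathrm{Der}_S\mid\theta(\alpha_H)\in S\alpha_H^{\nu(H)}\text{ for all }H\in\mathcal{A}\}$. It is free if $\mathfrak{D}(\mathcal{A},\nu)$ is a free $S$-module; then there is a homogeneous basis $\theta_1,\ldots,\theta_\ell$ and the multiset $\exp(\mathcal{A},\nu)=\{\mathrm{pdeg}\,\theta_1,\ldots,\mathrm{pdeg}\,\theta_\ell\}$ is well defined. Reflection groups. A unitary reflection group $W$ is a finite subgroup of $\mathrm{GL}(V)$ generated by its set $\mathcal{R}$ of reflections (elements whose fixed space is a hyperplane). $\mathcal{A}(W)$ is the set of reflecting hyperplanes; for $H\in\mathcal{A}(W)$, $W_H$ is the pointwise stabilizer of $H$ in $W$ and $e_H=|W_H|$. The multiplicities $m\omega$ and $m\omega+1$ are $H\mapsto me_H$ and $H\mapsto me_H+1$. The Coxeter number is $h=\frac1\ell\sum_{H\in\mathcal{A}}e_H=\frac1\ell(|\mathcal{R}|+|\mathcal{A}|)$. The coinvariant algebra is the quotient of $S$ by the ideal generated by the $W$-invariant polynomials without constant term; it is a graded $W$-module isomorphic to the regular representation. $\mathrm{Irr}(W)$ denotes the set of irreducible complex representations up to isomorphism. For $U\in\mathrm{Irr}(W)$ of dimension $d$, the $U$-exponents $n_1(U)\le\ldots\le n_d(U)$ are the $d$ degrees (with multiplicity) in which $U$ occurs in the coinvariant algebra. The permutation $\Psi$. $\Psi$ is the permutation of $\mathrm{Irr}(W)$ introduced by Malle (and studied by Opdam and by Gordon–Griffeth)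 through the Hecke algebra of $W$. It can be described as follows via the monodromy realization of the Hecke algebra. For $U\in\mathrm{Irr}(W)$ of dimension $d$ and $H\in\mathcal{A}$ let $a_H=\sum_{1\ne w\in W_H}(1-w)$, acting on $U$. Let $V^{\mathrm{reg}}=V\setminus\bigcup_{H\in\mathcal{A}}H$. The system $df=\sum_{H\in\mathcal{A}}\frac{d\alpha_H}{\alpha_H}\,a_Hf$ for holomorphic maps $f:V^{\mathrm{reg}}\to U$ is integrable with trivial monodromy on $V^{\mathrm{reg}}$, so its space of global solutions is $d$-dimensional; with the $W$-action $(wf)(v)=w(f(w^{-1}v))$ this space is an irreducible $W$-module, and $\Psi(U)$ is its class. Then $U\mapsto\Psi(U)$ is a permutation of $\mathrm{Irr}(W)$, and it satisfies the semi-palindromic property $n_i(U)+n_{d+1-i}(\Psi(U^* ))=h_U$ for $1\le i\le d$, where $h_U=|\mathcal{R}|-\sum_{s\in\mathcal{R}}\chi_U(s)/\chi_U(1)$ and $\chi_U$ is the character of $U$. $\Psi^{-m}$ is the $m$-th iterate of the inverse permutation. *)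

(* Defs.v *)
From HB Require Import structures.
From mathcomp Require Import all_boot all_order all_algebra all_fingroup.
From mathcomp Require Import mxrepresentation.
From mathcomp Require mpoly.

Set Implicit Arguments.
Unset Strict Implicit.
Unset Printing Implicit Defensive.

Import Order.TTheory GRing.Theory Num.Theory.

Local Open Scope ring_scope.

(* The notations of multinomials clash with those of mathcomp-analysis, so
   everything that uses them sits in this module, closed before the latter is
   imported.  V is 'cV[K]_l; S = S(V^* ) is {mpoly K[l]}, 'X_i being the i-th
   coordinate function, and linear forms on V are row vectors. *)
Module PolyDefs.
Import mpoly.
Section PolyDefs.
Variables (K : fieldType) (l : nat).
Implicit Types (P : {mpoly K[l]}) (theta : 'rV[{mpoly K[l]}]_l).

Definition linear_form (a : 'rV[K]_l) : {mpoly K[l]} :=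
  \sum_(i < l) a 0 i *: 'X_i.

(* Der_S is free on the partial derivatives: theta stands for the derivation
   \sum_i theta_i d/dx_i. *)
Definition apply_der theta P : {mpoly K[l]} := \sum_(i < l) theta 0 i * P^`M(i).

Definition has_pdeg theta (k : nat) : Prop :=
  forall i, theta 0 i \is k.-homog.

(* P(g^-1 v), where ginv is the matrix of g^-1. *)
Definition poly_act (ginv : 'M[K]_l) P : {mpoly K[l]} :=
  P \mPo [tuple linear_form (row i ginv) | i < l].

Definition is_homog (k : nat) P : bool := P \is k.-homog.
Definition constant_term P : K := P@_0%MM.

End PolyDefs.
End PolyDefs.

From mathcomp Require Import mathcomp_extra boolp classical_sets reals.
From mathcomp Require Import topology normedtype derive.
From mathcomp Require Export complex.
Import numFieldNormedType.Exports.
Import -(notations) mpoly.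
Import PolyDefs.

Section MultiArrangements.
Variables (K : fieldType) (l : nat).
Local Notation S := (mpoly.mpoly l K).
Local Notation hyperplane := {vspace 'cV[K]_l}.

Definition form_ker (a : 'rV[K]_l) : hyperplane :=
  lker (linfun (mulmx a : 'cV[K]_l -> 'cV[K]_1)).

(* A linear form alpha_H with kernel H (it exists and is unique up to a nonzero
   scalar when H is a hyperplane). *)
Definition alpha (H : hyperplane) : 'rV[K]_l :=
  xget 0 [set a : 'rV[K]_l | form_ker a = H]%classic.

Variables (A : seq hyperplane) (nu : hyperplane -> nat).

Definition in_derivation_module (theta : 'rV[S]_l) : Prop :=
  forall H, H \in A -> exists Q : S,
    apply_der theta (linear_form (alpha H)) =
    Q * linear_form (alpha H) ^+ nu H.

Definition is_derivation_basis (n : nat) (theta : 'I_n -> 'rV[S]_l) : Prop :=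
  (forall i, in_derivation_module (theta i)) /\
  (forall eta, in_derivation_module eta ->
     exists! c : 'rV[S]_n, eta = \sum_(i < n) c 0 i *: theta i).

(* exp(A, nu) is the multiset of the entries of es. *)
Definition free_with_exponents (es : seq nat) : Prop :=
  exists2 theta : 'I_(size es) -> 'rV[S]_l,
    is_derivation_basis theta &
    forall i : 'I_(size es), has_pdeg (theta i) (nth 0%N es i).

End MultiArrangements.

Section MonomialGroup.
Variables (K : fieldType) (r p l : nat).

Definition in_monomial_group (g : 'M[K]_l) : Prop :=
  [/\ exists s : 'S_l, forall i j, (g i j != 0) = (j == s i),
      forall i j, g i j != 0 -> g i j ^+ r = 1 &
      (\prod_i \prod_(j | g i j != 0) g i j) ^+ (r %/ p) = 1].

End MonomialGroup.

(* A finite subgroup of GL(V) is given as a finite group W with a faithful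
   matrix representation V.  A matrix representation rho of degree d makes W
   act on the left on 'cV[K]_d by g u = rho g *m u. *)
Section ReflectionGroups.
Variables (K : decFieldType) (l : nat) (gT : finGroupType) (W : {group gT}).
Variable V : mx_representation K W l.
Local Notation hyperplane := {vspace 'cV[K]_l}.

Definition fixed_space (g : gT) : hyperplane :=
  fixedSpace (linfun (mulmx (V g) : 'cV[K]_l -> 'cV[K]_l)).

Definition reflections : {set gT} :=
  [set g in W | (\dim (fixed_space g)).+1 == l].

Definition reflection_arrangement : seq hyperplane :=
  undup [seq fixed_space g | g in reflections].

Definition pointwise_stabilizer (H : hyperplane) : {set gT} :=
  [set g in W | (H <= fixed_space g)%VS].

Definition stab_order (H : hyperplane) : nat := #|pointwise_stabilizer H|.

(* The quotient is exact when W is irreducible. *)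
Definition coxeter_number : nat :=
  ((\sum_(H <- reflection_arrangement) stab_order H) %/ l)%N.

Fact dual_mx_repr : mx_repr W (fun g => (V g^-1%g)^T).
Proof.
split=> [|g h gW hW]; first by rewrite invg1 repr_mx1 trmx1.
by rewrite invMg repr_mxM ?groupV // trmx_mul.
Qed.
Definition dual_repr : mx_representation K W l := MxRepresentation dual_mx_repr.

Definition Irr : irrType K W := DecSocleType (regular_repr K W).

End ReflectionGroups.

Section CoinvariantAlgebra.
Variables (K : decFieldType) (l : nat) (gT : finGroupType) (W : {group gT}).
Variable V : mx_representation K W l.
Local Notation S := (mpoly.mpoly l K).

Definition act (g : gT) (P : S) : S := poly_act (V g^-1%g) P.

Definition in_coinvariant_ideal (P : S) : Prop :=
  exists (n : nat) (Q F : 'I_n -> S),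
    (forall i, constant_term (F i) = 0 /\ forall g, g \in W -> act g (F i) = F i)
    /\ P = \sum_(i < n) Q i * F i.

Section Multiplicity.
Variables (d : nat) (U : mx_representation K W d).

(* P represents the linear map U -> (S/I)_k sending the j-th basis vector of U
   to the class of P j; the second condition says that it commutes with W. *)
Definition coinvariant_hom (k : nat) (P : 'I_d -> S) : Prop :=
  (forall j, is_homog k (P j)) /\
  (forall g, g \in W -> forall j,
     in_coinvariant_ideal (act g (P j) - \sum_(i < d) U g i j *: P i)).

(* Hom_W(U, (S/I)_k) has dimension n, that is, U occurs n times in degree k of
   the coinvariant algebra S/I (for U irreducible and K algebraically closed). *)
Definition coinvariant_multiplicity (k n : nat) : Prop :=
  exists2 B : 'I_n -> 'I_d -> S,
    forall t, coinvariant_hom k (B t) &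
    forall P, coinvariant_hom k P -> exists! c : 'rV[K]_n,
      forall j, in_coinvariant_ideal (P j - \sum_(t < n) c 0 t *: B t j).

(* ns is the list n_1(U) <= ... <= n_d(U). *)
Definition U_exponents (ns : seq nat) : Prop :=
  [/\ size ns = d, sorted leq ns &
      forall k, coinvariant_multiplicity k (count_mem k ns)].

End Multiplicity.
End CoinvariantAlgebra.

Section Psi.
Variables (K : numClosedFieldType) (l : nat).
Variables (gT : finGroupType) (W : {group gT}).
Variable V : mx_representation K W l.

Definition regular_point (v : 'cV[K]_l) : Prop :=
  forall H, H \in reflection_arrangement V -> v \notin H.

Section Solutions.
Variables (d : nat) (U : mx_representation K W d).

Definition residue (H : {vspace 'cV[K]_l}) : 'M[K]_d :=
  \sum_(w in pointwise_stabilizer V H :\ 1%g) (1%:M - U w).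

(* Maps V^reg -> U are represented by total functions vanishing off V^reg; V^reg
   is open, so this extension is immaterial for differentiability there.
   Differentiability is over K, hence for K = R[i] it is holomorphy. *)
Definition is_solution (f : 'cV[K]_l -> 'cV[K]_d) : Prop :=
  (forall v, regular_point v ->
     is_diff v f (fun u => \sum_(H <- reflection_arrangement V)
       ((alpha H *m u) 0 0 / (alpha H *m v) 0 0) *: (residue H *m f v))) /\
  (forall v, ~ regular_point v -> f v = 0).

(* The space of solutions, with (w f)(v) = w (f (w^-1 v)), is isomorphic to U'
   through Phi. *)
Definition solutions_iso (d' : nat) (U' : mx_representation K W d') : Prop :=
  exists Phi : 'cV[K]_d' -> 'cV[K]_l -> 'cV[K]_d,
    [/\ forall c u u', Phi (c *: u + u') =1 fun v => c *: Phi u v + Phi u' v,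
        forall u, is_solution (Phi u),
        forall f, is_solution f -> exists! u, Phi u =1 f &
        forall w, w \in W -> forall u v,
          Phi (U' w *m u) v = U w *m Phi u (V w^-1%g *m v)].

End Solutions.

(* Distinct elements of Irr are not isomorphic, so Psi is determined by this. *)
Definition is_Psi (Psi : {perm Irr K W}) : Prop :=
  forall i : Irr K W, solutions_iso (irr_repr i) (irr_repr (Psi i)).

End Psi.

(* Main.v *)
(* Write X_i = x_i^r, and c = r/p if p < r and c = 0 if p = r, so that
   h = r(l-1) + c.

   By Saito's criterion, homogeneous derivations of a multi-arrangement form a
   basis as soon as their determinant is nonzero and their degrees have the
   right sum.  The derivations used here have for components (up to monomial
   factors) the integrals from 0 to x_i of t^(..) prod_k (t^r - X_k)^m: as the
   integrand vanishes to order m at x_i and at zeta x_j, such integrals for i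
   and for j agree to order 2m + 1 along x_i = zeta x_j.  Their determinant is
   nonzero by induction on l, letting one variable go to 0.

   All the modules that occur are the monomial modules M_k, in which W acts by
   the entrywise k-th powers of the matrices of V; thus V^* = M_{-1}.  The
   integrals x_i^k int_0^{x_n} t^(c-k-1) prod_{j <> i} (t^r - X_j) dt, i = 1..l,
   are for each n the components of a solution of the differential system
   attached to M_k, and W acts on the span of these l solutions by M_{k-c}.
   Hence Psi(M_k) = M_{k-c} and Psi^{-m}(V^* ) = M_{mc-1}, whose exponents are
   read off an explicit basis of the equivariant polynomial maps, obtained by
   Saito's criterion once more. *)

Require Import Defs.
From mathcomp Require Import all_boot all_order all_algebra all_fingroup.
From mathcomp Require Import mxrepresentation reals complex.
From mathcomp Require Import pgroup separable cyclotomic ring zify.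
From mathcomp Require boolp classical_sets.

Set Implicit Arguments.
Unset Strict Implicit.
Unset Printing Implicit Defensive.

Import Order.TTheory GRing.Theory Num.Theory.

Local Open Scope ring_scope.

(** * Divisibility and Cramer's rule *)

(** One divisibility condition, [saito_cond], serves twice: with [tau = 1] it describes the
    derivations of a multi-arrangement, with [tau = kappa] the congruences that equivariance forces
    on polynomial maps. Either way an explicit matrix needs three facts: the condition for its rows,
    its degree sum, a nonzero determinant. The obstacle is that the integrands may have poles at 0,
    of order growing with m. So an integral of t^(a-1) over [0,1] is replaced by the number 1/a,
    which makes sense because a is congruent to 1 (for the differential system, to c - k) modulo r
    and never 0. Taylor's formula and integration by parts then become identities between
    polynomials. For Psi one nonzero equivariant map from M_{k-c} to the space of solutions is
    enough: both sides are irreducible, the second by the definition of Psi, and Schur's lemma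
    applies. The constant [kappa] is congruent to 1 - mc modulo r because the x_j^k span a copy of
    M_{-k}; the same congruence aligns the degrees of the integrals with the exponents of
    M_{mc-1}. *)

Definition rdvd (R : comNzRingType) (a p : R) := exists q, p = q * a.

Section RingDivisibility.
Variable R : comNzRingType.
Implicit Types a b p q : R.

Lemma rdvd0 a : rdvd a 0.
Proof. by exists 0; rewrite mul0r. Qed.

Lemma rdvdD a p q : rdvd a p -> rdvd a q -> rdvd a (p + q).
Proof. by move=> [u ->] [v ->]; exists (u + v); rewrite mulrDl. Qed.

Lemma rdvd_mull a p q : rdvd a p -> rdvd a (q * p).
Proof. by move=> [u ->]; exists (q * u); rewrite mulrA. Qed.

Lemma rdvd_mulr a p q : rdvd a p -> rdvd a (p * q).
Proof. by rewrite mulrC; exact: rdvd_mull. Qed.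

Lemma rdvdN a p : rdvd a p -> rdvd a (- p).
Proof. by move=> [u ->]; exists (- u); rewrite mulNr. Qed.

Lemma rdvd_sum a (I : Type) (s : seq I) (P : pred I) (F : I -> R) :
  (forall i, P i -> rdvd a (F i)) -> rdvd a (\sum_(i <- s | P i) F i).
Proof. by move=> h; elim/big_ind: _ => //; [exact: rdvd0 | exact: rdvdD]. Qed.

Lemma rdvd_refl a : rdvd a a.
Proof. by exists 1; rewrite mul1r. Qed.

Lemma rdvd_exp a m n : (m <= n)%N -> rdvd (a ^+ m) (a ^+ n).
Proof. by move=> mn; exists (a ^+ (n - m)); rewrite -exprD subnK. Qed.

End RingDivisibility.

(** Units satisfy this as well; being nonzero and not dividing 1 are separate hypotheses where they
    matter. *)
Definition prime_elt (R : comNzRingType) (a : R) :=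
  forall p q, rdvd a (p * q) -> rdvd a p \/ rdvd a q.

Section PrimeElements.
Variable R : idomainType.
Implicit Types a b p q : R.

Lemma rdvd_primeX a b n p : a != 0 -> prime_elt a -> ~ rdvd a b ->
  rdvd (a ^+ n) (b * p) -> rdvd (a ^+ n) p.
Proof.
move=> a0 pa nab; elim: n p => [|n IH] p; first by exists p; rewrite mulr1.
move=> [u hu]; have : rdvd a (b * p) by exists (u * a ^+ n); rewrite hu exprSr mulrA.
case/pa=> // -[q hq]; rewrite hq exprSr in hu *.
have /IH [v ->] : rdvd (a ^+ n) (b * q).
  by exists u; apply: (mulIf a0); rewrite -!mulrA -hu.
by exists v; rewrite mulrA.
Qed.

Lemma prime_ndvdM a p q :
  prime_elt a -> ~ rdvd a p -> ~ rdvd a q -> ~ rdvd a (p * q).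
Proof. by move=> pa np nq /pa[]. Qed.

Lemma prime_ndvdX a p n :
  prime_elt a -> ~ rdvd a 1 -> ~ rdvd a p -> ~ rdvd a (p ^+ n).
Proof.
move=> pa n1 np; elim: n => [|n IH]; rewrite ?expr0 // exprS.
exact: prime_ndvdM.
Qed.

Lemma prime_ndvd_prod a (I : eqType) (s : seq I) (P : pred I) (F : I -> R) :
  prime_elt a -> ~ rdvd a 1 -> (forall i, i \in s -> P i -> ~ rdvd a (F i)) ->
  ~ rdvd a (\prod_(i <- s | P i) F i).
Proof.
move=> pa n1; elim: s => [|i s IH] h; rewrite ?big_nil ?big_cons //.
have hs : ~ rdvd a (\prod_(j <- s | P j) F j).
  by apply: IH => j js; apply: h; rewrite inE js orbT.
case: ifP => // Pi; apply: prime_ndvdM => //; apply: h => //.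
by rewrite inE eqxx.
Qed.

(** Stands in for unique factorization: the prime [a i] does not divide the product over the rest of
    the list, so its power has to divide the cofactor. *)
Lemma prod_primes_dvd (I : eqType) (s : seq I) (a : I -> R) (n : I -> nat) p :
  uniq s ->
  (forall i, i \in s -> a i != 0 /\ prime_elt (a i) /\ ~ rdvd (a i) 1) ->
  (forall i j, i \in s -> j \in s -> i != j -> ~ rdvd (a i) (a j)) ->
  (forall i, i \in s -> rdvd (a i ^+ n i) p) ->
  rdvd (\prod_(i <- s) a i ^+ n i) p.
Proof.
elim: s p => [|i s IH] p /=; first by exists p; rewrite big_nil mulr1.
move=> /andP[nis us] pr cop dv; rewrite big_cons.
have [q hq] : rdvd (\prod_(j <- s) a j ^+ n j) p.
  apply: IH us _ _ _ => [j js|j k js ks|j js].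
  - by apply: pr; rewrite inE js orbT.
  - by apply: cop; rewrite inE ?js ?ks orbT.
  - by apply: dv; rewrite inE js orbT.
have is' : i \in i :: s by rewrite inE eqxx.
have [a0 [pa n1]] := pr i is'.
have nd : ~ rdvd (a i) (\prod_(j <- s) a j ^+ n j).
  apply: prime_ndvd_prod => // j js _; apply: prime_ndvdX => //.
  apply: cop; rewrite ?inE ?eqxx ?js ?orbT //.
  by apply: contraNneq nis => ->.
have [u hu] : rdvd (a i ^+ n i) q.
  by apply: (rdvd_primeX a0 pa nd); rewrite mulrC -hq; apply: dv.
by exists u; rewrite hq hu mulrA.
Qed.

End PrimeElements.

Section Cramer.
Variables (R : idomainType) (l : nat).

Lemma row_comb_unique (B : 'M[R]_l) (c c' : 'rV[R]_l) :
  \det B != 0 -> c *m B = c' *m B -> c = c'.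
Proof.
move=> dB /(congr1 (mulmx^~ (\adj B))); rewrite -!mulmxA mul_mx_adj.
rewrite !mul_mx_scalar => /rowP h; apply/rowP => i; have := h i.
by rewrite !mxE => /(mulfI dB).
Qed.

(** Cramer's rule: the cofactors along row [t] do not see that row, so expanding the modified
    determinant along it gives the left-hand side. *)
Lemma adj_repl (B : 'M[R]_l) (eta : 'rV[R]_l) (t : 'I_l) :
  (eta *m \adj B) 0 t =
  \det (\matrix_(i, j) if i == t then eta 0 j else B i j).
Proof.
rewrite (expand_det_row _ t) mxE; apply: eq_bigr => j _.
rewrite !mxE eqxx; congr (_ * (_ * \det _)).
by apply/matrixP => i k; rewrite !mxE eq_sym (negPf (neq_lift _ _)).
Qed.

Lemma cramer_comb (B : 'M[R]_l) (eta : 'rV[R]_l) : \det B != 0 ->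
  (forall t, rdvd (\det B)
     (\det (\matrix_(i, j) if i == t then eta 0 j else B i j))) ->
  exists! c : 'rV[R]_l, eta = c *m B.
Proof.
move=> dB dv; have [c hc] : exists c : 'rV[R]_l, eta *m \adj B = \det B *: c.
  have hx t : exists x, (eta *m \adj B) 0 t == x * \det B.
    by rewrite adj_repl; have [u ->] := dv t; exists u.
  exists (\row_t xchoose (hx t)); apply/rowP => t.
  by rewrite [RHS]mxE [X in _ * X]mxE mulrC; apply/eqP; exact: (xchooseP (hx t)).
exists c; split=> [|c' hc']; last first.
  apply: (row_comb_unique dB); rewrite -hc'; apply/rowP => i.
  have := congr1 (fun M : 'rV_l => (M *m B) 0 i) hc.
  rewrite -mulmxA mul_adj_mx mul_mx_scalar -scalemxAl [X in X = _]mxE.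
  by rewrite [X in _ = X]mxE => /(mulfI dB) ->.
apply/rowP => i; have := congr1 (fun M : 'rV_l => (M *m B) 0 i) hc.
rewrite -mulmxA mul_adj_mx mul_mx_scalar -scalemxAl [X in X = _]mxE.
by rewrite [X in _ = X]mxE => /(mulfI dB).
Qed.

(** The adjugate turns [M *m a] into [\det M] times [a]; the unit entry of [a] then isolates
    [\det M]. *)
Lemma det_dvd_kernel (M : 'M[R]_l) (a : 'cV[R]_l) (d : R) (i0 : 'I_l) :
  a i0 0 \is a GRing.unit -> (forall i, rdvd d ((M *m a) i 0)) -> rdvd d (\det M).
Proof.
move=> ua dv; have : rdvd d ((\adj M *m (M *m a)) i0 0).
  by rewrite mxE; apply: rdvd_sum => j _; apply: rdvd_mull.
rewrite mulmxA mul_adj_mx mul_scalar_mx mxE => /(rdvd_mulr (a i0 0)^-1).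
by rewrite -mulrA divrr // mulr1.
Qed.

End Cramer.

(** * Saito's criterion *)

Module Saito.
Import mpoly.

Section MPoly.
Variables (K : fieldType) (l : nat).
Local Notation S := {mpoly K[l]}.
Implicit Types (p q L : S) (i j : 'I_l).

Lemma mpoly_ring_ind (P : S -> Prop) :
  (forall c, P c%:MP) -> (forall i, P 'X_i) ->
  (forall p q, P p -> P q -> P (p + q)) ->
  (forall p q, P p -> P q -> P (p * q)) -> forall p, P p.
Proof.
move=> hC hX hD hM; elim/mpolyind=> [|c m p _ _ Pp]; first by rewrite -mpolyC0.
apply: hD => //; rewrite -mul_mpolyC; apply/hM => //.
rewrite mpolyXE_id; elim/big_ind: _ => [|p' q'|i _]; [by rewrite -mpolyC1|exact: hM|].
by elim: (m i) => [|n IH]; rewrite ?expr0 -?mpolyC1 // exprS; apply/hM.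
Qed.

Definition subst_tuple i L := [tuple (if k == i then L else 'X_k) | k < l].

Lemma subst_XU i L k :
  ('X_k : S) \mPo subst_tuple i L = if k == i then L else 'X_k.
Proof. by rewrite comp_mpolyXU -tnth_nth tnth_mktuple. Qed.

Lemma rdvd_sub_subst i L p : rdvd ('X_i - L) (p - (p \mPo subst_tuple i L)).
Proof.
elim/mpoly_ring_ind: p => [c|k|p q hp hq|p q hp hq].
- by rewrite comp_mpolyC subrr; apply: rdvd0.
- by rewrite subst_XU; case: eqP => [->|_]; [apply: rdvd_refl|rewrite subrr; apply: rdvd0].
- by rewrite comp_mpolyD opprD addrACA; apply: rdvdD.
- rewrite rmorphM /=; set p' := p \mPo _; set q' := q \mPo _.
  have -> : p * q - p' * q' = p * (q - q') + (p - p') * q' by ring.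
  by apply: rdvdD; [apply: rdvd_mull | apply: rdvd_mulr].
Qed.

Section LinearElement.
Variables (i : 'I_l) (L : S).
Hypothesis hL : L \mPo subst_tuple i L = L.

(** Divisibility by ['X_i - L] is membership in the kernel of a ring morphism to a domain, whence
    primality. The hypothesis [hL] holds for every [L] free of the i-th variable. *)
Lemma rdvd_substP p : rdvd ('X_i - L) p <-> p \mPo subst_tuple i L = 0.
Proof.
split=> [[q ->]|h]; last by have := rdvd_sub_subst i L p; rewrite h subr0.
by rewrite rmorphM rmorphB /= hL subst_XU eqxx subrr mulr0.
Qed.

Lemma prime_linear : prime_elt ('X_i - L).
Proof.
move=> p q /rdvd_substP; rewrite rmorphM => /eqP; rewrite mulf_eq0.
by case/orP => /eqP h; [left|right]; apply/rdvd_substP.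
Qed.

Lemma linear_ndvd1 : ~ rdvd ('X_i - L) 1.
Proof. by move=> /rdvd_substP /eqP; rewrite rmorph1 oner_eq0. Qed.

End LinearElement.

Lemma rdvd_meval (a p : S) v : rdvd a p -> a.@[v] = 0 -> p.@[v] = 0.
Proof. by move=> [q ->] h; rewrite mevalM h mulr0. Qed.

Lemma homogM d e p q :
  p \is d.-homog -> q \is e.-homog -> p * q \is (d + e).-homog.
Proof. exact: dhomogM. Qed.

Lemma homogX d n p : p \is d.-homog -> p ^+ n \is (d * n).-homog.
Proof. exact: dhomogMn. Qed.

Lemma homogU i : ('X_i : S) \is 1.-homog.
Proof. by rewrite dhomogX /= mdeg1. Qed.

Lemma homog_prod (I : Type) (s : seq I) (P : pred I) (F : I -> S) (d : I -> nat) :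
  (forall x, P x -> F x \is (d x).-homog) ->
  \prod_(x <- s | P x) F x \is (\sum_(x <- s | P x) d x)%N.-homog.
Proof.
move=> h; elim/big_rec2: _ => [|x n p Px hp]; first exact: dhomog1.
by apply: homogM => //; apply: h.
Qed.

Lemma homog_det (n : nat) (B : 'M[S]_n) (d : 'I_n -> nat) :
  (forall t (i : 'I_n), B t i \is (d t).-homog) -> \det B \is (\sum_t d t)%N.-homog.
Proof.
move=> hB; rewrite /determinant; apply: rpred_sum => s _.
have -> (x : S) : (-1) ^+ s * x = ((-1) ^+ s : K) *: x.
  by rewrite -mul_mpolyC rmorphXn rmorphN rmorph1.
by apply: dhomogZ; apply: homog_prod.
Qed.

(** Both polynomials have degree [d], so the quotient has [msize] 1. *)
Lemma homog_dvd_const d p q : p \is d.-homog -> q \is d.-homog -> q != 0 ->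
  rdvd p q -> exists2 c : K, c != 0 & q = c *: p.
Proof.
move=> hp hq q0 [u hu]; have := q0; rewrite hu mulf_eq0 negb_or => /andP[u0 p0].
have hs (x : S) : x != 0 -> x \is d.-homog -> msize x = d.+1.
  move=> x0 hx; have := dhomog_uniq x0 hx (dhomog_msize hx).
  by move: x0; rewrite -msize_poly_eq0; case: (msize x) => // n _ ->.
have := msizeM u0 p0; rewrite -hu (hs q) // (hs p) //.
rewrite addnS /= => /eqP; rewrite -addn1 addnC eqn_add2r eq_sym.
by move/msize_poly1P => [c c0 hc]; exists c; rewrite // hu hc mul_mpolyC.
Qed.

End MPoly.

Section Saito.
Variables (K : numFieldType) (l r : nat) (z : K).
Hypothesis zP : r.-primitive_root z.
Local Notation S := {mpoly K[l]}.
Implicit Types (p q : S) (i j : 'I_l).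

Definition lin i j k : S := 'X_i - z ^+ k *: 'X_j.

Lemma lin_subst i j k : i != j ->
  (z ^+ k *: 'X_j : S) \mPo subst_tuple i (z ^+ k *: 'X_j) = z ^+ k *: 'X_j.
Proof. by move=> ij; rewrite linearZ /= subst_XU eq_sym (negPf ij). Qed.

Lemma lin_prime i j k : i != j -> prime_elt (lin i j k).
Proof. by move=> ij; apply/prime_linear/lin_subst. Qed.

Lemma lin_ndvd1 i j k : i != j -> ~ rdvd (lin i j k) 1.
Proof. by move=> ij; apply/linear_ndvd1/lin_subst. Qed.

Lemma norm_zX k : `|z ^+ k| = 1.
Proof.
have r0 : (0 < r)%N := prim_order_gt0 zP.
rewrite normrX; suff -> : `|z| = 1 by rewrite expr1n.
by apply/eqP; rewrite -(pexpr_eq1 r0) // -normrX prim_expr_order // normr1.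
Qed.

(* A zero of [lin i j k] which, having coordinates of distinct absolute values
   apart from the i-th and the j-th, lies on no other hyperplane. *)
Definition lin_point i j k (m : 'I_l) : K :=
  if m == i then z ^+ k else if m == j then 1 else m.+2%:R.

Lemma lin_point_norm i j k m :
  `|lin_point i j k m| = if (m == i) || (m == j) then 1 else m.+2%:R.
Proof.
rewrite /lin_point; case: (m == i) => /=; first exact: norm_zX.
by case: (m == j); rewrite ?normr1 // normr_nat.
Qed.

Lemma lin_meval i j k v : (lin i j k).@[v] = v i - z ^+ k * v j.
Proof. by rewrite /lin mevalB mevalZ !mevalXU. Qed.

Lemma lin_at_point i j k : i != j -> (lin i j k).@[lin_point i j k] = 0.
Proof. by move=> ij; rewrite lin_meval /lin_point eqxx eq_sym (negPf ij) eqxx mulr1 subrr. Qed.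

Lemma lin_ndvdX i j k m : i != j -> ~ rdvd (lin i j k) ('X_m : S).
Proof.
move=> ij /rdvd_meval h; have := h _ (lin_at_point k ij); rewrite mevalXU.
move/(congr1 Num.norm); rewrite lin_point_norm normr0 => /eqP.
by case: ifP; rewrite ?oner_eq0 ?pnatr_eq0.
Qed.

Lemma natSS_eq1 (m : nat) : ((m.+2%:R : K) == 1) = false.
Proof. by rewrite -[1]/(1%:R) eqr_nat. Qed.

Lemma lin_ndvd_lin i j i' j' (k k' : 'I_r) : (i < j)%N -> (i' < j')%N ->
  (i, j, k) != (i', j', k') -> ~ rdvd (lin i j k) (lin i' j' k').
Proof.
move=> ij ij' ne /rdvd_meval h.
have nij : i != j by apply: contraTneq ij => ->; rewrite ltnn.
have := h _ (lin_at_point k nij); rewrite lin_meval => /eqP; rewrite subr_eq0 => /eqP e.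
have := congr1 Num.norm e; rewrite normrM norm_zX mul1r !lin_point_norm => /eqP.
(* At the chosen point the absolute value is 1 at [i] and [j], and elsewhere the values are distinct
   and at least 2. Only [i' = i], [j' = j] survives, and comparing powers of [z] gives [k' = k]. *)
case: ifP => hi'; case: ifP => hj'; rewrite ?natSS_eq1 1?eq_sym ?natSS_eq1 //.
  move: e => + _; case/orP: hi' => /eqP ei; case/orP: hj' => /eqP ej; subst i' j';
    rewrite ?ltnn // in ij'; last by have := ltn_trans ij ij'; rewrite ltnn.
  rewrite /lin_point eqxx [j == i]eq_sym (negPf nij) eqxx mulr1 => /eqP.
  rewrite (eq_prim_root_expr zP) !modn_small // => /eqP/ord_inj ek.
  by rewrite ek eqxx in ne.
by rewrite eqr_nat !eqSS => /eqP ei; rewrite ei ltnn in ij'.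
Qed.

Lemma X_subst i : (0 : S) \mPo subst_tuple i 0 = 0.
Proof. exact: rmorph0. Qed.

Lemma X_prime i : prime_elt ('X_i : S).
Proof. by rewrite -['X_i]subr0; apply/prime_linear/X_subst. Qed.

Lemma X_ndvd1 i : ~ rdvd ('X_i : S) 1.
Proof. by rewrite -['X_i]subr0; apply/linear_ndvd1/X_subst. Qed.

(** A zero of ['X_i] whose other coordinates have distinct nonzero absolute values, hence on no
    other hyperplane. *)
Definition X_point i (m : 'I_l) : K := if m == i then 0 else m.+2%:R.

Lemma X_ndvdX i m : i != m -> ~ rdvd ('X_i : S) 'X_m.
Proof.
move=> im /(@rdvd_meval _ _ _ _ (X_point i)); rewrite !mevalXU /X_point eqxx.
by rewrite eq_sym (negPf im) => /(_ erefl) /eqP; rewrite pnatr_eq0.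
Qed.

Lemma X_ndvd_lin i i' j' k : (i' < j')%N -> ~ rdvd ('X_i : S) (lin i' j' k).
Proof.
move=> ij' /(@rdvd_meval _ _ _ _ (X_point i)); rewrite mevalXU lin_meval /X_point eqxx.
move=> /(_ erefl) /eqP; rewrite subr_eq0 => /eqP /(congr1 Num.norm) /eqP.
rewrite normrM norm_zX mul1r; case: ifP => [/eqP ei|_]; case: ifP => [/eqP ej|_].
- by rewrite ei ej ltnn in ij'.
- by rewrite normr0 eq_sym normr_eq0 pnatr_eq0.
- by rewrite normr0 normr_eq0 pnatr_eq0.
- by rewrite !normr_nat eqr_nat !eqSS => /eqP ei; rewrite ei ltnn in ij'.
Qed.

Lemma mpolyX_neq0 i : ('X_i : S) != 0.
Proof.
apply/eqP => /(congr1 (meval (fun=> 1))) /eqP.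
by rewrite mevalXU meval0 oner_eq0.
Qed.

Lemma lin_neq0 i j k : i != j -> lin i j k != 0.
Proof.
move=> ij; apply/eqP => /(congr1 (meval (fun m => (m == i)%:R))).
rewrite lin_meval meval0 eqxx [j == i]eq_sym (negPf ij) mulr0 subr0 => /eqP.
by rewrite oner_eq0.
Qed.

Local Notation idx := ('I_l + 'I_l * 'I_l * 'I_r)%type.

Definition idx_form (x : idx) : S :=
  match x with inl i => 'X_i | inr (i, j, k) => lin i j k end.
Definition idx_mult (b n : nat) (x : idx) : nat := if x is inl _ then b else n.
Definition idx_good (x : idx) : bool :=
  if x is inr (i, j, _) then (i < j)%N else true.
(** The defining polynomial of the multi-arrangement with multiplicity [b] on the coordinate
    hyperplanes and [n] on the others; [b = 0] covers the arrangements without coordinate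
    hyperplanes. *)
Definition saito_det b n : S :=
  \prod_(x : idx | idx_good x) idx_form x ^+ idx_mult b n x.

Lemma saito_detE b n :
  saito_det b n = \prod_(x <- filter idx_good (index_enum {: idx})) idx_form x ^+ idx_mult b n x.
Proof. by rewrite big_filter. Qed.

Lemma idx_form_ndvd x y : idx_good x -> idx_good y -> x != y ->
  ~ rdvd (idx_form x) (idx_form y).
Proof.
case: x => [i|[[i j] k]]; case: y => [i'|[[i' j'] k']] //=.
- by move=> _ _ ne; apply: X_ndvdX; apply: contraNneq ne => ->.
- by move=> _ ij' _; apply: X_ndvd_lin.
- move=> ij _ _; apply: lin_ndvdX.
  by apply: contraTneq ij => ->; rewrite ltnn.
- by move=> ij ij' ne; apply: lin_ndvd_lin.
Qed.

Lemma saito_det_dvd b n p :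
  (forall i, rdvd ('X_i ^+ b) p) ->
  (forall i j (k : 'I_r), (i < j)%N -> rdvd (lin i j k ^+ n) p) ->
  rdvd (saito_det b n) p.
Proof.
move=> hX hl; rewrite saito_detE.
apply: prod_primes_dvd => [|[i|[[i j] k]]|x y|[i|[[i j] k]]];
  rewrite ?mem_filter ?mem_index_enum ?andbT.
- by rewrite filter_uniq // index_enum_uniq.
- by move=> _; split; [exact: mpolyX_neq0|split; [exact: X_prime|exact: X_ndvd1]].
- rewrite /= => ij; have nij : i != j by apply: contraTneq ij => ->; rewrite ltnn.
  by split; [exact: lin_neq0|split; [exact: lin_prime|exact: lin_ndvd1]].
- by move=> gx gy; apply: idx_form_ndvd.
- by move=> _; apply: hX.
- by move=> ij; apply: hl.
Qed.

Lemma sum_ltn_ord : (\sum_(i < l) \sum_(j < l) (i < j) = 'C(l, 2))%N.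
Proof.
rewrite exchange_big /= -bin2_sum big_mkord; apply: eq_bigr => j _.
rewrite -big_mkcond /= sum1dep_card -[RHS]card_ord -!sum1_card.
rewrite (big_ord_widen_cond l (fun=> true) (fun=> 1%N)) 1?ltnW //.
by apply: eq_bigl => i; rewrite inE.
Qed.

Lemma lin_homog i j k : lin i j k \is 1.-homog.
Proof. by apply: rpredB; rewrite ?dhomogZ // homogU. Qed.

Lemma saito_det_homog b n :
  saito_det b n \is (l * b + n * r * 'C(l, 2))%N.-homog.
Proof.
have -> : (l * b + n * r * 'C(l, 2) =
           \sum_(x : idx | idx_good x) 1 * idx_mult b n x)%N.
  rewrite big_mkcond /= big_sumType /=; congr (_ + _)%N.
    by rewrite big_const_ord iter_addn_0 mul1n mulnC.
  transitivity (\sum_(i < l) \sum_(j < l) \sum_(k < r) if (i < j)%N then 1 * n else 0)%N.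
    rewrite -sum_ltn_ord big_distrr; apply: eq_bigr => i _ /=.
    rewrite big_distrr; apply: eq_bigr => j _ /=.
    rewrite big_const_ord iter_addn_0; case: (i < j)%N; lia.
  by rewrite pair_bigA pair_bigA /=; apply: eq_bigr => -[[i j] k] _.
apply: homog_prod => -[i|[[i j] k]] _; apply: homogX; [exact: homogU|exact: lin_homog].
Qed.

(** For [tau = 1] these are the conditions on a derivation; for [n = 1] and general [tau] they say
    that the vector is proportional to (z^(k tau), 1) in positions i, j along x_i = z^k x_j. *)
Definition saito_cond b n (tau : nat) (eta : 'rV[S]_l) : Prop :=
  (forall i, rdvd ('X_i ^+ b) (eta 0 i)) /\
  (forall i j (k : nat), (i < j)%N ->
     rdvd (lin i j k ^+ n) (eta 0 i - z ^+ (k * tau) *: eta 0 j)).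

(** Modulo each factor the matrix has an explicit kernel vector: e_i modulo the power of x_i, and
    e_i - z^(k tau) e_j modulo the power of [lin i j k]. *)
Lemma saito_cond_det_dvd b n tau (B : 'M[S]_l) :
  (forall t, saito_cond b n tau (row t B)) -> rdvd (saito_det b n) (\det B).
Proof.
move=> hB; apply: saito_det_dvd => [i|i j k ij].
  pose a := delta_mx i 0 : 'cV[S]_l.
  apply: (det_dvd_kernel (a := a) (i0 := i)) => [|t]; first by rewrite mxE !eqxx unitr1.
  by rewrite -colE mxE; have [/(_ i)] := hB t; rewrite mxE.
have nij : i != j by apply: contraTneq ij => ->; rewrite ltnn.
pose a := delta_mx i 0 - (z ^+ (k * tau))%:MP *: delta_mx j 0 : 'cV[S]_l.
apply: (det_dvd_kernel (a := a) (i0 := i)) => [|t].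
  by rewrite !mxE !eqxx (negPf nij) mulr0 subr0 unitr1.
rewrite mulmxBr -scalemxAr -!colE !mxE mul_mpolyC.
by have [_ /(_ i j k ij)] := hB t; rewrite !mxE.
Qed.

(** The degree sum makes [\det B] a constant multiple of [saito_det b n]. Replacing a row by [eta]
    preserves the condition, so [saito_det b n] divides every Cramer numerator too. *)
Theorem saito_criterion b n tau (B : 'M[S]_l) (d : 'I_l -> nat) :
  (forall t, saito_cond b n tau (row t B)) ->
  (forall t i, B t i \is (d t).-homog) ->
  (\sum_t d t = l * b + n * r * 'C(l, 2))%N ->
  \det B != 0 ->
  forall eta, saito_cond b n tau eta -> exists! c : 'rV[S]_l, eta = c *m B.
Proof.
move=> hB hd sd dB eta heta; apply: cramer_comb => // t.
have hdet := homog_det hd; rewrite sd in hdet.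
have [c c0 ->] := homog_dvd_const (saito_det_homog b n) hdet dB (saito_cond_det_dvd hB).
have [u ->] : rdvd (saito_det b n)
    (\det (\matrix_(i, j) if i == t then eta 0 j else B i j)).
  apply: (@saito_cond_det_dvd _ _ tau) => i.
  case: (eqVneq i t) => [->|it]; last first.
    suff -> : row i (\matrix_(i, j) (if i == t then eta 0 j else B i j)) = row i B by [].
    by apply/rowP => j; rewrite !mxE (negPf it).
  suff -> : row t (\matrix_(i, j) (if i == t then eta 0 j else B i j)) = eta by [].
  by apply/rowP => j; rewrite !mxE eqxx.
exists (c^-1 *: u); rewrite -scalerAl -scalerAr scalerA mulVf // scale1r //.
Qed.

End Saito.
End Saito.

(** * Formal integrals *)

(* The weights [w q] are formal values of [int_0^1 t^(q + b - 1) dt]; this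
   makes sense for all [b] outside of the nonpositive integers, so that no
   Laurent polynomial is needed. *)
Definition wev (R : comNzRingType) (w : nat -> R) (y : R) (P : {poly R}) : R :=
  \sum_(q < size P) w q * (P`_q * y ^+ q).

Section WeightedEvaluation.
Variables (R : comNzRingType).
Implicit Types (w : nat -> R) (y c : R) (P Q : {poly R}).

Lemma wevE n w y P : (size P <= n)%N -> wev w y P = \sum_(q < n) w q * (P`_q * y ^+ q).
Proof.
move=> hn; rewrite /wev (big_ord_widen n (fun q => w q * (P`_q * y ^+ q)) hn) big_mkcond.
apply: eq_bigr => q _; case: ltnP => // h; by rewrite nth_default // mul0r mulr0.
Qed.

Lemma wevD w y P Q : wev w y (P + Q) = wev w y P + wev w y Q.
Proof.
pose n := maxn (size P) (size Q).
rewrite !(@wevE n) ?leq_maxl ?leq_maxr ?(leq_trans (size_polyD _ _)) //.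
by rewrite -big_split; apply: eq_bigr => q _ /=; rewrite coefD mulrDl mulrDr.
Qed.

Lemma wevZ w y c P : wev w y (c *: P) = c * wev w y P.
Proof.
rewrite !(@wevE (size P)) ?size_scale_leq // mulr_sumr.
by apply: eq_bigr => q _; rewrite coefZ; ring.
Qed.

Lemma wev_sum w y (I : Type) (s : seq I) (P : pred I) (F : I -> {poly R}) :
  wev w y (\sum_(i <- s | P i) F i) = \sum_(i <- s | P i) wev w y (F i).
Proof.
apply: (big_morph (wev w y) (wevD w y)).
by rewrite /wev size_poly0 big_ord0.
Qed.

Lemma wevX w y P : wev w y ('X * P) = y * wev (fun q => w q.+1) y P.
Proof.
rewrite (@wevE (size P).+1); last first.
  by rewrite (leq_trans (size_polyMleq _ _)) // size_polyX.
rewrite big_ord_recl coefXM mul0r mulr0 add0r (@wevE (size P)) // mulr_sumr.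
apply: eq_bigr => q _; rewrite coefXM /= exprS; ring.
Qed.

Lemma wevXn w y n P : wev w y ('X^n * P) = y ^+ n * wev (fun q => w (n + q)%N) y P.
Proof.
elim: n w => [|n IH] w; first by rewrite expr0 !mul1r.
by rewrite exprS -mulrA wevX IH exprS mulrA.
Qed.

Lemma wevC w y c : wev w y c%:P = w 0%N * c.
Proof.
by rewrite (@wevE 1) ?size_polyC_leq1 // big_ord1 coefC /= expr0 mulr1.
Qed.

Lemma eq_wev w w' y P : w =1 w' -> wev w y P = wev w' y P.
Proof. by move=> e; apply: eq_bigr => q _; rewrite e. Qed.

(** The formal counterpart of rescaling the integration variable. *)
Lemma wev_dilate w y P : wev w y P = wev w 1 (P \Po (y *: 'X)).
Proof.
have hc q : (P \Po (y *: 'X))`_q = P`_q * y ^+ q.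
  rewrite coef_comp_poly; under eq_bigr => i _ do
    rewrite exprZn coefZ coefXn mulrA.
  case: (ltnP q (size P)) => [hq|hq].
    rewrite (bigD1 (Ordinal hq)) //= eqxx big1 ?addr0 ?mulr1 // => i ne.
    by rewrite (_ : (q == i) = false) ?mulr0 //; apply: contraNF ne => /eqP e; apply/eqP/val_inj.
  rewrite nth_default // mul0r big1 // => i _.
  by rewrite gtn_eqF ?mulr0 //; apply: leq_trans hq.
rewrite (@wevE (size P) w 1); first by apply: eq_bigr => q _; rewrite hc expr1n mulr1.
by apply/leq_sizeP => q hq; rewrite hc nth_default ?mul0r.
Qed.

(** The fundamental theorem of calculus on [0,1]: t^beta P(y t^rho) has derivative t^(beta-1) times
    (beta P + rho X P')(y t^rho). *)
Lemma wev_boundary w y (beta rho : R) P :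
  (forall q, w q * (beta + rho * q%:R) = 1) ->
  wev w y (beta *: P + rho *: ('X * P^`())) = P.[y].
Proof.
move=> hw; rewrite (@wevE (size P)); last first.
  apply/leq_sizeP => q hq; rewrite coefD !coefZ coefXM (nth_default _ hq) mulr0 add0r.
  case: q hq => [|q] hq; rewrite ?mulr0 //= coef_deriv nth_default ?mul0rn ?mulr0 //.
rewrite horner_coef; apply: eq_bigr => q _; rewrite coefD !coefZ coefXM.
rewrite -[RHS]mul1r -[X in _ = X * _](hw q); case: (nat_of_ord q) => [|n] /=; first by rewrite expr0; ring.
by rewrite coef_deriv -mulr_natr; ring.
Qed.

Lemma wev_deriv w P : (forall q, w q * q.+1%:R = 1) -> wev w 1 P^`() = P.[1] - P.[0].
Proof.
move=> hw; rewrite (@wevE (size P)); last first.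
  by rewrite (leq_trans (size_poly _ _)) // leq_pred.
rewrite (@horner_coef_wide _ (size P).+1) // big_ord_recl horner_coef0 expr0 mulr1 addrC addKr.
apply: eq_bigr => q _; rewrite coef_deriv -mulr_natr !expr1n !mulr1 /= -[RHS]mulr1 -[X in _ = _ * X](hw q).
by rewrite /bump leq0n; ring.
Qed.

End WeightedEvaluation.

Lemma rmorph_wev (R R' : comNzRingType) (f : {rmorphism R -> R'}) w y P :
  f (wev w y P) = wev (f \o w) (f y) (map_poly f P).
Proof.
rewrite (@wevE _ (size P) (f \o w)) ?map_polyE ?(leq_trans (size_Poly _)) ?size_map // {1}/wev rmorph_sum.
apply: eq_bigr => q _; by rewrite -map_polyE !rmorphM rmorphXn /= coef_map.
Qed.

Section DivisibilityOfIntegrals.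
Variables (R : idomainType) (r : nat) (w : nat -> nat -> R) (wi : nat -> R).
Hypothesis hw : forall n q, w n q * (1 - (r * n)%:R + r%:R * q%:R) = 1.
Hypothesis hwi : forall q, wi q * q.+1%:R = 1.
Variables (x y : R).
Hypothesis (x0 : x != 0) (y0 : y != 0).
Implicit Types (P Q T : {poly R}).

(** Along the segment from [y] to [x] both linear factors of the derivative are multiples of x - y,
    and so is the velocity; this accounts for the exponent mi + mj + 1. *)
Lemma taylor_dvd T Q (mi mj : nat) :
  T^`() = ('X - x%:P) ^+ mi * ('X - y%:P) ^+ mj * Q ->
  rdvd ((x - y) ^+ (mi + mj + 1)) (T.[x] - T.[y]).
Proof.
move=> hT; pose lam : {poly R} := (x - y) *: 'X + y%:P.
have -> : T.[x] - T.[y] = (T \Po lam).[1] - (T \Po lam).[0].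
  by rewrite !horner_comp /lam !hornerE; congr (T.[_] - T.[_]); ring.
rewrite -(wev_deriv _ hwi) deriv_comp hT.
have -> : lam^`() = (x - y)%:P by rewrite /lam derivD derivZ derivX derivC addr0 alg_polyC.
rewrite !comp_polyM !rmorphXn /= !comp_polyB !comp_polyX !comp_polyC.
have -> : lam - x%:P = (x - y)%:P * ('X - 1).
  by rewrite /lam -mul_polyC polyCB; ring.
have -> : lam - y%:P = (x - y)%:P * 'X by rewrite /lam -mul_polyC; ring.
exists (wev wi 1 (('X - 1) ^+ mi * 'X ^+ mj * (Q \Po lam))).
rewrite [RHS]mulrC -wevZ; congr (wev wi 1 _).
by rewrite -mul_polyC rmorphXn /= !exprMn !exprD expr1; ring.
Qed.

(* Here [w n q] is [1 / (1 - rn + rq)], and [x * wev (w n) (x ^+ r) P] is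
   [x^(rn)] times the integral of [t^(-rn) P(t^r)] from 0 to [x]. *)
Definition int_diff n P :=
  x * (y ^+ r) ^+ n * wev (w n) (x ^+ r) P - y * (x ^+ r) ^+ n * wev (w n) (y ^+ r) P.

(** The equation defining the weights is unchanged when [n] and [q] both grow by 1; this is why a
    factor ['X] of the integrand lowers the order of its pole ([int_diffX]). *)
Lemma wS n q : w n.+1 q.+1 = w n q.
Proof.
have e : 1 - (r * n.+1)%:R + r%:R * q.+1%:R = 1 - (r * n)%:R + r%:R * q%:R :> R.
  by rewrite !natrM -!natr1; ring.
have h := hw n.+1 q.+1; rewrite e in h.
by rewrite -[LHS]mulr1 -(hw n q) mulrCA h mulr1.
Qed.

Lemma int_diffD n P Q : int_diff n (P + Q) = int_diff n P + int_diff n Q.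
Proof. by rewrite /int_diff !wevD; ring. Qed.

Lemma int_diffZ n c P : int_diff n (c *: P) = c * int_diff n P.
Proof. by rewrite /int_diff !wevZ; ring. Qed.

Lemma int_diffX n P : int_diff n.+1 ('X * P) = x ^+ r * y ^+ r * int_diff n P.
Proof.
rewrite /int_diff !wevX !(eq_wev _ _ (w' := w n)); try exact: wS.
by rewrite !exprS; ring.
Qed.

(* For [n = 0] this is Taylor's formula; integrating by parts a multiple of [M]
   whose boundary terms vanish lowers [n], that is, the order of the pole of the
   integrand at 0. *)
Lemma int_diff_dvd n (mi mj : nat) Q :
  rdvd ((x - y) ^+ (mi + mj + 1))
    (int_diff n (('X - (x ^+ r)%:P) ^+ mi * ('X - (y ^+ r)%:P) ^+ mj * Q)).
Proof.
set A := 'X - (x ^+ r)%:P; set B := 'X - (y ^+ r)%:P.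
elim: n Q => [|n IH] Q.
  set P := _ * Q; rewrite /int_diff !expr0 !mulr1.
  (* An antiderivative of P(t^r), the weight [w 0 q] being 1/(1 + rq). *)
  pose T : {poly R} := \sum_(q < size P) (w 0 q * P`_q) *: 'X^((r * q).+1).
  have hT v : v * wev (w 0) (v ^+ r) P = T.[v].
    rewrite /T horner_sum /wev mulr_sumr; apply: eq_bigr => q _.
    by rewrite hornerZ hornerXn exprS exprM; ring.
  rewrite !hT.
  have dT : T^`() = P \Po 'X^r.
    rewrite comp_polyE /T raddf_sum; apply: eq_bigr => q _.
    rewrite /= derivZ derivXn -scaler_nat scalerA /= -exprM mulrAC.
    by congr (_ *: _); rewrite -[RHS]mul1r -[X in _ = X * _](hw 0 q) muln0 subr0 -natr1 natrM; ring.
  have hAB (v : R) : exists C, 'X^r - (v ^+ r)%:P = ('X - v%:P) * C.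
    by eexists; rewrite polyC_exp subrXX.
  have [C hC] := hAB x; have [D hD] := hAB y.
  apply: (@taylor_dvd _ (C ^+ mi * D ^+ mj * (Q \Po 'X^r))).
  rewrite dT /P !comp_polyM !rmorphXn /= !comp_polyB !comp_polyX !comp_polyC hC hD !exprMn.
  by ring.
set M := A ^+ mi * B ^+ mj.
(* [P] vanishes at x^r and y^r, so the integral of its derivative term [M * C] contributes 0. As a
   polynomial in ['X], [C] has constant term beta x^r y^r; the remainder carries a factor ['X] and
   falls under the induction hypothesis, and [beta] has the inverse [w n.+1 0]. *)
have hM1 : rdvd ((x - y) ^+ (mi + mj + 1)) (int_diff n.+1 M).
  pose beta : R := 1 - (r * n.+1)%:R.
  pose P := M * (A * B).
  pose C := beta *: (A * B) + r%:R *: ('X * ((mi.+1)%:R *: B + (mj.+1)%:R *: A)).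
  have hP : beta *: P + r%:R *: ('X * P^`()) = M * C.
    rewrite /P /C /M; have -> : A ^+ mi * B ^+ mj * (A * B) = A ^+ mi.+1 * B ^+ mj.+1.
      by rewrite !exprS; ring.
    rewrite derivM !deriv_exp.
    have -> : A^`() = 1 by rewrite /A derivB derivX derivC subr0.
    have -> : B^`() = 1 by rewrite /B derivB derivX derivC subr0.
    rewrite -[_ *+ mi.+1]mulr_natr -[_ *+ mj.+1]mulr_natr -!mul_polyC !polyC_natr /= !exprS.
    by clearbody A B; ring.
  have z : int_diff n.+1 (M * C) = 0.
    rewrite -hP /int_diff !wev_boundary; [|exact: hw|exact: hw].
    by rewrite /P !hornerM /A /B !hornerXsubC !subrr !(mulr0, mul0r) subrr.
  pose C' := beta *: ('X - (x ^+ r)%:P - (y ^+ r)%:P) + r%:R *: ((mi.+1)%:R *: B + (mj.+1)%:R *: A).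
  have hC : M * C = (beta * (x ^+ r * y ^+ r)) *: M + 'X * (M * C').
    rewrite /C /C' /A /B -!mul_polyC !polyCM; ring.
  move: z; rewrite hC int_diffD int_diffZ int_diffX -/beta => z.
  have e : beta * int_diff n.+1 M = - int_diff n (M * C').
    apply: (mulfI (x := x ^+ r * y ^+ r)); first by rewrite mulf_neq0 ?expf_neq0.
    by apply/eqP; rewrite -subr_eq0; apply/eqP; rewrite -[RHS]z; ring.
  have -> : int_diff n.+1 M = w n.+1 0 * (beta * int_diff n.+1 M).
    by rewrite mulrA; have := hw n.+1 0; rewrite mulr0 addr0 => ->; rewrite mul1r.
  by rewrite e; apply/rdvd_mull/rdvdN/IH.
(* The multiple of ['X] is handled by induction, the constant by [hM1]. *)
have [Q' [c ->]] : exists Q' c, Q = 'X * Q' + c%:P.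
  by elim/poly_ind: Q => [|Q' c _]; [exists 0, 0; rewrite mulr0 add0r | exists Q', c; rewrite mulrC].
have -> : M * ('X * Q' + c%:P) = 'X * (M * Q') + c *: M by rewrite -mul_polyC; ring.
rewrite int_diffD int_diffX int_diffZ; apply: rdvdD; apply: rdvd_mull => //.
Qed.

End DivisibilityOfIntegrals.

Lemma comp_poly_exp (R : comNzRingType) (P Q : {poly R}) n :
  (P ^+ n) \Po Q = (P \Po Q) ^+ n.
Proof. exact: rmorphXn (comp_poly Q) n P. Qed.

(** Rescaling the variable by [X i] turns the factor of index [i] into a multiple of ['X - 1], so
    that a power of [X i] comes out. *)
Lemma wev_prod_root (R : comNzRingType) (w : nat -> R) l N (mm : 'I_l -> nat) (X : 'I_l -> R) i :
  wev w (X i) ('X^N * \prod_k ('X - (X k)%:P) ^+ mm k) =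
  X i ^+ (N + mm i) * wev w 1 ('X^N * ('X - 1) ^+ mm i *
    \prod_(k < l | k != i) (X i *: 'X - (X k)%:P) ^+ mm k).
Proof.
have hk k : (('X - (X k)%:P) ^+ mm k) \Po (X i *: 'X) = (X i *: 'X - (X k)%:P) ^+ mm k.
  by rewrite comp_poly_exp comp_polyB comp_polyX comp_polyC.
rewrite wev_dilate -wevZ; congr (wev _ _ _).
rewrite comp_polyM comp_poly_exp comp_polyX rmorph_prod /=.
under eq_bigr => k _ do rewrite hk.
rewrite (bigD1 i) //=.
have -> : X i *: 'X - (X i)%:P = (X i)%:P * ('X - 1) by rewrite -mul_polyC; ring.
by rewrite -!mul_polyC !exprMn exprD polyCM !polyC_exp; ring.
Qed.

Lemma prod_root_split (R : comNzRingType) l N (mm : 'I_l -> nat) (X : 'I_l -> R) i j :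
  i != j -> exists Q : {poly R}, 'X^N * \prod_k ('X - (X k)%:P) ^+ mm k =
    ('X - (X i)%:P) ^+ mm i * ('X - (X j)%:P) ^+ mm j * Q.
Proof.
move=> ij; exists ('X^N * \prod_(k < l | (k != i) && (k != j)) ('X - (X k)%:P) ^+ mm k).
by rewrite (bigD1 i) //= (bigD1 j) 1?eq_sym //= mulrA [in LHS]mulrCA -!mulrA mulrCA.
Qed.

Lemma nonzero_eval_neq0 (K : numFieldType) (p : {poly K}) :
  p != 0 -> exists2 t, t != 0 & p.[t] != 0.
Proof.
move=> p0; pose s := [seq n.+1%:R : K | n <- iota 0 (size p)].
have us : uniq s.
  rewrite map_inj_uniq ?iota_uniq // => a b /eqP.
  by rewrite eqr_nat => /eqP[].
have /allPn[t ts nt] : ~~ all (root p) s.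
  apply/negP => /(max_poly_roots p0) /(_ us).
  by rewrite size_map size_iota ltnn.
by exists t => //; case/mapP: ts => n _ ->; rewrite pnatr_eq0.
Qed.

(** By [wev_prod_root], row [i] consists of the formal integrals of t^(N+j) prod_k (t - X_k)^m up to
    [X i], with the common factor X_i^(N+m) removed. The entries thus remain useful when a variable
    is 0. *)
Definition int_mx (R : comNzRingType) (w : nat -> R) (l m N : nat) (X : 'I_l -> R) : 'M[R]_l :=
  \matrix_(i, j) (X i ^+ j * wev w 1 ('X^(N + j) * ('X - 1) ^+ m *
     \prod_(k < l | k != i) (X i *: 'X - (X k)%:P) ^+ m)).

Lemma map_int_mx (R R' : comNzRingType) (f : {rmorphism R -> R'}) w l m N (X : 'I_l -> R) :
  map_mx f (int_mx w m N X) = int_mx (f \o w) m N (f \o X).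
Proof.
apply/matrixP => i j; rewrite !mxE rmorphM rmorphXn rmorph_wev rmorph1; congr (_ * wev _ _ _).
rewrite !rmorphM rmorph_prod !rmorphXn /= rmorphB /= map_polyX rmorph1; congr (_ * _).
apply: eq_bigr => k _; rewrite rmorphXn rmorphB /= map_polyC map_polyZ map_polyX //.
Qed.

Section NonVanishing.
Variables (K : numFieldType) (w : nat -> K) (beta rho : K).
Hypothesis hw : forall q, w q * (beta + rho * q%:R) = 1.
Hypothesis rho0 : rho != 0.

(** A value of the Beta function: integration by parts lowers [m] and raises [N], until a weight is
    reached. *)
Lemma beta_integral_neq0 (m N : nat) : wev w 1 ('X^N * ('X - 1) ^+ m) != 0.
Proof.
have cst c q : w q * c = 1 -> w q != 0 /\ c != 0.
  by move/eqP => h; split; apply: contraTneq h => ->; rewrite ?mul0r ?mulr0 eq_sym oner_eq0.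
elim: m N => [|m IH] N.
  rewrite expr0 mulr1 -['X^N]mulr1 wevXn -[1 in X in wev _ _ X]/(1%:P) wevC expr1n mul1r mulr1 addn0.
  by have [] := cst _ _ (hw N).
pose P : {poly K} := 'X^N * ('X - 1) ^+ m.+1.
have hP : beta *: P + rho *: ('X * P^`()) =
    (beta + rho * N%:R) *: P + (rho * m.+1%:R) *: ('X^(N.+1) * ('X - 1) ^+ m).
  rewrite /P derivM derivXn deriv_exp derivB derivX derivC subr0 /=.
  rewrite -[_ *+ N]mulr_natr -[_ *+ m.+1]mulr_natr -!mul_polyC !polyCD !polyCM !polyC_natr.
  by clear P; rewrite !exprS; case: N => [|N] /=; rewrite ?exprS; ring.
have P1 : P.[1] = 0 by rewrite /P hornerM horner_exp; rewrite !hornerE subrr expr0n mulr0.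
have := wev_boundary 1 P hw; rewrite hP wevD !wevZ P1 => /eqP.
rewrite addr_eq0 => /eqP h; apply/negP => /eqP h0.
move: h; rewrite -/P h0 mulr0 => /esym/eqP; rewrite oppr_eq0 mulf_eq0 (negPf (IH _)) orbF.
by rewrite mulf_eq0 (negPf rho0) pnatr_eq0.
Qed.

(* Where the first variable is 0, the determinant is up to a nonzero factor the
   same one for the other [l] variables and [N + 1 + m]; so it is nonzero there,
   hence also at some nonzero value of the first variable. *)
Theorem int_mx_nonsingular (l m N : nat) :
  exists X : 'I_l -> K, (forall i, X i != 0) /\ \det (int_mx w m N X) != 0.
Proof.
elim: l N => [|l IH] N.
  by exists (fun=> 1); split=> [[]//|]; rewrite det_mx00 oner_eq0.
(* The new value of [N]: each other row gains t^m from the factor of the vanishing variable, and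
   deleting column 0 raises the exponent of t by 1. *)
have [X [X0 dX]] := IH (N.+1 + m)%N.
pose Y (i : 'I_l.+1) : {poly K} := if unlift ord0 i is Some j then (X j)%:P else 'X.
pose d := \det (int_mx (polyC \o w) m N Y).
have hd t : d.[t] = \det (int_mx w m N (fun i => (Y i).[t])).
  rewrite /d -/(horner_eval t _) -det_map_mx map_int_mx; congr (\det _).
  apply/matrixP => i j; rewrite !mxE; congr (_ * _).
  by apply: eq_wev => q; rewrite /= /horner_eval hornerC.
suff d0 : d.[0] != 0.
  have /nonzero_eval_neq0[t t0 dt] : d != 0.
    by apply: contraNneq d0 => ->; rewrite horner0.
  exists (fun i => (Y i).[t]); rewrite -hd; split=> // i.
  by rewrite /Y; case: unliftP => [j|] _; rewrite ?hornerC ?hornerX.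
rewrite hd; set Z := fun i => (Y i).[0].
have Z0 : Z ord0 = 0 by rewrite /Z /Y unlift_none hornerX.
have Zl j : Z (lift ord0 j) = X j by rewrite /Z /Y liftK hornerC.
(* The powers of the vanishing variable leave only the entry in column 0 of this row, a Beta value
   times powers of the other variables. *)
rewrite (expand_det_row _ ord0) big_ord_recl [X in _ + X]big1 => [|j _]; last first.
  by rewrite mxE Z0 expr0n /= !mul0r.
rewrite addr0 mulf_neq0 //.
  rewrite mxE expr0 mul1r addn0 Z0.
  rewrite (eq_bigr (fun k => ((- Z k) ^+ m)%:P)); last first.
    by move=> k _; rewrite scale0r sub0r -polyCN polyC_exp.
  rewrite -rmorph_prod /= mulrC mul_polyC wevZ mulf_neq0 ?beta_integral_neq0 //.
  apply/prodf_neq0 => k; case: (unliftP ord0 k) => [j ->|->]; rewrite ?eqxx // => _.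
  by rewrite Zl expf_neq0 // oppr_eq0.
rewrite /cofactor addn0 expr0 mul1r.
have -> : row' ord0 (col' ord0 (int_mx w m N Z)) =
    diag_mx (\row_i X i ^+ m.+1) *m int_mx w m (N.+1 + m) X.
  apply/matrixP => i j; rewrite mul_diag_mx !mxE Zl.
  rewrite (bigD1 ord0) //= big_mkcond big_ord_recl eqxx /= mul1r.
  rewrite Z0 subr0 exprZn -scalerAl -scalerAr wevZ.
  rewrite /bump /= add1n exprS exprSr.
  have -> : 'X^(N.+1 + m + j) = 'X^(N + j.+1) * 'X^m :> {poly K} by rewrite -exprD; congr (_ ^+ _); lia.
  rewrite [in RHS]big_mkcond /=.
  under eq_bigr => k _ do rewrite andbT (inj_eq lift_inj) Zl.
  rewrite mulrA [RHS]mulrA; congr (_ * wev _ _ _); first by ring.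
  by rewrite !mulrA; congr (_ * _); rewrite mulrAC.
rewrite det_mulmx det_diag mulf_neq0 //; apply/prodf_neq0 => i _.
by rewrite mxE expf_neq0.
Qed.

End NonVanishing.

(** * Bases of derivations *)

Module Bases.
Import mpoly Saito.

Section Bases.
Variables (K : numClosedFieldType) (l r : nat) (z : K).
Hypothesis zP : r.-primitive_root z.
Hypothesis r2 : (2 <= r)%N.
Local Notation S := {mpoly K[l]}.
Implicit Types (i j : 'I_l).
Local Notation lin := (@lin K l z).
Local Notation x := (fun i : 'I_l => ('X_i : S)).

Definition wK (n q : nat) : K := (1 - (r * n)%:R + r%:R * q%:R)^-1.

(** The denominator is congruent to 1 modulo r, hence nonzero since r >= 2. *)
Lemma wKP n q : wK n q * (1 - (r * n)%:R + r%:R * q%:R) = 1.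
Proof.
rewrite mulVf // -natrM addrAC -[1]/(1%:R) -natrD subr_eq0 eqr_nat.
by apply/negP => /eqP /(congr1 (modn^~ r)); rewrite modnMr addnC mulnC modnMDl modn_small.
Qed.

Definition wS (n q : nat) : S := (wK n q)%:MP.

Lemma wSP n q : wS n q * (1 - (r * n)%:R + r%:R * q%:R) = 1.
Proof.
by rewrite /wS -[RHS]mpolyC1 -(wKP n q) mpolyCM !(mpolyCD, mpolyCM, mpolyCN, mpolyC_nat, mpolyC1).
Qed.

Lemma wS1P q : (q.+1%:R^-1)%:MP * q.+1%:R = 1 :> S.
Proof. by rewrite -mpolyC_nat -mpolyCM mulVf ?mpolyC1 // pnatr_eq0. Qed.

(** What is left of the integral up to x_i^r once its power of x_i^r is removed ([gw_int]). As a
    polynomial it can be multiplied by the net power of x_i, even when the integrand has a pole. *)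
Definition gw (w : nat -> K) (N : nat) (mm : 'I_l -> nat) i : S :=
  wev (fun q => (w q)%:MP) 1 ('X^N * ('X - 1) ^+ mm i *
    \prod_(k < l | k != i) (x i ^+ r *: 'X - (x k ^+ r)%:P) ^+ mm k).

Lemma gw_int w N mm i :
  wev (fun q => (w q)%:MP) (x i ^+ r) ('X^N * \prod_k ('X - (x k ^+ r)%:P) ^+ mm k) =
  (x i ^+ r) ^+ (N + mm i) * gw w N mm i.
Proof. exact: (wev_prod_root _ _ _ (fun k => 'X_k ^+ r)). Qed.

Definition gi n := gw (wK n).

Lemma gi_int n N mm i :
  wev (wS n) (x i ^+ r) ('X^N * \prod_k ('X - (x k ^+ r)%:P) ^+ mm k) =
  (x i ^+ r) ^+ (N + mm i) * gi n N mm i.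
Proof. exact: gw_int. Qed.

Definition homog_coefs d (P : {poly S}) := forall q, P`_q \is d.-homog.

Lemma homog_coefsM d e P Q :
  homog_coefs d P -> homog_coefs e Q -> homog_coefs (d + e) (P * Q).
Proof. by move=> hP hQ q; rewrite coefM; apply: rpred_sum => i _; apply: homogM. Qed.

Lemma homog_coefsX d n P : homog_coefs d P -> homog_coefs (d * n) (P ^+ n).
Proof.
move=> hP; elim: n => [|n IH]; last by rewrite exprS mulnS; apply: homog_coefsM.
rewrite muln0 => q; rewrite expr0 coef1.
by case: eqP => _; rewrite ?rpred0 // dhomog1.
Qed.

Lemma homog_wev (w : nat -> K) d P : homog_coefs d P ->
  wev (fun q => (w q)%:MP) 1 P \is d.-homog.
Proof.
move=> hP; apply: rpred_sum => q _.
by rewrite expr1n mulr1 mul_mpolyC; apply: dhomogZ.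
Qed.

Lemma homog_coefs0X : homog_coefs 0 'X.
Proof. by move=> q; rewrite coefX; case: eqP => _; rewrite ?rpred0 // dhomog1. Qed.

Lemma homog_coefs01 : homog_coefs 0 1.
Proof. by move=> q; rewrite coef1; case: eqP => _; rewrite ?rpred0 // dhomog1. Qed.

Lemma homog_coefsB d P Q : homog_coefs d P -> homog_coefs d Q -> homog_coefs d (P - Q).
Proof. by move=> hP hQ q; rewrite coefB rpredB. Qed.

Lemma homogUX i n : x i ^+ n \is n.-homog.
Proof. by rewrite -[n in n.-homog]mul1n; apply/homogX/homogU. Qed.

Lemma gw_homog w N mm i d : (r * \sum_(k < l | k != i) mm k = d)%N ->
  gw w N mm i \is d.-homog.
Proof.
move=> <-; apply: homog_wev; rewrite -[(r * _)%N]add0n; apply: homog_coefsM.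
  have h : homog_coefs (0 * N + 0 * mm i) ('X^N * ('X - 1) ^+ mm i).
    by apply: homog_coefsM; apply: homog_coefsX; [exact: homog_coefs0X|];
      apply: homog_coefsB; [exact: homog_coefs0X|exact: homog_coefs01].
  by move: h; rewrite !mul0n.
rewrite big_distrr /=; elim/big_rec2: _ => [|k d1 P _ hP]; first exact: homog_coefs01.
apply: homog_coefsM => //; apply: homog_coefsX; apply: homog_coefsB => q.
  rewrite coefZ coefX; case: eqP => _; rewrite ?mulr0 ?rpred0 // mulr1; exact: homogUX.
by rewrite coefC; case: eqP => _; rewrite ?rpred0 //; exact: homogUX.
Qed.

(** This is [int_diff_dvd] at x_i and z^k x_j; the second has r-th power x_j^r. *)
Lemma gi_diff_dvd n N mm i j k : (i < j)%N ->
  rdvd (lin i j k ^+ (mm i + mm j + 1))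
    (x i * (x j ^+ r) ^+ n * ((x i ^+ r) ^+ (N + mm i) * gi n N mm i) -
     z ^+ k *: x j * (x i ^+ r) ^+ n * ((x j ^+ r) ^+ (N + mm j) * gi n N mm j)).
Proof.
move=> ij; have nij : i != j by apply: contraTneq ij => ->; rewrite ltnn.
rewrite -!gi_int; set P := 'X^N * _.
have zr : (z ^+ k *: x j) ^+ r = x j ^+ r.
  by rewrite exprZn exprAC (prim_expr_order zP) expr1n scale1r.
have [Q hQ] := prod_root_split N mm (fun k => 'X_k ^+ r : S) nij.
have zx : z ^+ k *: x j != 0 :> S.
  rewrite -mul_mpolyC mulf_neq0 ?mpolyX_neq0 // mpolyC_eq0 expf_neq0 //.
  by rewrite -normr_eq0 -[z]expr1 (norm_zX zP) oner_eq0.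
have := int_diff_dvd wSP wS1P (mpolyX_neq0 K i) zx n (mm i) (mm j) Q.
by rewrite /int_diff zr -hQ.
Qed.

Lemma lin_ndvd_XX i j k a b : i != j -> ~ rdvd (lin i j k) ((x i ^+ a * x j ^+ b)).
Proof.
move=> ij; apply: prime_ndvdM; first exact: lin_prime.
  by apply: prime_ndvdX; [exact: lin_prime|exact: lin_ndvd1|exact: (lin_ndvdX zP)].
by apply: prime_ndvdX; [exact: lin_prime|exact: lin_ndvd1|exact: (lin_ndvdX zP)].
Qed.

(** Evaluating at r-th roots of the point given by [int_mx_nonsingular] reduces the claim to
    numbers. *)
Lemma int_mx_neq0 n m N : \det (int_mx (wS n) m N (fun i => x i ^+ r)) != 0.
Proof.
have rK0 : (r%:R : K) != 0 by rewrite pnatr_eq0 -lt0n ltnW.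
have [X [_ dX]] := int_mx_nonsingular (wKP n) rK0 l m N.
apply: contraNneq dX => d0; pose v i := r.-root (X i).
have := congr1 (meval v) d0; rewrite meval0 -det_map_mx map_int_mx => h; apply/eqP; rewrite -[RHS]h.
have vX i : (x i ^+ r).@[v] = X i by rewrite rmorphXn /= mevalXU rootCK // ltnW.
congr (\det _); apply/matrixP => i j; rewrite !mxE /= vX; congr (_ * _).
rewrite (eq_wev (w' := wK n)); last by move=> q; rewrite /= mevalC.
by under [in RHS]eq_bigr => k _ do rewrite vX.
Qed.

(** Here [ai] and [aj] are the monomials that clear negative powers of x_i and x_j; the right-hand
    side is the difference of [gi_diff_dvd] times a common factor. *)
Lemma clear_denominators (R : comNzRingType) (ai bi di fi gi' aj bj dj fj gj' c Z : R) :
  ai * bi = fi * di * c -> aj * bj = fj * dj * c ->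
  ai * aj * (gi' * bi - Z * (gj' * bj)) =
  (fi * aj * (di * gi') - Z * fj * ai * (dj * gj')) * c.
Proof.
move=> e1 e2; transitivity
  ((ai * bi) * (aj * gi') - Z * (aj * bj) * (ai * gj')); first by ring.
by rewrite e1 e2; ring.
Qed.

Lemma regroup_factors (R : comNzRingType) (b c d f g P : R) :
  b * c = d * f -> g * (b * P) * c = d * P * g * f.
Proof. by move=> h; transitivity ((b * c) * (g * P)); [ring | rewrite h; ring]. Qed.

Section OddMultiplicities.
Variables (m e A b : nat).
(** [b] is the multiplicity of the coordinate hyperplanes. The integral for t = 0 begins with x_i^(1
    + r(A-1)), and the equation says that the factor x_i^e brings this exponent to [b]. *)
Hypotheses (er : (e <= r)%N) (hb : (e + 1 + r * A = b + r)%N).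

(* Entry [(t, i)] is the integral from 0 to [x_i] of
   [t^(r(A + t - m - 1)) prod_k (t^r - X_k)^m], times [prod_k x_k^e] for [t = 0]. *)
Definition odd_basis : 'M[S]_l :=
  \matrix_(t, i) (gi m.+1 (A + t) (fun=> m) i *
    if (t : nat) is t'.+1 then x i ^+ (1 + r * (A + t'))
    else x i ^+ b * \prod_(k < l | k != i) x k ^+ e).

Definition odd_degree (t : 'I_l) : nat :=
  r * m * l.-1 + if (t : nat) is t'.+1 then 1 + r * (A + t') else b + e * l.-1.

Lemma card_neq (i : 'I_l) : #|[pred k | k != i]| = l.-1.
Proof. by have := cardC1 i; rewrite card_ord => <-; apply: eq_card => k. Qed.

Lemma odd_basis_homog t i : odd_basis t i \is (odd_degree t).-homog.
Proof.
rewrite mxE /odd_degree; apply: homogM.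
  by apply: gw_homog; rewrite sum_nat_const card_neq; lia.
case: (nat_of_ord t) => [|t']; last exact: homogUX.
apply: homogM; first exact: homogUX.
rewrite mulnC -(card_neq i) -sum_nat_const.
by apply: homog_prod => k _; exact: homogUX.
Qed.

Lemma odd_degree_sum : (0 < l)%N ->
  (\sum_t odd_degree t = l * b + (2 * m + 1) * r * 'C(l, 2))%N.
Proof.
rewrite /odd_degree; case: l => // n _; rewrite big_split /= sum_nat_const card_ord.
rewrite big_ord_recl /= big_split /= sum_nat_const card_ord -big_distrr /=.
rewrite big_split /= sum_nat_const card_ord -(big_mkord xpredT (fun k : nat => k)) bin2_sum.
have -> : 'C(n.+1, 2) = (n + 'C(n, 2))%N by rewrite binS bin1 addnC.
have := bin2 n; have := odd_double_half (n * n.-1).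
have : ~~ odd (n * n.-1) by case: (n) => // k; rewrite /= oddM /=; case: (odd k).
move=> /negPf -> /= h1 h2.
have h3 : (2 * 'C(n, 2) = n * n.-1)%N by rewrite h2 -h1; lia.
have h4 : (n * n.-1 + n = n * n)%N by case: (n) => // k; rewrite /=; lia.
(* Products that linear arithmetic cannot form by itself. *)
have h5 : (n * (e + 1 + r * A) = n * (b + r))%N by rewrite hb.
have h6 : (m * r * (2 * 'C(n, 2) + n) = m * r * (n * n))%N by rewrite h3 h4.
move: h5 h6; move: 'C(n, 2) => C h5 h6; lia.
Qed.

Lemma odd_basis_cond t : saito_cond z b (2 * m + 1) 1 (row t odd_basis).
Proof.
split=> [i|i j k ij].
  rewrite !mxE; apply: rdvd_mull; case: (nat_of_ord t) => [|t'].
    by apply/rdvd_mulr/rdvd_refl.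
  by apply: rdvd_exp; lia.
have nij : i != j by apply: contraTneq ij => ->; rewrite ltnn.
rewrite !mxE muln1.
have := gi_diff_dvd m.+1 (A + t) (fun=> m) k ij; rewrite /= addnn -mul2n => hd.
(* This monomial clears the negative powers in both integrals and is not divisible by the prime
   [lin i j k]. *)
apply: (rdvd_primeX (b := x i ^+ (r * m.+1) * x j ^+ (r * m.+1))).
- exact: lin_neq0.
- exact: lin_prime.
- exact: lin_ndvd_XX.
have hx (v : S) (a1 a2 a3 a4 : nat) : (a1 + a2 = 1 + a3 + a4)%N ->
    v ^+ a1 * v ^+ a2 = v * v ^+ a3 * v ^+ a4.
  by move=> h; rewrite -exprD -exprS -exprD h.
case: (nat_of_ord t) hd => [|t'] [u hu].
  exists (u * \prod_k x k ^+ e); rewrite [RHS]mulrAC -hu addn0 -!exprM -!mul_mpolyC.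
  pose P' := \prod_(k < l | (k != i) && (k != j)) x k ^+ e.
  have Pi : \prod_(k < l | k != i) x k ^+ e = x j ^+ e * P'.
    by rewrite (bigD1 j) // eq_sym.
  have Pj : \prod_(k < l | k != j) x k ^+ e = x i ^+ e * P'.
    by rewrite (bigD1 i) //; congr (_ * _); apply: eq_bigl => k'; rewrite andbC.
  have Pij : \prod_k x k ^+ e = x i ^+ e * (x j ^+ e * P') by rewrite (bigD1 i) //= Pi.
  rewrite Pij Pi Pj; apply: clear_denominators; rewrite [LHS]mulrA.
    by rewrite [RHS]mulrA; congr (_ * _); apply: hx; lia.
  by rewrite [x i ^+ e * (_ * _)]mulrCA [RHS]mulrA; congr (_ * _); apply: hx; lia.
exists u; rewrite -hu -!mul_mpolyC -!exprM.
rewrite -[RHS]mulr1; apply: clear_denominators; rewrite mulr1 -exprD -exprS;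
  by congr (_ ^+ _); lia.
Qed.

(** Up to monomial factors of the rows and columns, the matrix is the transpose of [int_mx]. *)
Lemma odd_basis_det : \det odd_basis != 0.
Proof.
pose D : 'rV[S]_l := \row_i x i ^+ r.
pose E : 'rV[S]_l := \row_(t < l) (if t == 0%N :> nat then \prod_k x k ^+ e else 1).
pose F : 'rV[S]_l := \row_i x i ^+ (1 + r * A).
have h : odd_basis *m diag_mx D =
    diag_mx E *m (int_mx (wS m.+1) m A (fun i => x i ^+ r))^T *m diag_mx F.
  apply/matrixP => t i; rewrite !mul_mx_diag mul_diag_mx !mxE -/(gi m.+1 (A + t) (fun=> m) i).
  case: (nat_of_ord t) => [|t'] /=.
    rewrite [\prod_k x k ^+ e](bigD1 i) //= expr0 mul1r -/(gi m.+1 (A + 0) (fun=> m) i).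
    have ei : x i ^+ b * x i ^+ r = x i ^+ e * x i ^+ (1 + r * A).
      by rewrite -!exprD; congr (_ ^+ _); lia.
    exact: regroup_factors.
  rewrite -/(gi m.+1 (A + t'.+1) (fun=> m) i) mul1r -!exprM [RHS]mulrAC [RHS]mulrC.
  by rewrite -[LHS]mulrA -!exprD; congr (_ * _ ^+ _); lia.
apply: contraTneq (int_mx_neq0 m.+1 m A) => d0; rewrite negbK.
have := congr1 determinant h; rewrite !det_mulmx d0 mul0r det_tr !det_diag => /esym/eqP.
rewrite !mulf_eq0 => /orP[/orP[|//]|] /prodf_eq0[i _]; rewrite mxE.
  by case: ifP => _; rewrite ?oner_eq0 // => /prodf_eq0[k _]; rewrite expf_eq0 (negPf (mpolyX_neq0 _ _)) andbF.
by rewrite expf_eq0 (negPf (mpolyX_neq0 _ _)) andbF.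
Qed.

End OddMultiplicities.

Section EvenMultiplicities.
Variables (m e A b : nat).
Hypotheses (er : (e <= r)%N) (hb : (e + 1 + r * A = b + r)%N).

Definition mult_but (t k : 'I_l) : nat := if k == t then m else m.+1.

(* Entry [(t, i)] is [x_t^e] times the integral from 0 to [x_i] of
   [t^(r(A - m - 1)) prod_k (t^r - X_k)^(m + 1) / (t^r - X_t)]. *)
Definition even_basis : 'M[S]_l :=
  \matrix_(t, i) (gi m.+1 A (mult_but t) i *
    if i == t then x t ^+ b else x t ^+ e * x i ^+ (1 + r * A)).

Lemma even_basis_homog t i :
  even_basis t i \is (b + r * (m.+1 * l.-1))%N.-homog.
Proof.
rewrite mxE [(b + _)%N]addnC /mult_but; case: (eqVneq i t) => [->|it].
  apply: homogM; last exact: homogUX.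
  apply: gw_homog; congr (_ * _)%N; rewrite -(card_neq t) mulnC -sum_nat_const.
  by apply: eq_bigr => k /negPf ->.
have -> : (r * (m.+1 * l.-1) + b =
    (r * (\sum_(k < l | k != i) if k == t then m else m.+1)) + (e + (1 + r * A)))%N.
  rewrite -(card_neq i) [(m.+1 * _)%N]mulnC -sum_nat_const (bigD1 t) /=; last by rewrite inE eq_sym.
  rewrite [in RHS](bigD1 t) 1?eq_sym //= ?eqxx.
  rewrite [X in (_ * (m + X))%N](eq_bigr (fun=> m.+1)); last by move=> k /andP[_ /negPf ->].
  set X := (\sum_(_ < _ | _) _)%N; nia.
apply: homogM; first exact: gw_homog.
by apply: homogM; exact: homogUX.
Qed.

Lemma even_degree_sum : (0 < l)%N ->
  (\sum_(t < l) (b + r * (m.+1 * l.-1)) = l * b + (2 * m.+1) * r * 'C(l, 2))%N.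
Proof.
move=> l0; rewrite sum_nat_const card_ord.
have h := mul_bin_diag l 1; rewrite bin1 in h.
have : (m.+1 * r * (l * l.-1) = m.+1 * r * (2 * 'C(l, 2)))%N by rewrite h.
by move: 'C(l, 2) => C; nia.
Qed.

Lemma even_basis_cond t : saito_cond z b (2 * m.+1) 1 (row t even_basis).
Proof.
split=> [i|i j k ij].
  rewrite !mxE; apply: rdvd_mull; case: (eqVneq i t) => [->|_]; first exact: rdvd_refl.
  by apply/rdvd_mull/rdvd_exp; lia.
have nij : i != j by apply: contraTneq ij => ->; rewrite ltnn.
rewrite !mxE muln1.
(* The exponent on the right is 2m + 2 if [t] is [i] or [j], and 2m + 3 otherwise. *)
have [u hu] : rdvd (lin i j k ^+ (2 * m.+1)) (lin i j k ^+ (mult_but t i + mult_but t j + 1)).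
  apply: rdvd_exp; rewrite /mult_but.
  case: (eqVneq i t) => [ei|_]; case: (eqVneq j t) => [ej|_]; try lia.
  by rewrite ei ej eqxx in nij.
have [v hv] := gi_diff_dvd m.+1 A (mult_but t) k ij.
apply: (rdvd_primeX (b := x i ^+ (r * m.+1) * x j ^+ (r * m.+1))).
- exact: lin_neq0.
- exact: lin_prime.
- exact: lin_ndvd_XX.
exists (v * u * x t ^+ e); rewrite [RHS]mulrAC -[v * u * _]mulrA -hu -hv -!exprM -!mul_mpolyC.
have hx (y : S) (a1 a2 a3 a4 : nat) : (a1 + a2 = 1 + a3 + a4)%N ->
    y ^+ a1 * y ^+ a2 = y * y ^+ a3 * y ^+ a4.
  by move=> h; rewrite -exprD -exprS -exprD h.
have hi j' : x j' ^+ (r * m.+1) * (if j' == t then x t ^+ b else x t ^+ e * x j' ^+ (1 + r * A)) =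
    x j' * x j' ^+ (r * (A + mult_but t j')) * x t ^+ e.
  rewrite /mult_but; case: (eqVneq j' t) => [->|_]; first by apply: hx; lia.
  rewrite mulrCA [RHS]mulrC; congr (_ * _).
  by rewrite -exprD -exprS; congr (_ ^+ _); lia.
exact: clear_denominators (hi i) (hi j).
Qed.

(** The change of basis from powers to the products without one factor; it writes the integrands of
    [even_basis] as combinations of t^(..) prod_k (t^r - X_k)^m. *)
Definition deleted_coefs : 'M[S]_l :=
  \matrix_(t, q) (\prod_(k < l | k != t) ('X - (x k ^+ r)%:P))`_q.

Lemma size_deleted t : size (\prod_(k < l | k != t) ('X - (x k ^+ r)%:P)) = l.
Proof.
rewrite -big_filter size_prod_XsubC -sum1_size big_filter sum1_card card_neq.
by rewrite prednK // (leq_ltn_trans _ (ltn_ord t)).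
Qed.

(** Lagrange interpolation: the product with the Vandermonde matrix of the x_i^r is diagonal with
    nonzero entries. *)
Lemma deleted_coefs_det : \det deleted_coefs != 0.
Proof.
have h : deleted_coefs *m (\matrix_(q, i) (x i ^+ r) ^+ q) =
    diag_mx (\row_t \prod_(k < l | k != t) (x t ^+ r - x k ^+ r)).
  apply/matrixP => t i; rewrite !mxE.
  rewrite (eq_bigr (fun q : 'I_l => (\prod_(k < l | k != t) ('X - (x k ^+ r)%:P))`_q *
    (x i ^+ r) ^+ q)); last by move=> q _; rewrite !mxE.
  rewrite -horner_coef_wide ?size_deleted // horner_prod.
  rewrite (eq_bigr (fun k => x i ^+ r - x k ^+ r)); last by move=> k _; rewrite hornerXsubC.
  case: (eqVneq t i) => [->|ti]; first by rewrite mulr1n.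
  by rewrite mulr0n (bigD1 i) 1?eq_sym //= subrr mul0r.
apply/eqP => d0.
have := congr1 determinant h; rewrite det_mulmx d0 mul0r det_diag => /esym/eqP.
case/prodf_eq0 => t _; rewrite mxE => /prodf_eq0[k kt].
have r0 : (0 < r)%N by apply: ltnW.
move/eqP/(congr1 (meval (fun i => (i == t)%:R))); rewrite meval0 mevalB !rmorphXn /= !mevalXU.
by rewrite eqxx (negPf kt) expr1n expr0n eqn0Ngt r0 subr0 => /eqP; rewrite oner_eq0.
Qed.

Lemma gi_mult_but t i :
  (x i ^+ r) ^+ mult_but t i * gi m.+1 A (mult_but t) i =
  (x i ^+ r) ^+ m * \sum_q deleted_coefs t q * ((x i ^+ r) ^+ q * gi m.+1 (A + q) (fun=> m) i).
Proof.
apply: (mulfI (x := (x i ^+ r) ^+ A)); first by rewrite !expf_neq0 // mpolyX_neq0.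
rewrite mulrA -exprD -gi_int.
have -> : 'X^A * \prod_k ('X - (x k ^+ r)%:P) ^+ mult_but t k =
    \sum_q deleted_coefs t q *: ('X^(A + q) * \prod_k ('X - (x k ^+ r)%:P) ^+ m).
  have -> : \prod_k ('X - (x k ^+ r)%:P) ^+ mult_but t k =
      (\prod_(k < l | k != t) ('X - (x k ^+ r)%:P)) * \prod_k ('X - (x k ^+ r)%:P) ^+ m.
    rewrite [LHS](bigD1 t) //= [\prod_k _ ^+ m](bigD1 t) //= /mult_but eqxx mulrCA -big_split /=.
    by congr (_ * _); apply: eq_bigr => k /negPf ->; rewrite exprS.
  rewrite mulrA -[X in 'X^A * X](coefK (\prod_(k < l | k != t) _)) size_deleted poly_def.
  rewrite mulr_sumr mulr_suml; apply: eq_bigr => q _.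
  by rewrite mxE -scalerAr -scalerAl exprD.
rewrite wev_sum mulr_sumr mulr_sumr; apply: eq_bigr => q _.
rewrite wevZ gi_int !exprD.
have ac (R : comNzRingType) (a c d f g : R) : d * (a * f * c * g) = a * (c * (d * (f * g))).
  by ring.
exact: ac.
Qed.

Lemma even_basis_det : \det even_basis != 0.
Proof.
pose D : 'rV[S]_l := \row_i x i ^+ r.
pose E : 'rV[S]_l := \row_t x t ^+ e.
pose F : 'rV[S]_l := \row_i x i ^+ (1 + r * A).
have h : even_basis *m diag_mx D = diag_mx E *m
    (deleted_coefs *m (int_mx (wS m.+1) m A (fun i => x i ^+ r))^T) *m diag_mx F.
  apply/matrixP => t i; rewrite !mul_mx_diag mul_diag_mx !mxE.
  set sm := \sum_(q < l) _.
  have es : sm = \sum_q deleted_coefs t q * ((x i ^+ r) ^+ q * gi m.+1 (A + q) (fun=> m) i).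
    by apply: eq_bigr => q _; rewrite !mxE.
  have := gi_mult_but t i; rewrite -es /mult_but.
  have xm0 : (x i ^+ r) ^+ m != 0 by rewrite !expf_neq0 // mpolyX_neq0.
  case: (eqVneq i t) => [<-|_] => [/(mulfI xm0)|].
    move=> ->; rewrite -mulrA -exprD mulrC mulrAC -exprD; congr (_ ^+ _ * _); lia.
  rewrite exprSr -mulrA => /(mulfI xm0) <-; move: (gi _ _ _ _) => g.
  have ac (R : comNzRingType) (a c d f : R) : d * (a * c) * f = a * (f * d) * c by ring.
  exact: ac.
apply: contraTneq (int_mx_neq0 m.+1 m A) => d0; rewrite negbK.
have := congr1 determinant h; rewrite !det_mulmx d0 mul0r det_tr !det_diag => /esym/eqP.
rewrite !mulf_eq0 (negPf deleted_coefs_det) orFb.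
move=> /orP[/orP[|//]|] /prodf_eq0[i _]; rewrite mxE;
  by rewrite expf_eq0 (negPf (mpolyX_neq0 _ _)) andbF.
Qed.

End EvenMultiplicities.

End Bases.
End Bases.

(** * The reflection arrangement *)

Section HyperplaneForms.
Variables (K : fieldType) (l : nat).
Implicit Types (a : 'rV[K]_l) (v : 'cV[K]_l) (H : {vspace 'cV[K]_l}).

Lemma mem_form_ker a v : (v \in form_ker a) = (a *m v == 0).
Proof. by rewrite memv_ker lfunE. Qed.

Lemma form_ker_eq a a0 : a0 != 0 -> form_ker a = form_ker a0 ->
  exists2 c, c != 0 & a = c *: a0.
Proof.
move=> a00 h; have [i0 ai0] : exists i, a0 0 i != 0.
  apply/existsP; apply: contraNT a00; rewrite negb_exists => /forallP e.
  by apply/eqP/rowP => i; rewrite mxE; apply/eqP; have := e i; rewrite negbK.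
have key v : (a0 *m v == 0) = (a *m v == 0) by rewrite -!mem_form_ker h.
have mE b j : b *m (delta_mx j 0 : 'cV[K]_l) = (b 0 j)%:M.
  by apply/matrixP => i k; rewrite !ord1 -colE !mxE.
have e : a = (a 0 i0 / a0 0 i0) *: a0.
  apply/rowP => j; rewrite mxE.
  (* A vector killed by [a0], hence also by [a]: this is the proportion between the coefficients. *)
  have : a0 *m (a0 0 i0 *: delta_mx j 0 - a0 0 j *: delta_mx i0 0 : 'cV_l) == 0.
    by rewrite mulmxBr -!scalemxAr !mE !scale_scalar_mx mulrC subrr.
  rewrite key mulmxBr -!scalemxAr !mE !scale_scalar_mx subr_eq0.
  move=> /eqP /(congr1 (fun M : 'M_1 => M 0 0)); rewrite !mxE !mulr1n => ej.
  by apply: (mulfI ai0); rewrite ej [RHS]mulrA [a0 0 i0 * (_ / _)]mulrC divfK // mulrC.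
exists (a 0 i0 / a0 0 i0) => //; apply: contraNneq ai0 => c0.
have : a0 *m (delta_mx i0 0 : 'cV_l) == 0 by rewrite key e c0 scale0r mul0mx.
by rewrite mE => /eqP /(congr1 (fun M : 'M_1 => M 0 0)); rewrite !mxE mulr1n => ->.
Qed.

(** [xget] does find a form, since [a0] is one, and forms with the same kernel are proportional. *)
Lemma alpha_form_ker a0 : a0 != 0 ->
  exists2 c, c != 0 & alpha (form_ker a0) = c *: a0.
Proof.
move=> a00; apply: form_ker_eq => //; rewrite /alpha.
by case: classical_sets.xgetP => [a _ ha|/(_ a0)] //; case.
Qed.

Lemma dim_form_ker a0 : a0 != 0 -> (\dim (form_ker a0)).+1 = l.
Proof.
move=> a00; pose f := linfun (mulmx a0 : 'cV[K]_l -> 'cV[K]_1).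
have := limg_ker_dim f fullv; rewrite capfv dimvf /dim /= muln1.
have h1 : (\dim (limg f) <= 1)%N by rewrite (leq_trans (dimvS (subvf _))) // dimvf.
suff h2 : (0 < \dim (limg f))%N by have -> : \dim (limg f) = 1%N by [lia|]; rewrite addn1.
rewrite lt0n dimv_eq0; apply: contraNneq a00 => /eqP; rewrite -subv0 => /subvP h.
apply/eqP/rowP => j; rewrite mxE.
have := h (f (delta_mx j 0)) (memv_img _ (memvf _)).
rewrite memv0 lfunE /= -colE => /eqP /(congr1 (fun M : 'M_1 => M 0 0)).
by rewrite !mxE.
Qed.

Lemma eq_form_ker a0 H : a0 != 0 -> (\dim H).+1 = l ->
  (forall v, v \in H -> a0 *m v = 0) -> H = form_ker a0.
Proof.
move=> a00 dH h; apply/eqP; rewrite eqEdim; apply/andP; split.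
  by apply/subvP => v /h /eqP; rewrite mem_form_ker.
by have := dim_form_ker a00; rewrite -[X in _ = X]dH => -[->].
Qed.

End HyperplaneForms.

(** * Derivation modules in terms of Saito conditions *)

Module Freeness.
Import mpoly PolyDefs Saito.

Section Derivations.
Variables (K : numFieldType) (l r : nat) (z : K).
Hypothesis zP : r.-primitive_root z.
Local Notation S := {mpoly K[l]}.
Implicit Types (i j : 'I_l).

Lemma mderivU i j : ('X_j : S)^`M(i) = (i == j)%:R.
Proof.
rewrite mderivX mnm1E eq_sym; case: eqVneq => [->|_]; last by rewrite scale0r.
suff -> : (U_(j) - U_(j) = 0)%MM by rewrite mpolyX0 scale1r.
by apply/mnmP => k; rewrite mnmBE subnn mnm0E.
Qed.

Lemma apply_der_linear (theta : 'rV[S]_l) (a : 'rV[K]_l) :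
  apply_der theta (linear_form a) = \sum_i a 0 i *: theta 0 i.
Proof.
rewrite /apply_der; apply: eq_bigr => i _; rewrite /linear_form raddf_sum /=.
rewrite (bigD1 i) //= big1 ?addr0 => [|j ji]; rewrite mderivZ mderivU.
  by rewrite eqxx -scalerAr mulr1.
by rewrite eq_sym (negPf ji) scaler0.
Qed.

Lemma linear_formZ c (a : 'rV[K]_l) : linear_form (c *: a) = c *: linear_form a.
Proof. by rewrite /linear_form scaler_sumr; apply: eq_bigr => i _; rewrite mxE scalerA. Qed.

Definition lrow i j k : 'rV[K]_l := delta_mx 0 i - z ^+ k *: delta_mx 0 j.

Lemma linear_form_delta i : linear_form (delta_mx 0 i : 'rV[K]_l) = 'X_i.
Proof.
rewrite /linear_form (bigD1 i) //= big1 ?addr0 => [|j ji]; first by rewrite mxE !eqxx scale1r.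
by rewrite mxE (negPf ji) andbF scale0r.
Qed.

Lemma linear_form_lrow i j k : linear_form (lrow i j k) = lin z i j k.
Proof.
have linD (a a' : 'rV[K]_l) : linear_form (a + a') = linear_form a + linear_form a'.
  by rewrite /linear_form -big_split; apply: eq_bigr => m _; rewrite mxE scalerDl.
by rewrite linD -scaleNr linear_formZ !linear_form_delta scaleNr.
Qed.

Lemma delta_neq0 i : (delta_mx 0 i : 'rV[K]_l) != 0.
Proof. by apply/eqP => /rowP /(_ i); rewrite !mxE !eqxx => /eqP; rewrite oner_eq0. Qed.

Lemma lrow_neq0 i j k : i != j -> lrow i j k != 0.
Proof.
move=> ij; apply/eqP => /rowP /(_ i); rewrite !mxE !eqxx (negPf ij) andbF mulr0 subr0.
by move/eqP; rewrite oner_eq0.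
Qed.

(** Rescaling the form changes both sides by nonzero constants, so the choice made by [alpha] is
    immaterial. *)
Lemma derivation_at (theta : 'rV[S]_l) (a0 : 'rV[K]_l) (n : nat) : a0 != 0 ->
  (exists Q, apply_der theta (linear_form (alpha (form_ker a0))) =
     Q * linear_form (alpha (form_ker a0)) ^+ n) <->
  rdvd (linear_form a0 ^+ n) (apply_der theta (linear_form a0)).
Proof.
move=> a00; have [c c0 ->] := alpha_form_ker a00.
rewrite !apply_der_linear linear_formZ exprZn.
have -> : \sum_i (c *: a0) 0 i *: theta 0 i = c *: \sum_i a0 0 i *: theta 0 i.
  by rewrite scaler_sumr; apply: eq_bigr => i _; rewrite mxE scalerA.
split=> -[Q hQ].
  exists (c^-1 *: (c ^+ n *: Q)).
  apply: (scalerI c0); rewrite hQ -scalerAl scalerA mulfV // scale1r.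
  by rewrite -scalerAl -scalerAr.
exists (c *: ((c ^+ n)^-1 *: Q)).
by rewrite hQ -scalerAl -scalerAl -scalerAr !scalerA mulrAC mulfK ?expf_neq0.
Qed.

Section Arrangement.
Variables (A : seq {vspace 'cV[K]_l}) (nu : {vspace 'cV[K]_l} -> nat) (b n : nat).
Hypothesis HA : forall H, H \in A ->
  (exists i j k, (i < j)%N /\ H = form_ker (lrow i j k)) \/
  (exists i, H = form_ker (delta_mx 0 i)).
Hypothesis HB : forall i j k, (i < j)%N ->
  form_ker (lrow i j k) \in A /\ nu (form_ker (lrow i j k)) = n.
Hypothesis HC : forall i, form_ker (delta_mx 0 i) \in A -> nu (form_ker (delta_mx 0 i)) = b.
(** Covers both kinds of arrangement: with all coordinate hyperplanes, or with [b = 0], when the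
    condition at x_i is void. *)
Hypothesis HD : b = 0%N \/ forall i, form_ker (delta_mx 0 i) \in A.

Lemma derivation_moduleP (theta : 'rV[S]_l) :
  in_derivation_module A nu theta <-> saito_cond z b n 1 theta.
Proof.
have eX i : apply_der theta (linear_form (delta_mx 0 i)) = theta 0 i.
  rewrite apply_der_linear (bigD1 i) //= big1 ?addr0 => [|j ji].
    by rewrite mxE !eqxx scale1r.
  by rewrite mxE (negPf ji) andbF scale0r.
have el i j k : apply_der theta (linear_form (lrow i j k)) = theta 0 i - z ^+ (k * 1) *: theta 0 j.
  rewrite apply_der_linear muln1 -(eX i) -(eX j) !apply_der_linear.
  rewrite scaler_sumr -sumrB; apply: eq_bigr => m _.
  by rewrite !mxE scalerBl scalerA.
have nij i j : (i < j)%N -> i != j by move=> ij; apply: contraTneq ij => ->; rewrite ltnn.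
split=> [h|[hX hl] H HinA].
  split=> [i|i j k ij].
    case: HD => [->|hA]; first by exists (theta 0 i); rewrite expr0 mulr1.
    have := h _ (hA i); rewrite HC // => /(derivation_at _ _ (delta_neq0 i)).
    by rewrite eX linear_form_delta.
  have [HinA hn] := HB k ij.
  have := h _ HinA; rewrite hn => /(derivation_at _ _ (lrow_neq0 k (nij _ _ ij))).
  by rewrite el linear_form_lrow.
have [[i [j [k [ij eH]]]]|[i eH]] := HA HinA; rewrite eH in HinA *.
  have [_ ->] := HB k ij; apply/(derivation_at _ _ (lrow_neq0 k (nij _ _ ij))).
  by rewrite el linear_form_lrow; apply: hl.
rewrite HC //; apply/(derivation_at _ _ (delta_neq0 i)).
by rewrite eX linear_form_delta.
Qed.

Lemma free_by_saito (B : 'M[S]_l) (d : 'I_l -> nat) (es : seq nat) :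
  (forall t, saito_cond z b n 1 (row t B)) ->
  (forall t i, B t i \is (d t).-homog) ->
  (\sum_t d t = l * b + n * r * 'C(l, 2))%N ->
  \det B != 0 -> perm_eq es [seq d t | t <- enum 'I_l] ->
  free_with_exponents A nu es.
Proof.
move=> hB hd sd dB hes.
have sz : size es = l by rewrite (perm_size hes) size_map size_enum_ord.
(* [es] may list the degrees in any order, so the rows of [B] are permuted to match it. *)
have [s hs] : exists s : 'S_l, forall i : 'I_l, nth 0%N es i = d (s i).
  have e : map_tuple d (ord_tuple l) = [seq d t | t <- enum 'I_l] :> seq nat.
    by congr map; exact: val_ord_tuple.
  have /tuple_permP[s hs] : perm_eq (Tuple (introT eqP sz)) (map_tuple d (ord_tuple l)).
    by rewrite e.
  exists s => i; have := congr1 (nth 0%N ^~ i) hs; rewrite /= => ->.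
  rewrite (nth_map i) ?size_enum_ord // nth_ord_enum.
  by rewrite tnth_map tnth_ord_tuple.
pose f (i : 'I_(size es)) : 'I_l := s (cast_ord sz i).
pose g (t : 'I_l) : 'I_(size es) := cast_ord (esym sz) (s^-1%g t).
have fK : cancel f g by move=> i; rewrite /f /g permK cast_ordK.
have gK : cancel g f by move=> i; rewrite /f /g cast_ordKV permKV.
exists (fun u => row (f u) B); last first.
  by move=> i j; rewrite mxE (hs (cast_ord sz i)); apply: hd.
split=> [i|eta /derivation_moduleP heta]; first exact/derivation_moduleP/hB.
have comb (c : 'rV[S]_(size es)) : \sum_u c 0 u *: row (f u) B = (\row_t c 0 (g t)) *m B.
  rewrite mulmx_sum_row (reindex f) /=; last by exists g => i _; [exact: fK|exact: gK].
  by apply: eq_bigr => i _; rewrite mxE fK.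
have [c [hc uc]] := saito_criterion zP hB hd sd dB heta.
exists (\row_u c 0 (f u)); split=> [|c' hc'].
  rewrite comb hc; congr (_ *m _); apply/rowP => t.
  by rewrite !mxE gK.
rewrite comb in hc'; have h := uc _ hc'.
by apply/rowP => i; rewrite mxE h mxE fK.
Qed.

End Arrangement.
End Derivations.
End Freeness.

(** In characteristic 0 the polynomial X^r - 1 has r distinct roots, and a finite group of roots of
    unity is cyclic. *)
Lemma exists_prim_root (K : numClosedFieldType) (r : nat) :
  (0 < r)%N -> exists z : K, r.-primitive_root z.
Proof.
move=> r0; pose P : {poly K} := 'X^r - 1.
have [s hs] := closed_field_poly_normal P.
have mP : P \is monic by rewrite monicE lead_coefXnsubC.
rewrite (monicP mP) scale1r in hs.
have sz : size s = r by have := size_XnsubC (1 : K) r0; rewrite -/P hs size_prod_XsubC => -[].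
have us : uniq s by rewrite -separable_prod_XsubC -hs separable_Xn_sub_1 // pnatr_eq0 -lt0n.
have /hasP[z _ hz] : has r.-primitive_root s.
  apply: cyclic.has_prim_root => //; last by rewrite sz.
  by apply/allP => x xs; change (is_true (root P x)); rewrite hs root_prod_XsubC.
by exists z.
Qed.

(** * The group G(r,p,l): reflections, stabilizers, Coxeter number *)

Section MonomialMatrices.
Variables (K : fieldType) (l : nat).
Implicit Types (s : 'S_l) (ga : 'I_l -> K) (v : 'cV[K]_l).

Definition mono s ga : 'M[K]_l := \matrix_(i, j) if j == s i then ga i else 0.

Lemma mono_mul s ga m (v : 'M[K]_(l, m)) i k : (mono s ga *m v) i k = ga i * v (s i) k.
Proof.
rewrite mxE (bigD1 (s i)) //= big1 ?addr0 => [|j js]; first by rewrite mxE eqxx.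
by rewrite mxE (negPf js) mul0r.
Qed.

Lemma in_monomial_groupP r p (g : 'M[K]_l) : (0 < r)%N ->
  in_monomial_group r p g <->
  exists s ga, [/\ g = mono s ga, forall i, ga i ^+ r = 1 & (\prod_i ga i) ^+ (r %/ p) = 1].
Proof.
move=> r0; have nz x : x ^+ r = 1 -> x != 0 :> K.
  by move=> h; apply: contra_eq_neq h => ->; rewrite expr0n eqn0Ngt r0 eq_sym oner_neq0.
split=> [[[s hs] h1 h2]|[s [ga [-> h1 h2]]]].
  exists s, (fun i => g i (s i)); split.
  - apply/matrixP => i j; rewrite mxE; case: eqP => [->//|/eqP js].
    by apply/eqP; apply: contraNT js => gij; rewrite -hs.
  - by move=> i; apply: h1; rewrite hs eqxx.
  - rewrite -[RHS]h2; congr (_ ^+ _); apply: eq_bigr => i _.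
    by rewrite (eq_bigl (pred1 (s i))) ?big_pred1_eq // => j; rewrite hs.
have hm i j : (mono s ga i j != 0) = (j == s i).
  by rewrite mxE; case: ifP => _; rewrite ?eqxx // nz.
split; first by exists s.
- by move=> i j; rewrite hm mxE => /eqP ->; rewrite eqxx.
- rewrite -[RHS]h2; congr (_ ^+ _); apply: eq_bigr => i _.
  by rewrite (eq_bigl (pred1 (s i))) ?big_pred1_eq ?mxE ?eqxx // => j; rewrite hm.
Qed.

End MonomialMatrices.

Module MonomialW.
Import Saito Freeness.

Section Group.
Variables (K : numClosedFieldType) (r p l : nat).
Variables (gT : finGroupType) (W : {group gT}) (V : mx_representation K W l) (z : K).
Hypotheses (zP : r.-primitive_root z) (r2 : (2 <= r)%N) (l2 : (2 <= l)%N).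
Hypotheses (p0 : (0 < p)%N) (pr : (p %| r)%N) (Vfaith : mx_faithful V).
Hypothesis hW : forall g : 'M[K]_l,
  in_monomial_group r p g <-> exists2 w, w \in W & V w = g.
Implicit Types (i j : 'I_l) (s : 'S_l) (ga : 'I_l -> K).
Local Notation lrow := (@lrow K l z).
Local Notation erow i := (delta_mx 0 i : 'rV[K]_l).

Let r0 : (0 < r)%N. Proof. exact: ltnW. Qed.

Lemma V_mono w : w \in W -> exists s ga,
  [/\ V w = mono s ga, forall i, ga i ^+ r = 1 & (\prod_i ga i) ^+ (r %/ p) = 1].
Proof. by move=> wW; apply/(in_monomial_groupP _ _ r0)/hW; exists w. Qed.

Lemma mono_V s ga : (forall i, ga i ^+ r = 1) -> (\prod_i ga i) ^+ (r %/ p) = 1 ->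
  exists2 w, w \in W & V w = mono s ga.
Proof. by move=> h1 h2; apply/hW/(in_monomial_groupP _ _ r0); exists s, ga. Qed.

Lemma V_inj : {in W &, injective V}.
Proof. exact: mx_faithful_inj. Qed.

Lemma mem_fixed_space w v : (v \in fixed_space V w) = (V w *m v == v).
Proof. by apply/fixedSpaceP/eqP; rewrite lfunE. Qed.

Definition ga_swap i j (a : K) : 'I_l -> K :=
  fun m => if m == i then a else if m == j then a^-1 else 1.

Definition ga_scale i (a : K) : 'I_l -> K := fun m => if m == i then a else 1.

Lemma prod_ga_swap i j a : i != j -> a != 0 -> \prod_m ga_swap i j a m = 1.
Proof.
move=> ij a0; rewrite (bigD1 i) //= (bigD1 j) 1?eq_sym //= big1 => [|m /andP[mi mj]].
  by rewrite /ga_swap eqxx eq_sym (negPf ij) eqxx mulr1 mulfV.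
by rewrite /ga_swap (negPf mi) (negPf mj).
Qed.

Lemma prod_ga_scale i a : \prod_m ga_scale i a m = a.
Proof.
rewrite (bigD1 i) //= big1 => [|m mi]; first by rewrite /ga_scale eqxx mulr1.
by rewrite /ga_scale (negPf mi).
Qed.

Lemma zX_neq0 k : z ^+ k != 0.
Proof. by rewrite -normr_eq0 (norm_zX zP) oner_eq0. Qed.

Lemma unityX k : (z ^+ k) ^+ r = 1.
Proof. by rewrite exprAC (prim_expr_order zP) expr1n. Qed.

(** The entries have product 1, so these reflections belong to the group whatever [p] is. *)
Lemma reflection_swap i j k : i != j -> exists2 w, w \in W & V w = mono (tperm i j) (ga_swap i j (z ^+ k)).
Proof.
move=> ij; apply: mono_V => [m|]; last by rewrite prod_ga_swap ?zX_neq0 // expr1n.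
by rewrite /ga_swap; case: ifP => _; [|case: ifP => _]; rewrite ?exprVn ?unityX ?invr1 ?expr1n.
Qed.

Lemma reflection_scale i k : exists2 w, w \in W & V w = mono 1 (ga_scale i (z ^+ (p * k))).
Proof.
apply: mono_V => [m|].
  by rewrite /ga_scale; case: ifP => _; rewrite ?unityX ?expr1n.
by rewrite prod_ga_scale -exprM mulnAC [(p * (r %/ p))%N]mulnC (divnK pr) exprM (prim_expr_order zP) expr1n.
Qed.

Lemma lrow_mul i j k (v : 'cV[K]_l) : (lrow i j k *m v == 0) = (v i 0 == z ^+ k * v j 0).
Proof.
have e : lrow i j k *m v = (v i 0 - z ^+ k * v j 0)%:M.
  apply/matrixP => a b; rewrite !ord1 mulmxBl -scalemxAl -!rowE !mxE.
  by rewrite mulr1n.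
rewrite e -[RHS]subr_eq0; apply/eqP/eqP => [/(congr1 (fun M : 'M_1 => M 0 0))|->].
  by rewrite !mxE mulr1n.
by apply/matrixP => a b; rewrite !mxE mul0rn.
Qed.

Lemma erow_mul i (v : 'cV[K]_l) : (erow i *m v == 0) = (v i 0 == 0).
Proof.
rewrite -rowE; apply/eqP/eqP => [/(congr1 (fun M : 'M_1 => M 0 0))|h].
  by rewrite !mxE.
by apply/matrixP => a b; rewrite !ord1 !mxE.
Qed.

Lemma fixed_swap i j k w : i != j -> V w = mono (tperm i j) (ga_swap i j (z ^+ k)) ->
  fixed_space V w = form_ker (lrow i j k).
Proof.
move=> ij hw; apply/vspaceP => v; rewrite mem_fixed_space mem_form_ker lrow_mul hw.
apply/eqP/eqP => [/matrixP /(_ i 0)|h].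
  by rewrite mono_mul tpermL /ga_swap eqxx.
apply/matrixP => m b; rewrite !ord1 mono_mul /ga_swap.
case: (eqVneq m i) => [->|mi]; first by rewrite tpermL h.
case: (eqVneq m j) => [->|mj]; first by rewrite tpermR h mulKf ?zX_neq0.
by rewrite tpermD 1?eq_sym // mul1r.
Qed.

Lemma fixed_scale i a w : a != 1 -> V w = mono 1 (ga_scale i a) ->
  fixed_space V w = form_ker (erow i).
Proof.
move=> a1 hw; apply/vspaceP => v; rewrite mem_fixed_space mem_form_ker erow_mul hw.
apply/eqP/eqP => [/matrixP /(_ i 0)|h].
  rewrite mono_mul perm1 /ga_scale eqxx -[RHS]mul1r => /eqP.
  by rewrite -subr_eq0 -mulrBl mulf_eq0 subr_eq0 (negPf a1) => /eqP.
apply/matrixP => m b; rewrite !ord1 mono_mul perm1 /ga_scale.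
by case: (eqVneq m i) => [->|mi]; rewrite ?h ?mulr0 ?mul1r.
Qed.

Lemma reflections_classify w : w \in reflections V ->
  (exists i j k, (i < j)%N /\ fixed_space V w = form_ker (lrow i j k)) \/
  ((p < r)%N /\ exists i, fixed_space V w = form_ker (erow i)).
Proof.
rewrite inE => /andP[wW /eqP dw].
have [s [ga [hw g1 gp]]] := V_mono wW.
have fixE v : v \in fixed_space V w -> forall i, v i 0 = ga i * v (s i) 0.
  by rewrite mem_fixed_space hw => /eqP {1}<- i; rewrite mono_mul.
have gz i : exists k, ga i = z ^+ k by have [k ->] := prim_rootP zP (g1 i); exists k.
(* If [s] moves [i], fixed vectors satisfy v_i = ga_i v_(s i), and the dimension leaves room for no
   further equation. *)
case: (pickP (fun i => s i != i)) => [i si|s1].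
  left; set j := s i in si; have [k hk] := gz i.
  case: (ltngtP i j) => [ij|ji|/val_inj e]; last by rewrite e eqxx in si.
    exists i, j, k; split=> //; apply: eq_form_ker => //; first by apply: lrow_neq0; rewrite eq_sym.
    by move=> v /fixE /(_ i) h; apply/eqP; rewrite lrow_mul h hk.
  (* For j < i the same hyperplane is written with the inverse root of unity. *)
  have [k' hk'] : exists k', (ga i)^-1 = z ^+ k'.
    by have [|k' ->] := prim_rootP zP (x := (ga i)^-1); [rewrite exprVn g1 invr1|exists k'].
  exists j, i, k'; split=> //; apply: eq_form_ker => //; first exact: lrow_neq0.
  move=> v /fixE /(_ i) h; apply/eqP; rewrite lrow_mul h -hk' mulKf //.
  by rewrite hk zX_neq0.
have s1' i : s i = i by apply/eqP; have := s1 i; rewrite /= => /negbFE.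
right; case: (pickP (fun i => ga i != 1)) => [i gi|g1']; last first.
  have : fixed_space V w = fullv.
    apply/vspaceP => v; rewrite mem_fixed_space memvf hw; apply/eqP/matrixP => m b.
    by rewrite mono_mul s1'; have /negbFE/eqP -> := g1' m; rewrite mul1r.
  by move=> e; move: dw; rewrite e dimvf /dim /= muln1 => /eqP; rewrite gtn_eqF.
have eF : fixed_space V w = form_ker (erow i).
  apply: eq_form_ker => //; first exact: delta_neq0.
  move=> v /fixE /(_ i); rewrite s1' => h; apply/eqP; rewrite erow_mul.
  move/eqP: h; rewrite -[X in X == _]mul1r -subr_eq0 -mulrBl mulf_eq0 subr_eq0.
  by rewrite eq_sym (negPf gi).
split; last by exists i.
(* For j <> i the vector e_j lies in the hyperplane and is fixed. So the product of the entries is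
   [ga i], and p = r would force it to be 1. *)
have gj j : j != i -> ga j = 1.
  move=> ji; have : (delta_mx j 0 : 'cV_l) \in fixed_space V w.
    by rewrite eF mem_form_ker erow_mul mxE [i == j]eq_sym (negPf ji).
  by move/fixE/(_ j); rewrite s1' !mxE !eqxx mulr1.
have pg : \prod_m ga m = ga i by rewrite (bigD1 i) //= big1 ?mulr1.
rewrite ltn_neqAle dvdn_leq // andbT; apply: contraNneq gi => e.
by move: gp; rewrite pg e divnn r0 expr1 => ->.
Qed.

Lemma mem_arrangement H : H \in reflection_arrangement V <->
  (exists i j k, (i < j)%N /\ H = form_ker (lrow i j k)) \/
  ((p < r)%N /\ exists i, H = form_ker (erow i)).
Proof.
rewrite mem_undup; split=> [/imageP[w wR ->]|]; first exact: reflections_classify.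
have nij i j : (i < j)%N -> i != j by move=> ij; apply: contraTneq ij => ->; rewrite ltnn.
case=> [[i [j [k [ij ->]]]]|[plr [i ->]]].
  have [w wW hw] := reflection_swap k (nij _ _ ij).
  have e := fixed_swap (nij _ _ ij) hw; rewrite -e; apply/imageP; exists w => //.
  rewrite inE wW e dim_form_ker ?eqxx //; apply: lrow_neq0; exact: nij.
have [w wW hw] := reflection_scale i 1; rewrite muln1 in hw.
have zp1 : z ^+ p != 1 by rewrite -(prim_order_dvd zP) gtnNdvd.
have e := fixed_scale zp1 hw; rewrite -e; apply/imageP; exists w => //.
by rewrite inE wW e dim_form_ker ?eqxx //; apply: delta_neq0.
Qed.

(** The default 1 is returned only for matrices outside the group; see [eltP]. *)
Definition elt (g : 'M[K]_l) : gT := odflt 1%g [pick w in W | V w == g].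

Lemma eltP g : (exists2 w, w \in W & V w = g) -> elt g \in W /\ V (elt g) = g.
Proof.
move=> [w wW hw]; rewrite /elt; case: pickP => [u /andP[uW /eqP]|/(_ w)] //=.
by rewrite wW hw eqxx.
Qed.

Definition w_swap i j k := elt (mono (tperm i j) (ga_swap i j (z ^+ k))).
Definition w_scale i k := elt (mono 1 (ga_scale i (z ^+ (p * k)))).

Lemma w_swapP i j k : i != j ->
  w_swap i j k \in W /\ V (w_swap i j k) = mono (tperm i j) (ga_swap i j (z ^+ k)).
Proof. by move=> ij; apply/eltP/reflection_swap. Qed.

Lemma w_scaleP i k :
  w_scale i k \in W /\ V (w_scale i k) = mono 1 (ga_scale i (z ^+ (p * k))).
Proof. exact/eltP/reflection_scale. Qed.

Lemma V_eq1 w : w \in W -> V w = 1%:M -> w = 1%g.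
Proof. by move=> wW h; apply: V_inj; rewrite ?group1 // repr_mx1. Qed.

Lemma stab_mono (H : {vspace 'cV[K]_l}) w s ga m : (H <= fixed_space V w)%VS ->
  V w = mono s ga -> (delta_mx m 0 : 'cV_l) \in H -> s m = m /\ ga m = 1.
Proof.
move=> /subvP hs hw /hs; rewrite mem_fixed_space hw => /eqP /matrixP /(_ m 0).
rewrite mono_mul !mxE !eqxx andbT; case: (eqVneq (s m) m) => [sm|_].
  by rewrite /= mulr1 => ->.
by rewrite /= mulr0 => /esym/eqP; rewrite oner_eq0.
Qed.

(** An element of the stabilizer fixes e_m for m other than i and j, as well as z^k e_i + e_j; only
    the identity and one swap do so. *)
Lemma stab_lrow i j k : i != j ->
  pointwise_stabilizer V (form_ker (lrow i j k)) = [set 1%g; w_swap i j k].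
Proof.
move=> ij; have [swW hsw] := w_swapP k ij.
apply/setP => w; rewrite !inE; apply/idP/idP; last first.
  case/orP => /eqP ->.
    rewrite group1; apply/subvP => v _.
    by rewrite mem_fixed_space repr_mx1 mul1mx.
  by rewrite swW (fixed_swap ij hsw) subvv.
move=> /andP[wW hs]; have [s [ga [hw _ _]]] := V_mono wW.
have fix1 m : m != i -> m != j -> s m = m /\ ga m = 1.
  move=> mi mj; apply: stab_mono hs hw _.
  by rewrite mem_form_ker lrow_mul !mxE !eqxx !andbT [i == m]eq_sym [j == m]eq_sym (negPf mi) (negPf mj) mulr0.
have sij m : m \in [:: i; j] -> s m \in [:: i; j].
  rewrite !inE => hm; apply: contraT; rewrite negb_or => /andP[a b].
  have [e _] := fix1 _ a b; have em := perm_inj e.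
  by rewrite em in a b; rewrite (negPf a) (negPf b) in hm.
pose u : 'cV[K]_l := z ^+ k *: delta_mx i 0 + delta_mx j 0.
have ui : u i 0 = z ^+ k by rewrite !mxE !eqxx (negPf ij) addr0 mulr1.
have uj : u j 0 = 1 by rewrite !mxE !eqxx eq_sym (negPf ij) mulr0 add0r.
have : u \in fixed_space V w.
  by apply: (subvP hs); rewrite mem_form_ker lrow_mul ui uj mulr1.
rewrite mem_fixed_space hw => /eqP hu.
have ei : ga i * u (s i) 0 = z ^+ k by rewrite -mono_mul hu.
have ej : ga j * u (s j) 0 = 1 by rewrite -mono_mul hu.
have := sij i; rewrite !inE eqxx => /(_ isT) /orP[/eqP si|/eqP si].
  have sj : s j = j.
    have := sij j; rewrite !inE eqxx orbT => /(_ isT) /orP[/eqP sj|/eqP //].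
    by move: ij; rewrite -(inj_eq (@perm_inj _ s)) si sj eqxx.
  apply/orP; left; apply/eqP/V_eq1 => //; rewrite hw.
  apply/matrixP => m n; rewrite !mxE eq_sym; case: (eqVneq m i) => [->|mi].
    by rewrite si; case: eqP => // _; apply: (mulIf (zX_neq0 k)); rewrite mul1r -[RHS]ei si ui.
  case: (eqVneq m j) => [->|mj]; last by have [-> ->] := fix1 _ mi mj; case: eqP.
  by rewrite sj; case: eqP => // _; rewrite sj uj mulr1 in ej.
have sj : s j = i.
  have := sij j; rewrite !inE eqxx orbT => /(_ isT) /orP[/eqP //|/eqP sj].
  by move: ij; rewrite -(inj_eq (@perm_inj _ s)) si sj eqxx.
apply/orP; right; apply/eqP/V_inj => //; rewrite hw hsw.
rewrite si uj mulr1 in ei; rewrite sj ui in ej.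
apply/matrixP => m n; rewrite !mxE /ga_swap; case: (eqVneq m i) => [->|mi].
  by rewrite si tpermL ei.
case: (eqVneq m j) => [->|mj]; last first.
  by have [-> ->] := fix1 _ mi mj; rewrite tpermD // eq_sym.
by rewrite sj tpermR; case: eqP => // _; apply: (mulIf (zX_neq0 k)); rewrite ej mulVf ?zX_neq0.
Qed.

Lemma w_swap_neq1 i j k : i != j -> w_swap i j k != 1%g.
Proof.
move=> ij; apply/eqP => h; have [_] := w_swapP k ij; rewrite h repr_mx1.
move/matrixP/(_ i i); rewrite !mxE eqxx tpermL (negPf ij) => /eqP.
by rewrite oner_eq0.
Qed.

Lemma stab_order_lrow i j k : i != j -> stab_order V (form_ker (lrow i j k)) = 2.
Proof. by move=> ij; rewrite /stab_order stab_lrow // cards2 eq_sym w_swap_neq1. Qed.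

Lemma rp_gt0 : (0 < r %/ p)%N.
Proof. by rewrite divn_gt0 // dvdn_leq. Qed.

Lemma zp_prim : (r %/ p).-primitive_root (z ^+ p).
Proof.
have e : (r %/ (r %/ p) = p)%N by rewrite -{1}(divnK pr) mulKn // rp_gt0.
by rewrite -{2}e; apply: (dvdn_prim_root zP); rewrite -{2}(divnK pr) dvdn_mulr.
Qed.

(** Such an element is diagonal with a single free entry, whose (r/p)-th power is 1, hence a power
    of z^p. *)
Lemma stab_erow i w : w \in W ->
  (w \in pointwise_stabilizer V (form_ker (erow i))) =
  [exists k : 'I_(r %/ p), w == w_scale i k].
Proof.
move=> wW; rewrite inE wW /=; apply/idP/existsP => [hs|[k /eqP ->]]; last first.
  have [_ hk] := w_scaleP i k; apply/subvP => v.
  rewrite mem_form_ker erow_mul mem_fixed_space hk => /eqP h.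
  apply/eqP/matrixP => m b; rewrite !ord1 mono_mul perm1 /ga_scale.
  by case: (eqVneq m i) => [->|mi]; rewrite ?h ?mulr0 ?mul1r.
have [s [ga [hw g1 gp]]] := V_mono wW.
have fix1 m : m != i -> s m = m /\ ga m = 1.
  move=> mi; apply: stab_mono hs hw _.
  by rewrite mem_form_ker erow_mul !mxE andbT eq_sym [i == m]eq_sym (negPf mi).
have si : s i = i.
  apply/eqP; apply: contraT => h; have [e _] := fix1 _ h.
  by move: h; rewrite (perm_inj e) eqxx.
have pg : \prod_m ga m = ga i by rewrite (bigD1 i) //= big1 ?mulr1 // => m /fix1[].
rewrite pg in gp; have [k hk] := prim_rootP zp_prim gp.
exists k; have [kW hk'] := w_scaleP i k.
apply/eqP/V_inj => //; rewrite hw hk'; apply/matrixP => m n; rewrite !mxE perm1 /ga_scale.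
case: (eqVneq m i) => [->|mi]; first by rewrite si hk exprM.
by have [-> ->] := fix1 _ mi.
Qed.

Lemma w_scale_inj i : injective (fun k : 'I_(r %/ p) => w_scale i k).
Proof.
move=> k k' /= h; have [_] := w_scaleP i k; rewrite h; have [_ ->] := w_scaleP i k'.
move/matrixP/(_ i i); rewrite !mxE perm1 eqxx /ga_scale eqxx !exprM => /eqP.
by rewrite (eq_prim_root_expr zp_prim) !modn_small // eq_sym => /eqP/val_inj.
Qed.

Lemma stab_erowE i : pointwise_stabilizer V (form_ker (erow i)) =
  [set w_scale i (k : 'I_(r %/ p)) | k : 'I_(r %/ p)].
Proof.
apply/setP => w; case wW: (w \in W); last first.
  rewrite inE wW; apply/esym/imsetP => -[k _ e].
  by have [] := w_scaleP i k; rewrite -e wW.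
rewrite stab_erow //; apply/existsP/imsetP => [[k /eqP ->]|[k _ ->]]; by exists k.
Qed.

Lemma stab_order_erow i : stab_order V (form_ker (erow i)) = (r %/ p)%N.
Proof. by rewrite /stab_order stab_erowE card_imset ?card_ord //; apply: w_scale_inj. Qed.

Local Notation idx := ('I_l + 'I_l * 'I_l * 'I_r)%type.

Definition idx_row (x : idx) : 'rV[K]_l :=
  match x with inl i => erow i | inr (i, j, k) => lrow i j k end.
Definition idx_hyper (x : idx) := idx_good x && (if x is inl _ then (p < r)%N else true).

Lemma idx_row_neq0 x : idx_good x -> idx_row x != 0.
Proof.
case: x => [i|[[i j] k]] /= h; first exact: delta_neq0.
by apply: lrow_neq0; apply: contraTneq h => ->; rewrite ltnn.
Qed.

Lemma linear_form_idx x : PolyDefs.linear_form (idx_row x) = idx_form z x.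
Proof. by case: x => [i|[[i j] k]]; [exact: linear_form_delta|exact: linear_form_lrow]. Qed.

Lemma arrangement_perm : perm_eq (reflection_arrangement V)
  [seq form_ker (idx_row x) | x <- [seq x <- index_enum {: idx} | idx_hyper x]].
Proof.
apply: uniq_perm; first exact: undup_uniq.
  rewrite map_inj_in_uniq ?filter_uniq ?index_enum_uniq // => x y.
  rewrite !mem_filter => /andP[/andP[gx _] _] /andP[/andP[gy _] _] e.
  (* Equal kernels would make the two forms proportional, against [idx_form_ndvd]. *)
  apply/eqP; apply: contraT => ne.
  have [c c0 ey] := form_ker_eq (idx_row_neq0 gx) (esym e).
  case: (idx_form_ndvd zP gx gy ne); rewrite -!linear_form_idx ey linear_formZ.
  by rewrite -mpoly.mul_mpolyC; apply/rdvd_mull/rdvd_refl.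
move=> H; apply/idP/idP.
  move=> /mem_arrangement [[i [j [k [ij ->]]]]|[plr [i ->]]]; apply/mapP.
    have kr : (k %% r < r)%N by rewrite ltn_mod.
    exists (inr (i, j, Ordinal kr)); last by rewrite /= /Freeness.lrow /= (prim_expr_mod zP).
    by rewrite mem_filter mem_index_enum /idx_hyper /= ij.
  by exists (inl i) => //; rewrite mem_filter mem_index_enum /idx_hyper /= plr.
move=> /mapP[[i|[[i j] k]]]; rewrite mem_filter mem_index_enum /idx_hyper andbT /= ?andbT.
  by move=> plr ->; apply/mem_arrangement; right; split=> //; exists i.
by move=> ij ->; apply/mem_arrangement; left; exists i, j, k.
Qed.

(** The c of h = r(l-1) + c: the order e_H for coordinate hyperplanes, and 0 when the arrangement
    does not contain them. *)
Definition axis_order : nat := if (p < r)%N then (r %/ p)%N else 0%N.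

Lemma coxeter_numberE : coxeter_number V = (r * l.-1 + axis_order)%N.
Proof.
rewrite /coxeter_number (perm_big _ arrangement_perm) big_map big_filter big_mkcond.
rewrite big_sumType /=.
have -> : (\sum_(i < l) (if idx_hyper (inl i) then
    stab_order V (form_ker (idx_row (inl i))) else 0) = l * axis_order)%N.
  rewrite -[X in (X * axis_order)%N]card_ord -sum_nat_const; apply: eq_bigr => i _.
  by rewrite /idx_hyper /axis_order /=; case: ifP => // _; rewrite stab_order_erow.
have -> : (\sum_(x : 'I_l * 'I_l * 'I_r) (if idx_hyper (inr x) then
    stab_order V (form_ker (idx_row (inr x))) else 0) = 2 * r * 'C(l, 2))%N.
  transitivity (\sum_(i < l) \sum_(j < l) \sum_(k < r) if (i < j)%N then 2 else 0)%N.
    rewrite pair_bigA pair_bigA /=; apply: eq_bigr => -[[i j] k] _.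
    rewrite /idx_hyper /= andbT; case: ifP => // ij; rewrite stab_order_lrow //.
    by apply: contraTneq ij => ->; rewrite ltnn.
  rewrite -sum_ltn_ord big_distrr; apply: eq_bigr => i _ /=.
  rewrite big_distrr; apply: eq_bigr => j _ /=.
  rewrite sum_nat_const card_ord; case: (i < j)%N; lia.
have h := mul_bin_diag l 1; rewrite bin1 in h.
have -> : (l * axis_order + 2 * r * 'C(l, 2) = (r * l.-1 + axis_order) * l)%N by nia.
by rewrite mulnK // ltnW.
Qed.

End Group.
End MonomialW.

(** * Freeness of the two reflection multi-arrangements *)

Module FreeArr.
Import mpoly Saito Freeness Bases MonomialW.

Section Arithmetic.
Variables (r p m : nat).
Hypotheses (r2 : (2 <= r)%N) (p0 : (0 < p)%N) (pr : (p %| r)%N).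
Local Notation c := (axis_order r p).

(* [x_j^(kappa + r t)], [t < l - 1], and [x_j^(kappa - r)] times the
   [defect]-th power of the product of the coordinates generate the module of
   polynomial maps transforming like the [x_j^kappa]. *)
Definition kappa : nat := (if p < r then 1 + ((p - m %% p) %% p) * (r %/ p) else 1)%N.
Definition defect : nat := (r + (p < r) - kappa)%N.
Definition shift : nat := ((m * c + kappa - 1) %/ r)%N.
Definition module_exponent l (t : 'I_l) : nat :=
  (if (t : nat) is t'.+1 then kappa + r * t' else (p < r) + defect * l.-1)%N.

Lemma kappa_bounds : (0 < kappa)%N /\ (kappa <= r)%N.
Proof.
rewrite /kappa; case: ifP => _; last by split=> //; apply: ltnW.
split; first by rewrite addn_gt0.
have rp := MonomialW.rp_gt0 r2 p0 pr.
have : ((p - m %% p) %% p < p)%N by rewrite ltn_mod.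
have := divnK pr; move: (r %/ p)%N ((p - m %% p) %% p)%N rp => a s a0 e hs.
have h : (s.+1 * a <= p * a)%N by rewrite leq_mul2r hs orbT.
by rewrite mulSn in h; lia.
Qed.

(** [kappa] is the representative of 1 - mc modulo r between 1 and r, so the division in [shift] is
    exact. *)
Lemma shiftE : (r * shift + 1 = m * c + kappa)%N.
Proof.
have [k0 _] := kappa_bounds; rewrite /shift mulnC divnK; first by lia.
rewrite /kappa /axis_order; case: ifP => _; last by rewrite muln0 add0n subnn.
rewrite [(1 + _)%N]addnC addnA addnK -mulnDl -{1}(divnK pr) mulnC dvdn_mul //.
rewrite /dvdn modnDmr -modnDml subnKC ?modnn //.
by rewrite ltnW // ltn_mod.
Qed.

(** The relation [hb] required by [odd_basis], for the multiplicity mc + 1 if p < r and 0 if p =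
    r. *)
Lemma defectE : (defect + 1 + r * shift = m * c + (p < r)%N + r)%N.
Proof. by have [k0 k1] := kappa_bounds; have := shiftE; rewrite /defect; lia. Qed.

Lemma defect_le : (defect <= r)%N.
Proof. by have [k0 k1] := kappa_bounds; rewrite /defect; case: (p < r)%N; lia. Qed.

End Arithmetic.

Section Free.
Variables (K : numClosedFieldType) (r p l : nat).
Variables (gT : finGroupType) (W : {group gT}) (V : mx_representation K W l) (z : K).
Hypotheses (zP : r.-primitive_root z) (r2 : (2 <= r)%N) (l2 : (2 <= l)%N).
Hypotheses (p0 : (0 < p)%N) (pr : (p %| r)%N) (Vfaith : mx_faithful V).
Hypothesis hW : forall g : 'M[K]_l,
  in_monomial_group r p g <-> exists2 w, w \in W & V w = g.
Implicit Types (i j : 'I_l).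
Local Notation S := {mpoly K[l]}.
Local Notation c := (axis_order r p).

(** The orders e_H are 2 on the hyperplanes x_i = z^k x_j and c on the coordinate hyperplanes, when
    there are any; this explains 2 m0 + mu and m0 c + mu. *)
Lemma free_from_basis (mu b m0 : nat) (B : 'M[S]_l) (d : 'I_l -> nat) (es : seq nat) :
  ((p < r)%N -> b = m0 * c + mu)%N -> (p < r)%N \/ b = 0%N ->
  (forall t, saito_cond z b (2 * m0 + mu) 1 (row t B)) ->
  (forall t i, B t i \is (d t).-homog) ->
  (\sum_t d t = l * b + (2 * m0 + mu) * r * 'C(l, 2))%N ->
  \det B != 0 -> perm_eq es [seq d t | t <- enum 'I_l] ->
  free_with_exponents (reflection_arrangement V)
    (fun H => m0 * stab_order V H + mu)%N es.
Proof.
move=> hb hb0 hB hd sd dB hes.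
have nij i j : (i < j)%N -> i != j by move=> ij; apply: contraTneq ij => ->; rewrite ltnn.
have memA := mem_arrangement zP r2 p0 pr hW.
apply: (free_by_saito zP (b := b) (n := 2 * m0 + mu)) hB hd sd dB hes.
- by move=> H /memA [h|[_ h]]; [left|right].
- move=> i j k ij; split; first by apply/memA; left; exists i, j, k.
  by rewrite (stab_order_lrow zP r2 Vfaith hW k (nij _ _ ij)) mulnC.
- move=> i /memA [[i' [j [k [ij e]]]]|[plr _]].
    exfalso; have [a a0 ea] := form_ker_eq (lrow_neq0 z k (nij _ _ ij)) e.
    have nij' := nij _ _ ij; have nji' : j != i' by rewrite eq_sym.
    move/rowP: ea => ea; have := ea i'; have := ea j.
    rewrite !mxE !eqxx (negPf nij') (negPf nji') /= mulr0 !mulr1 subr0 sub0r.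
    case: (eqVneq i' i) => [<-|_]; last first.
      by move=> _ /esym; rewrite mulr1 => a00; rewrite a00 eqxx in a0.
    rewrite (negPf nji') => /esym/eqP; rewrite mulf_eq0 oppr_eq0 (negPf a0).
    by rewrite (negPf (zX_neq0 zP k)).
  by rewrite (stab_order_erow zP r2 p0 pr Vfaith hW) hb // /axis_order plr.
- case: hb0 => [plr|]; [right=> i|by left].
  by apply/memA; right; split=> //; exists i.
Qed.

Theorem free_even m :
  free_with_exponents (reflection_arrangement V)
    (fun H => m * stab_order V H)%N (nseq l (m * coxeter_number V)%N).
Proof.
have nconst (a : nat) : perm_eq (nseq l a) [seq a | t <- enum 'I_l].
  rewrite -[l in nseq l a]size_enum_ord; suff -> : nseq (size (enum 'I_l)) a = [seq a | t <- enum 'I_l] by [].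
  by elim: (enum 'I_l) => //= _ s ->.
have l0 : (0 < l)%N by apply: ltnW.
have c0 : ~~ (p < r)%N -> c = 0%N by rewrite /axis_order => /negPf ->.
have -> : (fun H => m * stab_order V H)%N = (fun H => m * stab_order V H + 0)%N.
  by apply/boolp.funext => H; rewrite addn0.
case: m => [|m].
  (* Multiplicity 0 gives the whole module of derivations, with the partial derivatives as basis. *)
  apply: (@free_from_basis 0 0 0 1%:M (fun=> 0%N)); rewrite ?det1 ?oner_eq0 //.
  - by right.
  - by move=> t; split=> [i|i j k _]; eexists; rewrite expr0 mulr1.
  - by move=> t i; rewrite mxE; case: (t == i); rewrite ?rpred0 // ?dhomog1.
  - by rewrite sum_nat_const muln0; lia.
(* [A] and [e] are the quotient and remainder that solve e + 1 + rA = b + r, with [b] the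
   multiplicity of the coordinate hyperplanes. *)
pose b := (m.+1 * c)%N; pose A := ((b + r - 1) %/ r)%N; pose e := ((b + r - 1) %% r)%N.
have r0 : (0 < r)%N by apply: ltnW.
have er : (e <= r)%N by rewrite ltnW // ltn_mod.
have hb : (e + 1 + r * A = b + r)%N.
  by have := divn_eq (b + r - 1) r; rewrite -/A -/e; lia.
have -> : (m.+1 * coxeter_number V = b + r * (m.+1 * l.-1))%N.
  by rewrite (coxeter_numberE zP r2 l2 p0 pr Vfaith hW) /b; lia.
apply: (@free_from_basis 0 b m.+1 (even_basis K l r m e A b) (fun=> b + r * (m.+1 * l.-1))%N).
- by rewrite addn0.
- by rewrite /b /axis_order; case: ifP => _; [left|right; rewrite muln0].
- by move=> t; rewrite addn0; exact: (even_basis_cond zP r2 _ er hb).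
- by move=> t i; exact: (even_basis_homog zP r2 _ er hb).
- by rewrite addn0; apply: (even_degree_sum zP r2 m er hb l0).
- exact: (even_basis_det _ zP r2 _ er hb).
- exact: nconst.
Qed.

Section Odd.
Variable m : nat.
Local Notation defect := (defect r p m).
Local Notation shift := (shift r p m).
Local Notation module_exponent := (module_exponent r p m).
Local Notation defect_le := (defect_le m r2 p0 pr).

Theorem free_odd (ns : seq nat) : perm_eq ns [seq module_exponent t | t <- enum 'I_l] ->
  free_with_exponents (reflection_arrangement V)
    (fun H => m * stab_order V H + 1)%N [seq (m * coxeter_number V + n)%N | n <- ns].
Proof.
move=> hns; pose b := (m * c + (p < r)%N)%N.
have l0 : (0 < l)%N by apply: ltnW.
have hb : (defect + 1 + r * shift = b + r)%N by rewrite (defectE m r2 p0 pr).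
apply: (@free_from_basis 1 b m (odd_basis K l r m defect shift b) (odd_degree r m defect shift b)).
- by rewrite /b => ->.
- rewrite /b /axis_order; case: (p < r)%N; [by left|right].
  by rewrite muln0.
- by move=> t; exact: (odd_basis_cond zP r2 _ defect_le hb).
- by move=> t i; exact: (odd_basis_homog zP r2 _ defect_le hb).
- exact: (odd_degree_sum zP r2 _ defect_le hb).
- exact: (odd_basis_det _ zP r2 _ defect_le hb).
(* The degrees agree because r shift + 1 = mc + kappa. *)
- have -> : [seq odd_degree r m defect shift b t | t <- enum 'I_l] =
      [seq (m * coxeter_number V + n)%N | n <- [seq module_exponent t | t <- enum 'I_l]].
    rewrite -map_comp; apply: eq_map => t /=; rewrite /odd_degree /module_exponent.
    rewrite (coxeter_numberE zP r2 l2 p0 pr Vfaith hW) /b.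
    have := shiftE m r2 p0 pr; case: (nat_of_ord t) => [|t'] h; first by lia.
    have -> : (1 + r * (shift + t') = m * c + kappa r p m + r * t')%N by rewrite -h; lia.
    by lia.
  exact: perm_map.
Qed.

End Odd.

End Free.
End FreeArr.

(** * Coinvariant algebra and exponents *)

Module Coinvariants.
Import mpoly PolyDefs Saito Freeness.
Local Notation act := Defs.act.

Section Euler.
Variables (K : numFieldType) (l : nat).
Local Notation S := {mpoly K[l]}.
Implicit Types (i j : 'I_l).

(** Separates degrees without splitting polynomials into homogeneous components; see
    [span_constant]. *)
Definition euler (P : S) : S := \sum_i 'X_i * P^`M(i).

Lemma eulerD P Q : euler (P + Q) = euler P + euler Q.
Proof. by rewrite /euler -big_split; apply: eq_bigr => i _; rewrite mderivD mulrDr. Qed.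

Lemma eulerM P Q : euler (P * Q) = euler P * Q + P * euler Q.
Proof.
rewrite /euler mulr_suml mulr_sumr -big_split; apply: eq_bigr => i _ /=.
by rewrite mderivM mulrDr; congr (_ + _); [rewrite mulrA | rewrite mulrCA].
Qed.

Lemma euler_sum (I : Type) (s : seq I) (F : I -> S) :
  euler (\sum_(x <- s) F x) = \sum_(x <- s) euler (F x).
Proof.
apply: (big_morph euler eulerD); rewrite /euler big1 // => i _.
by rewrite mderiv0 mulr0.
Qed.

Lemma euler_monomial m : euler 'X_[m] = (mdeg m)%:R *: 'X_[m].
Proof.
rewrite /euler mdegE natr_sum scaler_suml; apply: eq_bigr => i _.
rewrite mderivX -scalerAr -mpolyXD.
have [->|mi] := eqVneq (m i) 0%N; first by rewrite !scale0r.
congr (_ *: 'X_[_]); apply/mnmP => k; rewrite mnmDE mnmBE mnm1E.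
by case: eqVneq => [<-|_]; rewrite ?subnKC ?lt0n // subn0.
Qed.

Lemma euler_homog d P : P \is d.-homog -> euler P = d%:R * P.
Proof.
move=> /dhomogP hP; rewrite {1 2}[P]mpolyE euler_sum mulr_sumr.
rewrite big_seq [RHS]big_seq; apply: eq_bigr => m mP.
have eZ c Q : euler (c *: Q) = c *: euler Q.
  by rewrite /euler scaler_sumr; apply: eq_bigr => i _; rewrite mderivZ scalerAr.
by rewrite eZ euler_monomial (hP m mP) -scalerAr scaler_nat mulr_natl.
Qed.

Lemma constant_term_euler P : constant_term (euler P) = 0.
Proof.
rewrite /constant_term /euler raddf_sum big1 // => i _ /=.
rewrite (rmorphM (mcoeff 0%MM)) /= mcoeffX.
by rewrite (_ : (U_(i) == 0)%MM = false) ?mul0r // -mdeg_eq0 mdeg1.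
Qed.

End Euler.

Section Action.
Variables (K : numClosedFieldType) (l : nat) (gT : finGroupType) (W : {group gT}).
Variable V : mx_representation K W l.
Local Notation S := {mpoly K[l]}.
Implicit Types (P Q : S) (g h : gT).

Lemma actD g P Q : act V g (P + Q) = act V g P + act V g Q.
Proof. exact: comp_mpolyD. Qed.

Lemma actM g P Q : act V g (P * Q) = act V g P * act V g Q.
Proof. exact: rmorphM. Qed.

Lemma actC g c : act V g c%:MP = c%:MP.
Proof. exact: comp_mpolyC. Qed.

Lemma actZ g c P : act V g (c *: P) = c *: act V g P.
Proof. exact: comp_mpolyZ. Qed.

Lemma act_sum g (I : Type) (s : seq I) (A : pred I) (F : I -> S) :
  act V g (\sum_(x <- s | A x) F x) = \sum_(x <- s | A x) act V g (F x).
Proof. exact: rmorph_sum. Qed.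

Lemma act_prod g (I : Type) (s : seq I) (A : pred I) (F : I -> S) :
  act V g (\prod_(x <- s | A x) F x) = \prod_(x <- s | A x) act V g (F x).
Proof. exact: rmorph_prod. Qed.

Lemma actX g P n : act V g (P ^+ n) = act V g P ^+ n.
Proof. exact: rmorphXn. Qed.

Lemma actU g (i : 'I_l) : act V g 'X_i = \sum_j V g^-1%g i j *: 'X_j.
Proof.
rewrite /act /poly_act comp_mpolyXU -tnth_nth tnth_mktuple /linear_form.
by apply: eq_bigr => j _; rewrite mxE.
Qed.

Lemma act_mul g h P : g \in W -> h \in W -> act V (g * h)%g P = act V g (act V h P).
Proof.
move=> gW hW; elim/mpoly_ring_ind: P => [c|i|P Q e1 e2|P Q e1 e2].
- by rewrite !actC.
- rewrite !actU act_sum invMg repr_mxM ?groupV //.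
  under [in RHS]eq_bigr => k _ do rewrite actZ actU scaler_sumr.
  rewrite exchange_big /=; apply: eq_bigr => j _.
  by rewrite mxE scaler_suml; apply: eq_bigr => k _; rewrite scalerA.
- by rewrite !actD e1 e2.
- by rewrite !actM e1 e2.
Qed.

Lemma act_homog g d P : P \is d.-homog -> act V g P \is d.-homog.
Proof.
move=> /dhomogP hP; rewrite [P]mpolyE act_sum big_seq; apply: rpred_sum => m mP.
rewrite actZ; apply: dhomogZ; rewrite -(hP m mP) mpolyXE_id act_prod /= mdegE.
apply: homog_prod => i _; rewrite actX -[X in X.-homog]mul1n; apply: homogX.
by rewrite actU; apply: rpred_sum => j _; apply: dhomogZ; apply: homogU.
Qed.

Definition invariant F := forall g, g \in W -> act V g F = F.

Lemma ideal0 : in_coinvariant_ideal V 0.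
Proof.
exists 0%N, (fun=> 0), (fun=> 0); split; last by rewrite big_ord0.
by case.
Qed.

Lemma ideal_gen Q F : constant_term F = 0 -> invariant F ->
  in_coinvariant_ideal V (Q * F).
Proof. by exists 1%N, (fun=> Q), (fun=> F); split=> //; rewrite big_ord1. Qed.

Lemma idealD P Q : in_coinvariant_ideal V P -> in_coinvariant_ideal V Q ->
  in_coinvariant_ideal V (P + Q).
Proof.
move=> [n [A [F [hF ->]]]] [n' [A' [F' [hF' ->]]]].
exists (n + n')%N, (fun u => match split u with inl a => A a | inr a => A' a end),
  (fun u => match split u with inl a => F a | inr a => F' a end); split.
  by move=> u; case: (split u).
rewrite big_split_ord /=; congr (_ + _); apply: eq_bigr => i _.
  by rewrite (unsplitK (inl i)).
by rewrite (unsplitK (inr i)).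
Qed.

Lemma idealM Q P : in_coinvariant_ideal V P -> in_coinvariant_ideal V (Q * P).
Proof.
move=> [n [A [F [hF ->]]]]; exists n, (fun u => Q * A u), F; split=> //.
by rewrite mulr_sumr; apply: eq_bigr => i _; rewrite mulrA.
Qed.

Lemma idealZ c P : in_coinvariant_ideal V P -> in_coinvariant_ideal V (c *: P).
Proof. by rewrite -mul_mpolyC; apply: idealM. Qed.

Lemma ideal_sum (I : Type) (s : seq I) (A : pred I) (F : I -> S) :
  (forall x, A x -> in_coinvariant_ideal V (F x)) ->
  in_coinvariant_ideal V (\sum_(x <- s | A x) F x).
Proof. by move=> h; elim/big_ind: _ => //; [exact: ideal0 | exact: idealD]. Qed.

Section Averaging.
Variables (d : nat) (U : mx_representation K W d).
Implicit Types (A B : 'I_d -> S).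

Definition equivariant A := forall g, g \in W -> forall j,
  act V g (A j) = \sum_i U g i j *: A i.

(** The Reynolds operator on linear maps from [U] to S. *)
Definition average A j : S :=
  #|W|%:R^-1 *: \sum_(g in W) \sum_i U g^-1%g i j *: act V g (A i).

Lemma cardW_neq0 : (#|W|%:R : K) != 0.
Proof. by rewrite pnatr_eq0 -lt0n cardG_gt0. Qed.

Lemma average_equivariant A : equivariant (average A).
Proof.
move=> h hW j; rewrite /average actZ act_sum.
under [in RHS]eq_bigr => k _ do rewrite scalerA mulrC -scalerA scaler_sumr.
rewrite -scaler_sumr; congr (_ *: _).
rewrite exchange_big /= [RHS](reindex_inj (mulgI h)) /=.
apply: eq_big => [g|g gW]; first by rewrite groupMl.
rewrite act_sum; under [in RHS]eq_bigr => k _ do rewrite scaler_sumr.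
rewrite exchange_big /=; apply: eq_bigr => i _.
rewrite actZ -act_mul //; under [RHS]eq_bigr => k _ do rewrite scalerA.
rewrite -scaler_suml; congr (_ *: _).
have -> : U g^-1%g = U (h * g)^-1%g *m U h.
  by rewrite -repr_mxM ?groupV ?groupM // invMg mulgKV.
by rewrite mxE; apply: eq_bigr => k _; rewrite mulrC.
Qed.

Lemma sum_repr_inv g A j : g \in W ->
  \sum_i U g^-1%g i j *: (\sum_k U g k i *: A k) = A j.
Proof.
move=> gW; under eq_bigr => i _ do rewrite scaler_sumr.
rewrite exchange_big /= (bigD1 j) //= [X in _ + X]big1 ?addr0 => [|k kj].
  under eq_bigr => i _ do rewrite scalerA mulrC.
  rewrite -scaler_suml; have := repr_mxM U gW (groupVr gW).
  by rewrite mulgV repr_mx1 => /matrixP/(_ j j); rewrite !mxE eqxx => <-; rewrite scale1r.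
under eq_bigr => i _ do rewrite scalerA mulrC.
rewrite -scaler_suml; have := repr_mxM U gW (groupVr gW).
by rewrite mulgV repr_mx1 => /matrixP/(_ k j); rewrite !mxE (negPf kj) => <-; rewrite scale0r.
Qed.

Lemma average_id A j : equivariant A -> average A j = A j.
Proof.
move=> hA; rewrite /average (eq_bigr (fun=> A j)) => [|g gW]; last first.
  by under eq_bigr => i _ do rewrite hA //; apply: sum_repr_inv.
by rewrite sumr_const -scaler_nat scalerA mulVf ?scale1r ?cardW_neq0.
Qed.

(** [A j] is the average of the terms that equivariance would produce; the actual terms differ from
    these by elements of the ideal. *)
Lemma average_mod_ideal A j :
  (forall g, g \in W -> forall j, in_coinvariant_ideal V
     (act V g (A j) - \sum_i U g i j *: A i)) ->
  in_coinvariant_ideal V (A j - average A j).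
Proof.
move=> hA; have e : A j = #|W|%:R^-1 *: \sum_(g in W) \sum_i U g^-1%g i j *: (\sum_k U g k i *: A k).
  rewrite (eq_bigr (fun=> A j)) => [|g gW]; last exact: sum_repr_inv.
  by rewrite sumr_const -scaler_nat scalerA mulVf ?scale1r ?cardW_neq0.
rewrite {1}e /average -scalerBr -sumrB; apply/idealZ/ideal_sum => g gW.
rewrite -sumrB; apply: ideal_sum => i _; rewrite -scalerBr; apply: idealZ.
by rewrite -opprB -scaleN1r; apply/idealZ/hA.
Qed.

Lemma average_homog A k : (forall j, A j \is k.-homog) -> forall j, average A j \is k.-homog.
Proof.
move=> hA j; apply: dhomogZ; apply: rpred_sum => g _; apply: rpred_sum => i _.
by apply: dhomogZ; apply: act_homog.
Qed.

Lemma average_sum (I : Type) (s : seq I) (F : I -> 'I_d -> S) j :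
  average (fun i => \sum_(x <- s) F x i) j = \sum_(x <- s) average (F x) j.
Proof.
rewrite /average -scaler_sumr; congr (_ *: _); rewrite [RHS]exchange_big.
apply: eq_bigr => g _; rewrite [RHS]exchange_big; apply: eq_bigr => i _.
by rewrite act_sum scaler_sumr.
Qed.

Lemma average_mul F A j : invariant F ->
  average (fun i => A i * F) j = average A j * F.
Proof.
move=> hF; rewrite /average -scalerAl mulr_suml; congr (_ *: _).
apply: eq_bigr => g gW; rewrite mulr_suml; apply: eq_bigr => i _.
by rewrite actM hF // scalerAl.
Qed.

End Averaging.

Section Multiplicity.
Variables (d : nat) (U : mx_representation K W d).
Variables (B : 'M[S]_d) (deg : 'I_d -> nat).
Hypothesis B_equivariant : forall t, equivariant U (fun j => B t j).
Hypothesis B_homog : forall t j, B t j \is (deg t).-homog.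
Hypothesis B_det : \det B != 0.
Hypothesis B_span : forall A : 'I_d -> S, equivariant U A ->
  exists c : 'rV[S]_d, \row_j A j = c *m B.

(** Applying [g] to the expansion of [A] yields a second expansion in the rows of [B]; as [\det B]
    is nonzero, the two coincide. *)
Lemma span_invariant (A : 'I_d -> S) (c : 'rV[S]_d) : equivariant U A ->
  \row_j A j = c *m B -> forall t, invariant (c 0 t).
Proof.
move=> hA hc t g gW.
suff /rowP/(_ t) : \row_t act V g (c 0 t) = c by rewrite mxE.
apply: (row_comb_unique B_det); rewrite -hc; apply/rowP => j; rewrite !mxE.
pose T (v : 'I_d -> S) i := \sum_j U g^-1%g i j *: v i.
have hA' i : A i = \sum_t c 0 t * B t i by have /rowP/(_ i) := hc; rewrite !mxE.
have act_c i : act V g (A i) = \sum_t act V g (c 0 t) * (\sum_k U g k i *: B t k).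
  rewrite hA' act_sum; apply: eq_bigr => s _.
  by rewrite actM B_equivariant.
rewrite -(sum_repr_inv U A j gW).
under [RHS]eq_bigr => i _ do rewrite -hA // act_c scaler_sumr.
rewrite exchange_big /=; apply: eq_bigr => s _; rewrite mxE.
under [RHS]eq_bigr => i _ do rewrite scalerAr.
by rewrite -mulr_sumr (sum_repr_inv U (fun k => B s k)).
Qed.

Let avg_in_ideal (A : 'I_d -> S) := exists c : 'rV[S]_d,
  \row_j average U A j = c *m B /\ forall t, constant_term (c 0 t) = 0.

Let avg_in_ideal_sum (I : Type) (s : seq I) (F : I -> 'I_d -> S) :
  (forall x, avg_in_ideal (F x)) -> avg_in_ideal (fun i => \sum_(x <- s) F x i).
Proof.
move=> hF; have [c hc] := boolp.choice hF; exists (\sum_(x <- s) c x); split.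
  rewrite mulmx_suml; apply/rowP => j; rewrite mxE average_sum summxE.
  by apply: eq_bigr => x _; have [/rowP/(_ j)] := hc x; rewrite mxE.
move=> t; rewrite summxE /constant_term raddf_sum big1 // => x _.
by have [_ h] := hc x; exact: h.
Qed.

(** [A] is its own average, so it suffices to average vectors with a single entry Q F. The invariant
    F comes out of the average, so the coefficients are multiples of F and have no constant term. *)
Lemma span_ideal (A : 'I_d -> S) (c : 'rV[S]_d) : equivariant U A ->
  \row_j A j = c *m B -> (forall j, in_coinvariant_ideal V (A j)) ->
  forall t, constant_term (c 0 t) = 0.
Proof.
move=> hA hc hI; pose e (i : 'I_d) (P : S) (k : 'I_d) := if k == i then P else 0.
have he i Q F : constant_term F = 0 -> invariant F -> avg_in_ideal (fun k => e i (Q * F) k).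
  move=> hF iF; have [c' hc'] := B_span (@average_equivariant d U (e i Q)).
  exists (F *: c'); split.
    transitivity (F *: \row_j average U (e i Q) j); last by rewrite hc' scalemxAl.
    apply/rowP => j; rewrite mxE [RHS]mxE [X in _ = _ * X]mxE.
    transitivity (average U (e i Q) j * F); last exact: mulrC.
    rewrite -(average_mul U (e i Q) j iF).
    apply: (congr1 (fun v => average U v j)); apply/boolp.funext => k.
    by rewrite /e; case: ifP; rewrite ?mul0r.
  by move=> t; rewrite mxE /constant_term (rmorphM (mcoeff 0%MM)) /= -/(constant_term F) hF mul0r.
have heI i : avg_in_ideal (fun k => e i (A i) k).
  have [n [Q [F [hF ->]]]] := hI i.
  have := @avg_in_ideal_sum _ (index_enum 'I_n) (fun s => e i (Q s * F s)).
  case=> [s|c' [hc' h0]]; first by have [h1 h2] := hF s; apply: he.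
  exists c'; split; last exact: h0.
  rewrite -hc'; apply/rowP => j; rewrite [LHS]mxE [RHS]mxE.
  apply: (congr1 (fun v => average U v j)); apply/boolp.funext => k.
  by rewrite /e; case: ifP => _ //; rewrite big1.
have [c' [hc' h0]] := @avg_in_ideal_sum _ (index_enum 'I_d) (fun i => e i (A i)) heI.
suff -> : c = c' by [].
apply: (row_comb_unique B_det); rewrite -hc -hc'; apply/rowP => j; rewrite !mxE.
rewrite -[LHS](average_id j hA); apply: (congr1 (fun v => average U v j)); apply/boolp.funext => k.
by rewrite (bigD1 k) //= /e eqxx big1 ?addr0 // => i ik; rewrite eq_sym (negPf ik).
Qed.

(** Applying [euler] to the expansion gives k c_t = euler c_t + (deg t) c_t, whose constant term is
    (k - deg t) c_t(0) = 0. *)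
Lemma span_constant (A : 'I_d -> S) (c : 'rV[S]_d) k :
  (forall j, A j \is k.-homog) -> \row_j A j = c *m B ->
  forall t, deg t != k -> constant_term (c 0 t) = 0.
Proof.
move=> hk hc t tk.
have hA' j : A j = \sum_t c 0 t * B t j by have /rowP/(_ j) := hc; rewrite !mxE.
have : k%:R *: c = \row_t (euler (c 0 t) + (deg t)%:R * c 0 t).
  apply: (row_comb_unique B_det); rewrite -scalemxAl -hc; apply/rowP => j; rewrite !mxE.
  rewrite -(euler_homog (hk j)) hA' euler_sum; apply: eq_bigr => s _.
  by rewrite !mxE eulerM (euler_homog (B_homog s j)) mulrDl mulrCA !mulrA.
move/rowP/(_ t); rewrite !mxE => /(congr1 (@constant_term _ _)).
rewrite /constant_term mcoeffD -/(constant_term (euler _)) constant_term_euler add0r.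
rewrite !(rmorphM (mcoeff 0%MM)) !rmorph_nat => /eqP.
rewrite -subr_eq0 -mulrBl mulf_eq0 => /orP[|/eqP //].
by rewrite subr_eq0 eqr_nat eq_sym (negPf tk).
Qed.

(** The rows of degree [k] give a basis of Hom_W(U, (S/I)_k): a map may be averaged, its
    coefficients reduce to their constant terms modulo the ideal, and [span_ideal] gives
    independence. *)
Theorem multiplicity_of_basis k :
  coinvariant_multiplicity V U k #|[pred t | deg t == k]|.
Proof.
set T := [pred t | deg t == k].
have degT (s : 'I_#|T|) : deg (enum_val s) = k by have := enum_valP s; rewrite inE => /eqP.
exists (fun s j => B (enum_val s) j).
  move=> s; split=> [j|g gW j]; first by rewrite /is_homog -[X in X.-homog](degT s); apply: B_homog.
  by rewrite (B_equivariant _ gW) subrr; apply: ideal0.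
move=> P [hk hP].
pose A := average U P; have eA : equivariant U A := @average_equivariant d U P.
have hkA j : A j \is k.-homog by apply: average_homog.
have [c hc] := B_span eA.
have hA' j : A j = \sum_t c 0 t * B t j by have /rowP/(_ j) := hc; rewrite !mxE.
pose a : 'rV[K]_#|T| := \row_s constant_term (c 0 (enum_val s)).
have hPA j : in_coinvariant_ideal V (P j - A j) by apply: average_mod_ideal.
have ha j : in_coinvariant_ideal V (P j - \sum_s a 0 s *: B (enum_val s) j).
  have -> : P j - \sum_s a 0 s *: B (enum_val s) j =
      P j - A j + \sum_t B t j * (c 0 t - (constant_term (c 0 t))%:MP).
    under [X in _ - X = _]eq_bigr => s _ do rewrite mxE.
    rewrite -(big_enum_val (fun t => constant_term (c 0 t) *: B t j)) /=.
    under [X in _ = _ + X]eq_bigr => t _ do rewrite mulrBr.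
    rewrite sumrB addrA; congr (_ - _).
      rewrite -{1}[P j](subrK (A j)) hA'; congr (_ + _).
      by apply: eq_bigr => t _; rewrite mulrC.
    rewrite big_mkcond; apply: eq_bigr => t _; rewrite inE mulrC mul_mpolyC.
    case: ifP => // /negbT tk; by rewrite (span_constant hkA hc tk) scale0r.
  apply: idealD => //; apply: ideal_sum => t _; apply: ideal_gen.
    by rewrite /constant_term mcoeffB mcoeffC eqxx mulr1 subrr.
  move=> g gW; rewrite -mpolyCN actD actC; congr (_ + _).
  exact: span_invariant eA hc t g gW.
exists a; split=> // a' ha'.
pose D j := \sum_s (a - a') 0 s *: B (enum_val s) j.
have eD : equivariant U D.
  move=> g gW j; rewrite /D act_sum; under [RHS]eq_bigr => i _ do rewrite scaler_sumr.
  rewrite [RHS]exchange_big; apply: eq_bigr => s _; rewrite actZ B_equivariant // scaler_sumr.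
  by apply: eq_bigr => i _; rewrite !scalerA mulrC.
pose v : 'rV[S]_d := \sum_s ((a - a') 0 s)%:MP *: delta_mx 0 (enum_val s).
have hv : \row_j D j = v *m B.
  rewrite mulmx_suml; apply/rowP => j; rewrite mxE summxE; apply: eq_bigr => s _.
  by rewrite -scalemxAl -rowE !mxE mul_mpolyC.
have hI j : in_coinvariant_ideal V (D j).
  have -> : D j = (P j - \sum_s a' 0 s *: B (enum_val s) j) -
      (P j - \sum_s a 0 s *: B (enum_val s) j).
    rewrite opprB addrC addrA subrK -sumrB; apply: eq_bigr => s _.
    by rewrite !mxE scalerBl.
  by apply: idealD; [exact: ha'|rewrite -scaleN1r; apply: idealZ; exact: ha].
have h0 := span_ideal eD hv hI.
apply/rowP => s; apply/eqP; rewrite -subr_eq0; apply/eqP.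
have := h0 (enum_val s); rewrite /v summxE (bigD1 s) //= big1 ?addr0 => [|s' ss'].
  by rewrite !mxE !eqxx mulr1 /constant_term mcoeffC eqxx mulr1.
by rewrite !mxE (inj_eq enum_val_inj) eq_sym (negPf ss') andbF mulr0.
Qed.

End Multiplicity.
End Action.
End Coinvariants.

(** * The monomial modules M_k and their exponents *)

Lemma mono_mulmx (K : fieldType) l (s t : 'S_l) (a b : 'I_l -> K) :
  mono s a *m mono t b = mono (s * t)%g (fun i => a i * b (s i)).
Proof.
apply/matrixP => i j; rewrite mono_mul !mxE permM.
by case: eqP => _; rewrite ?mulr0.
Qed.

Lemma mono_inv (K : fieldType) l (s : 'S_l) (a : 'I_l -> K) : (forall i, a i != 0) ->
  invmx (mono s a) = mono s^-1 (fun j => (a (s^-1%g j))^-1).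
Proof.
move=> a0; have e : mono s a *m mono s^-1 (fun j => (a (s^-1%g j))^-1) = 1%:M.
  rewrite mono_mulmx mulgV; apply/matrixP => i j.
  by rewrite !mxE perm1 permK mulfV // eq_sym; case: eqP.
have [u _] := mulmx1_unit e.
by rewrite -[RHS]mul1mx -(mulVmx u) -mulmxA e mulmx1.
Qed.

Module PowerRepr.
Import mpoly PolyDefs Saito Freeness Bases MonomialW FreeArr Coinvariants.

Section PowerRepr.
Variables (K : numClosedFieldType) (r p l : nat).
Variables (gT : finGroupType) (W : {group gT}) (V : mx_representation K W l) (z : K).
Hypotheses (zP : r.-primitive_root z) (r2 : (2 <= r)%N) (l2 : (2 <= l)%N).
Hypotheses (p0 : (0 < p)%N) (pr : (p %| r)%N) (Vfaith : mx_faithful V).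
Hypothesis hW : forall g : 'M[K]_l,
  in_monomial_group r p g <-> exists2 w, w \in W & V w = g.
Implicit Types (i j : 'I_l) (g h : gT).
Local Notation S := {mpoly K[l]}.
Local Notation act := Defs.act.
Local Notation c := (axis_order r p).
Local Notation Vmono := (V_mono r2 hW).

(* The exponent is [q.+1] so that the zero entries of [V g] remain zero. *)
Definition pow_mx q g : 'M[K]_l := map_mx (fun x => x ^+ q.+1) (V g).

Lemma pow_mono q g s ga : V g = mono s ga -> pow_mx q g = mono s (fun i => ga i ^+ q.+1).
Proof.
move=> e; apply/matrixP => i j; rewrite /pow_mx e !mxE.
by case: eqP => _; rewrite ?expr0n.
Qed.

Lemma pow_mx_repr q : mx_repr W (pow_mx q).
Proof.
split=> [|g h gW hW'].
  rewrite /pow_mx repr_mx1; apply/matrixP => i j; rewrite !mxE.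
  by case: eqP => _; rewrite ?expr1n ?expr0n.
have [s [ga [eg _ _]]] := Vmono gW; have [t [gb [eh _ _]]] := Vmono hW'.
rewrite (pow_mono q eg) (pow_mono q eh) mono_mulmx.
rewrite (@pow_mono q (g * h)%g (s * t)%g (fun i => ga i * gb (s i))).
  by apply/matrixP => i j; rewrite !mxE exprMn.
by rewrite repr_mxM // eg eh mono_mulmx.
Qed.

Definition pow_repr q : mx_representation K W l := MxRepresentation (pow_mx_repr q).

Lemma unity_neq0 (a : K) : a ^+ r = 1 -> a != 0.
Proof.
move=> h; apply: contra_eq_neq h => ->.
by rewrite expr0n eqn0Ngt (ltnW r2) eq_sym oner_neq0.
Qed.

Lemma act_mono g s ga i : g \in W -> V g = mono s ga -> (forall i, ga i ^+ r = 1) ->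
  act V g 'X_(s i) = (ga i)^-1 *: 'X_i.
Proof.
move=> gW e g1; rewrite actU repr_mxV // e mono_inv => [|j]; last exact: unity_neq0.
rewrite (bigD1 i) //= big1 ?addr0 => [|j ji]; first by rewrite mxE permK eqxx.
by rewrite mxE permK (negPf ji) scale0r.
Qed.

Lemma pow_equivariantE q (A : 'I_l -> S) g s ga i : equivariant V (pow_repr q) A ->
  g \in W -> V g = mono s ga -> act V g (A (s i)) = ga i ^+ q.+1 *: A i.
Proof.
move=> hA gW e; rewrite hA // (bigD1 i) //= big1 ?addr0 => [|j ji].
  by rewrite (pow_mono q e) mxE eqxx.
by rewrite (pow_mono q e) mxE (inj_eq perm_inj) eq_sym (negPf ji) scale0r.
Qed.

Lemma pow_equivariantP q (A : 'I_l -> S) :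
  (forall g s ga, g \in W -> V g = mono s ga -> (forall i, ga i ^+ r = 1) ->
     (\prod_i ga i) ^+ (r %/ p) = 1 ->
     forall i, act V g (A (s i)) = ga i ^+ q.+1 *: A i) ->
  equivariant V (pow_repr q) A.
Proof.
move=> h g gW j; have [s [ga [e g1 gp]]] := Vmono gW.
have {1}-> : j = s (s^-1%g j) by rewrite permKV.
rewrite (h g s ga) // (bigD1 (s^-1%g j)) //= big1 ?addr0 => [|i ij].
  by rewrite (pow_mono q e) mxE permKV eqxx.
rewrite (pow_mono q e) mxE; case: eqP => [ej|_]; last by rewrite scale0r.
by rewrite ej permK eqxx in ij.
Qed.

Lemma act_sub_dvd g (a P : S) : (forall k, rdvd a (act V g 'X_k - 'X_k)) ->
  rdvd a (act V g P - P).
Proof.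
move=> h; elim/mpoly_ring_ind: P => [d|k|P Q hP hQ|P Q hP hQ].
- by rewrite actC subrr; apply: rdvd0.
- exact: h.
- by rewrite actD opprD addrACA; apply: rdvdD.
- rewrite actM -(subrK P (act V g P)) mulrDl -addrA -mulrBr.
  by apply: rdvdD; [apply: rdvd_mulr|apply: rdvd_mull].
Qed.

Section Exponents.
Variables (q m : nat).
Local Notation kappa := (kappa r p m).
Local Notation defect := (defect r p m).
(** Says that [pow_repr q] is M_{-kappa}, the module spanned by the x_j^kappa. *)
Hypothesis hq : (r %| q.+1 + kappa)%N.
Let kb := kappa_bounds m r2 p0 pr.

Lemma pow_unity a : a ^+ r = 1 -> a ^+ q.+1 * a ^+ kappa = 1 :> K.
Proof. by move=> h; rewrite -exprD -(divnK hq) mulnC exprM h expr1n. Qed.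

(** A reflection acts trivially modulo the form of its hyperplane. A scaling multiplies A_i by a
    scalar other than 1, so x_i divides A_i; a swap sends A_j to a multiple of A_i, which gives the
    congruence. *)
Lemma pow_equivariant_cond (A : 'I_l -> S) : equivariant V (pow_repr q) A ->
  saito_cond z (p < r)%N 1 kappa (\row_j A j).
Proof.
move=> hA; split=> [i|i j k ij]; rewrite !mxE.
  case: (ltnP p r) => plr; last by exists (A i); rewrite expr0 mulr1.
  have [gW e] := w_scaleP zP r2 pr hW i 1; set g := w_scale _ _ _ _ _ in gW e.
  rewrite muln1 in e; set a := z ^+ p in e.
  have g1 k : ga_scale i a k ^+ r = 1.
    by rewrite /ga_scale; case: ifP => _; rewrite ?expr1n // /a exprAC (prim_expr_order zP) expr1n.
  have hX k : rdvd 'X_i (act V g 'X_k - 'X_k).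
    have := act_mono k gW e g1; rewrite perm1 => ->; rewrite /ga_scale.
    case: eqP => [->|_]; last by rewrite invr1 scale1r subrr; apply: rdvd0.
    exists (a^-1 - 1)%:MP; rewrite mul_mpolyC scalerBl scale1r //.
  have := act_sub_dvd (A i) hX.
  have := pow_equivariantE i hA gW e; rewrite perm1 => ->.
  rewrite /ga_scale eqxx -[X in _ - X]scale1r -scalerBl expr1 => -[Q hQ].
  (* Otherwise r would divide p kappa, which is congruent to p modulo r. *)
  have a1 : a ^+ q.+1 - 1 != 0.
    rewrite subr_eq0 /a -exprM -(prim_order_dvd zP).
    apply/negP => h; have hpk : (r %| p * kappa)%N.
      by rewrite -(dvdn_addr _ h) -mulnDr dvdn_mull.
    move: hpk; rewrite /FreeArr.kappa plr mulnDr muln1 mulnCA [(p * _)%N]mulnC divnK //.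
    by rewrite dvdn_addl ?dvdn_mull // gtnNdvd.
  by exists ((a ^+ q.+1 - 1)^-1 *: Q); rewrite -scalerAl -hQ scalerA mulVf ?scale1r.
have nij : i != j by apply: contraTneq ij => ->; rewrite ltnn.
have [gW e] := w_swapP zP r2 hW k nij; set g := w_swap _ _ _ _ _ in gW e.
set a := z ^+ k in e.
have a1 : a ^+ r = 1 by rewrite /a exprAC (prim_expr_order zP) expr1n.
have a0 := unity_neq0 a1.
have g1 n : ga_swap i j a n ^+ r = 1.
  by rewrite /ga_swap; case: ifP => _; [|case: ifP => _]; rewrite ?expr1n // exprVn a1 invr1.
rewrite expr1; have hX n : rdvd (lin z i j k) (act V g 'X_n - 'X_n).
  have := act_mono (tperm i j n) gW e g1; rewrite tpermK => ->; rewrite /ga_swap.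
  case: tpermP => [->|->|/eqP ni /eqP nj].
  - rewrite [j == i]eq_sym (negPf nij) eqxx invrK.
    by exists (-1); rewrite mulN1r opprB.
  - rewrite eqxx; exists (a^-1)%:MP; rewrite mul_mpolyC scalerBr scalerA mulVf // scale1r //.
  - by rewrite (negPf ni) (negPf nj) invr1 scale1r subrr; apply: rdvd0.
have := act_sub_dvd (A j) hX.
have := pow_equivariantE i hA gW e; rewrite tpermL => ->.
rewrite /ga_swap eqxx => -[Q hQ]; exists (a ^+ kappa *: Q).
rewrite -scalerAl -hQ scalerBr scalerA mulrC (pow_unity a1) scale1r.
by rewrite /a -exprM.
Qed.

Definition pow_basis : 'M[S]_l :=
  \matrix_(t, j) (if (t : nat) is t'.+1 then 'X_j ^+ (kappa + r * t')
    else 'X_j ^+ (p < r)%N * \prod_(k < l | k != j) 'X_k ^+ defect).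

(** Makes the [defect]-th power of the product of the coordinates invariant, as its (r/p)-th power
    is. *)
Lemma defect_dvd : (r %/ p %| defect)%N.
Proof.
rewrite /FreeArr.defect /FreeArr.kappa; case: ltnP => [plr|rp].
  rewrite addn1 -[r.+1]add1n subnDl dvdn_sub ?dvdn_mull //.
  by rewrite -{2}(divnK pr) dvdn_mulr.
have -> : p = r by apply/eqP; rewrite eqn_leq rp dvdn_leq // ltnW.
by rewrite divnn (ltnW r2) dvd1n.
Qed.

Lemma pow_basis_equivariant t : equivariant V (pow_repr q) (fun j => pow_basis t j).
Proof.
apply: pow_equivariantP => g s ga gW e g1 gp i; rewrite !mxE.
have g0 k := unity_neq0 (g1 k).
have powV k N : act V g 'X_(s k) ^+ N = (ga k ^- N)%:MP * 'X_k ^+ N.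
  by rewrite (act_mono k gW e g1) exprZn exprVn mul_mpolyC.
case: (nat_of_ord t) => [|t'].
  rewrite actM actX powV act_prod.
  have -> : \prod_(k < l | k != s i) act V g ('X_k ^+ defect) =
      (\prod_(k < l | k != i) ga k ^- defect)%:MP * \prod_(k < l | k != i) 'X_k ^+ defect.
    rewrite (reindex_inj (@perm_inj _ s)) /= rmorph_prod -big_split /=.
    apply: eq_big => [k|k _]; first by rewrite (inj_eq perm_inj).
    by rewrite actX powV.
  rewrite -!mul_mpolyC mulrACA -mpolyCM; congr (_%:MP * _).
  have gd : \prod_(k < l) ga k ^+ defect = 1.
    by rewrite prodrXl -(divnK defect_dvd) mulnC exprM gp expr1n.
  have -> : \prod_(k < l | k != i) ga k ^- defect = ga i ^+ defect.
    have P0 : \prod_(k < l | k != i) ga k ^+ defect != 0.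
      by apply/prodf_neq0 => k _; rewrite expf_neq0.
    by rewrite (bigD1 i) //= in gd; rewrite prodfV; apply: (mulIf P0); rewrite mulVf.
  apply: (mulIf (expf_neq0 kappa (g0 i))); rewrite (pow_unity (g1 i)) -mulrA -exprD.
  have -> : (defect + kappa = r + (p < r))%N.
    by rewrite /FreeArr.defect subnK // (leq_trans kb.2) // leq_addr.
  by rewrite exprD g1 mul1r mulVf // expf_neq0.
rewrite actX powV -mul_mpolyC; congr (_%:MP * _).
apply: (mulIf (expf_neq0 kappa (g0 i))); rewrite (pow_unity (g1 i)).
by rewrite exprD exprM g1 expr1n mulr1 mulVf // expf_neq0.
Qed.

Lemma pow_basis_homog t j : pow_basis t j \is (module_exponent r p m t).-homog.
Proof.
rewrite mxE /module_exponent; case: (nat_of_ord t) => [|t']; last exact: homogUX.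
apply: homogM; first exact: homogUX.
rewrite mulnC -(card_neq j) -sum_nat_const.
by apply: homog_prod => k _; exact: homogUX.
Qed.

Lemma module_exponent_sum :
  (\sum_t module_exponent r p m (t : 'I_l) = l * (p < r) + 1 * r * 'C(l, 2))%N.
Proof.
rewrite /module_exponent; case: l l2 => // n _.
rewrite big_ord_recl /= big_split /= sum_nat_const card_ord -big_distrr /=.
rewrite -(big_mkord xpredT (fun k : nat => k)) bin2_sum.
have -> : 'C(n.+1, 2) = (n + 'C(n, 2))%N by rewrite binS bin1 addnC.
have e : (kappa + defect = r + (p < r))%N.
  by rewrite /FreeArr.defect subnKC // (leq_trans kb.2) // leq_addr.
move: 'C(n, 2) e => C; move: kappa defect => a b; case: (p < r)%N => /= e.
  have h : (n * (a + b) = n * (r + 1))%N by rewrite e.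
  rewrite /bump /=; lia.
have h : (n * (a + b) = n * (r + 0))%N by rewrite e.
lia.
Qed.

Lemma X_power_diff_neq0 i j : i != j -> 'X_i ^+ r - 'X_j ^+ r != 0 :> S.
Proof.
move=> ij; apply/eqP => /(congr1 (meval (fun k => (k == i)%:R))).
rewrite meval0 mevalB !rmorphXn /= !mevalXU eqxx [j == i]eq_sym (negPf ij) expr1n.
by rewrite expr0n eqn0Ngt (ltnW r2) subr0 => /eqP; rewrite oner_eq0.
Qed.

(** Up to monomial factors this is the Vandermonde matrix of the x_i^r. *)
Lemma pow_basis_det : \det pow_basis != 0.
Proof.
pose D : 'rV[S]_l := \row_i 'X_i ^+ r.
pose E : 'rV[S]_l := \row_(t < l) (if t == 0%N :> nat then \prod_k 'X_k ^+ defect else 1).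
pose F : 'rV[S]_l := \row_i 'X_i ^+ kappa.
have h : pow_basis *m diag_mx D = diag_mx E *m Vandermonde l D *m diag_mx F.
  apply/matrixP => t i; rewrite !mul_mx_diag mul_diag_mx !mxE.
  case: (nat_of_ord t) => [|t'] /=.
    rewrite [\prod_k _](bigD1 i) //= expr0 mulr1 mulrAC [RHS]mulrAC -!exprD.
    congr ('X_i ^+ _ * _); rewrite /FreeArr.defect; have [_ k1] := kb; lia.
  by rewrite mul1r -!exprM -!exprD; congr ('X_i ^+ _); lia.
apply/eqP => d0; have := congr1 determinant h.
rewrite !det_mulmx d0 mul0r !det_diag det_Vandermonde => /esym/eqP.
rewrite !mulf_eq0 => /orP[/orP[]|] /prodf_eq0[i _].
- rewrite mxE; case: ifP => _; rewrite ?oner_eq0 // => /prodf_eq0[k _].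
  by rewrite expf_eq0 (negPf (mpolyX_neq0 _ _)) andbF.
- move=> /prodf_eq0[j ij]; rewrite !mxE; apply/negP/X_power_diff_neq0.
  by apply: contraTneq ij => ->; rewrite ltnn.
- by rewrite mxE expf_eq0 (negPf (mpolyX_neq0 _ _)) andbF.
Qed.

Lemma equivariant_transport (d : nat) (U U' : mx_representation K W d) (C : 'M[K]_d) A :
  (forall g, g \in W -> U g *m C = C *m U' g) -> equivariant V U A ->
  equivariant V U' (fun n => \sum_k C k n *: A k).
Proof.
move=> hC hA g gW j; rewrite act_sum.
under eq_bigr => i _ do rewrite actZ hA // scaler_sumr.
rewrite exchange_big /=; under [RHS]eq_bigr => i _ do rewrite scaler_sumr.
rewrite [RHS]exchange_big /=; apply: eq_bigr => k _.
have /matrixP/(_ k j) := hC g gW; rewrite !mxE => e.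
under eq_bigr => i _ do rewrite scalerA mulrC.
under [RHS]eq_bigr => i _ do rewrite scalerA mulrC.
by rewrite -!scaler_suml e.
Qed.

Theorem pow_exponents (d : nat) (U : mx_representation K W d) (ns : seq nat) :
  mx_rsim (pow_repr q) U -> sorted leq ns ->
  perm_eq ns [seq module_exponent r p m t | t <- enum 'I_l] ->
  U_exponents V U ns.
Proof.
case=> C eld fC hC sns pns; subst d.
split=> // [|k]; first by rewrite (perm_size pns) size_map size_enum_ord.
have -> : count_mem k ns = #|[pred t | module_exponent r p m (t : 'I_l) == k]|.
  rewrite (seq.permP pns) count_map cardE -size_filter /enum_mem -filter_predI.
  by congr (size _); apply: eq_filter => t; rewrite /= !inE andbT.
pose CS : 'M[S]_l := map_mx (@mpolyC l K) C.
have uC : C \in unitmx by rewrite -row_free_unit.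
have mulCS (A : 'I_l -> S) (D : 'M[K]_l) :
    (\row_j A j) *m map_mx (@mpolyC l K) D = \row_j \sum_i D i j *: A i.
  apply/rowP => j; rewrite !mxE; apply: eq_bigr => i _.
  by rewrite !mxE mulrC mul_mpolyC.
have hCV g : g \in W -> U g *m invmx C = invmx C *m pow_repr q g.
  move=> gW; apply: (can_inj (mulKmx uC)); rewrite mulKVmx // mulmxA -hC //.
  by rewrite mulmxK.
apply: (@multiplicity_of_basis _ _ _ _ V _ U (pow_basis *m CS) (@module_exponent r p m l)).
- move=> t; have := equivariant_transport hC (pow_basis_equivariant t).
  congr equivariant; apply/boolp.funext => j; rewrite [RHS]mxE; apply: eq_bigr => i _.
  by rewrite [CS _ _]mxE mulrC mul_mpolyC.
- move=> t j; rewrite mxE; apply: rpred_sum => i _; rewrite [CS _ _]mxE mulrC mul_mpolyC.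
  by apply: dhomogZ; apply: pow_basis_homog.
- rewrite det_mulmx mulf_neq0 ?pow_basis_det // det_map_mx /= mpolyC_eq0.
  by rewrite -unitfE -unitmxE.
- move=> A hA; have hA' := equivariant_transport hCV hA.
  have := pow_equivariant_cond hA'.
  have rows t : saito_cond z (p < r)%N 1 kappa (row t pow_basis).
    have := pow_equivariant_cond (pow_basis_equivariant t).
    by congr saito_cond; apply/rowP => j; rewrite !mxE.
  move=> /(saito_criterion zP rows pow_basis_homog module_exponent_sum pow_basis_det) [c' [hc' _]].
  exists c'; rewrite mulmxA -hc' -mulCS -mulmxA -map_mxM mulVmx //.
  by rewrite map_mx1 mulmx1.
Qed.

End Exponents.
End PowerRepr.
End PowerRepr.

(** * The differential system *)

Module KZ.
Import mpoly PolyDefs Saito Freeness Bases MonomialW FreeArr Coinvariants PowerRepr.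

Section CoefficientDerivation.
Variables (K : numFieldType) (l : nat).
Local Notation S := {mpoly K[l]}.
Implicit Types (i j : 'I_l) (P Q : {poly S}).

(** Differentiation under the integral sign: the integration variable is held fixed. *)
Definition pderiv j P : {poly S} := map_poly (mderiv j) P.

Lemma coef_pderiv j P q : (pderiv j P)`_q = (P`_q)^`M(j).
Proof. by rewrite coef_map_id0 // mderiv0. Qed.

Lemma pderivM j P Q : pderiv j (P * Q) = pderiv j P * Q + P * pderiv j Q.
Proof.
apply/polyP => q; rewrite coefD !coefM coef_pderiv coefM raddf_sum /= -big_split.
by apply: eq_bigr => i _; rewrite /= mderivM !coef_pderiv.
Qed.

Lemma pderiv_XsubC j (a : S) : pderiv j ('X - a%:P) = - (a^`M(j))%:P.
Proof.
have hX : pderiv j 'X = 0.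
  apply/polyP => q; rewrite coef_pderiv coefX coef0.
  by case: (q == 1%N); rewrite -?mpolyC1 ?mderivC ?mderiv0.
by rewrite /pderiv (raddfB (map_poly (mderiv j))) /= -/(pderiv j 'X) hX sub0r map_polyC.
Qed.

Lemma pderiv_prod0 j (I : Type) (s : seq I) (A : pred I) (F : I -> {poly S}) :
  (forall x, A x -> pderiv j (F x) = 0) -> pderiv j (\prod_(x <- s | A x) F x) = 0.
Proof.
move=> h; elim/big_rec: _ => [|x P Ax hP]; last by rewrite pderivM hP h // mul0r mulr0 addr0.
have -> : (1 : {poly S}) = (1%:MP)%:P by rewrite mpolyC1.
by rewrite /pderiv map_polyC /= mderivC.
Qed.

Lemma mderivXn i j n : ('X_i ^+ n : S)^`M(j) = (n%:R * (i == j)%:R) *: 'X_i ^+ n.-1.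
Proof.
elim: n => [|n IH]; first by rewrite expr0 -mpolyC1 mderivC mul0r scale0r.
rewrite exprS mderivM IH mderivU eq_sym; case: (i == j); rewrite ?mulr1 ?mulr0 ?scale0r ?mul0r ?add0r ?mulr0 //=.
rewrite mul1r; case: n {IH} => [|n] /=; first by rewrite scale0r mulr0 addr0 scale1r.
by rewrite -scalerAr -exprS -{1}['X_i ^+ n.+1]scale1r -scalerDl -[1]/(1%:R) -natrD.
Qed.

Lemma XmderivX i j n : ('X_j : S) * ('X_i ^+ n)^`M(j) = (n%:R * (i == j)%:R) *: 'X_i ^+ n.
Proof.
rewrite mderivXn; case: eqP => [->|_]; last by rewrite mulr0 !scale0r mulr0.
by case: n => [|n] /=; rewrite ?mul0r ?scale0r ?mulr0 // -scalerAr -exprS.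
Qed.

Lemma XmderivM j (P Q : S) : 'X_j * (P * Q)^`M(j) = ('X_j * P^`M(j)) * Q + P * ('X_j * Q^`M(j)).
Proof. by rewrite mderivM mulrDr; congr (_ + _); [rewrite mulrA | rewrite mulrCA]. Qed.

End CoefficientDerivation.

Lemma wev_XsubC_diff (R : comNzRingType) (w : nat -> R) y a b P :
  (a - b) * wev w y P = wev w y (('X - b%:P) * P) - wev w y (('X - a%:P) * P).
Proof.
rewrite -wevZ; have -> : (a - b) *: P = ('X - b%:P) * P + (-1) *: (('X - a%:P) * P).
  by rewrite scaleN1r -mulrBl -mul_polyC polyCB -(subrKA 'X) opprB addrC.
by rewrite wevD wevZ mulN1r.
Qed.

(** This and the next three facts isolate the algebra of the derivative computations below, with
    plain letters for polynomials. *)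
Fact cross_ring (R : comNzRingType) (d q c' a e b I J F DF : R) : a * F = b * e * I ->
  q * d * a * F + a * DF = (0 * e + b * (c' * d * e)) * I + b * e * (- J - d * ((c' - q) * I)) ->
  a * DF = - (b * e * J).
Proof.
move=> h /(canRL (addKr _)) ->.
have -> : q * d * a * F = q * d * (a * F) by rewrite mulrA.
by rewrite h; ring.
Qed.

Fact cross_ring2 (R : idomainType) (Xi Xj xj xj1 a b e b' xjd I Ii Ij Fi Fj DF r' : R) :
  a != 0 -> xj != 0 -> Xj = xj * xj1 -> xj * xjd * b' = Xj ->
  (Xi - Xj) * I = Ii - Ij -> a * Fi = b * e * Ii -> a * Fj = b' * e * Ij ->
  a * (xj * DF) = - (b * e * (r' * Xj * I)) ->
  (Xi - Xj) * DF = - (r' * (xj1 * Fi - xjd * b * Fj)).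
Proof.
move=> a0 xj0 e1 e2 hI h1 h2 h3; apply: (mulfI a0); apply: (mulfI xj0).
transitivity ((Xi - Xj) * (a * (xj * DF))); first by ring.
transitivity (- (r' * (xj * xj1 * (a * Fi) - xj * xjd * b * (a * Fj)))); last by ring.
rewrite h3 h1 h2 -e1.
transitivity (- (b * e * r' * Xj) * ((Xi - Xj) * I)); first by ring.
rewrite hI -e2; ring.
Qed.

Fact diag_ring (R : comNzRingType) (P2 Xi Xj xi xi1 xj xj1 xjd xjd1 a a1 Fi Fj DF r' : R) :
  Xi = xi * xi1 -> Xj = xj * xj1 -> xjd = xj * xjd1 -> a = xi * a1 ->
  (Xi - Xj) * DF = - (r' * (xj1 * Fi - xjd1 * a * Fj)) ->
  ((Xi - Xj) * P2) * (r' * Fi - xj * DF) = xi * (P2 * (r' * (xi1 * Fi - xjd * a1 * Fj))).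
Proof.
move=> e1 e2 e3 e4 h.
transitivity (P2 * ((Xi - Xj) * r' * Fi - xj * ((Xi - Xj) * DF))); first by ring.
rewrite h e1 e2 e3 e4; ring.
Qed.

Fact diag_ring2 (R : comNzRingType) (a b d e F s : R) : (a * d) * e = a * (b * F) + s ->
  d * (a * e) - s = b * a * F.
Proof. by move=> h; have -> : d * (a * e) = a * d * e by [ring|]; rewrite h; ring. Qed.

Section KZ.
Variables (K : numClosedFieldType) (r l : nat) (z : K).
Hypotheses (zP : r.-primitive_root z) (r2 : (2 <= r)%N).
Variables (Q c : nat).
Hypotheses (Q0 : (0 < Q)%N) (Qr : (Q < r)%N) (cr : (c <= r)%N) (cQ : ~~ (r %| Q + (r - c))%N).
Local Notation S := {mpoly K[l]}.
Implicit Types (i j k n : 'I_l).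
Local Notation x := (fun i : 'I_l => ('X_i : S)).

(** The formal integral of t^(c - Q - 1 + rq) over [0,1]. By [cQ], c and Q differ modulo r, so no
    denominator is 0. *)
Definition kz_weight (q : nat) : K := (c%:R - Q%:R + r%:R * q%:R)^-1.

Lemma kz_weightP q : kz_weight q * (c%:R - Q%:R + r%:R * q%:R) = 1.
Proof.
rewrite mulVf // -natrM addrAC -natrD subr_eq0 eqr_nat; apply: contraNneq cQ => e.
have -> : (Q + (r - c) = r * q.+1)%N by rewrite mulnS; lia.
by rewrite dvdn_mulr.
Qed.

Definition kz_mult i k : nat := k != i.

(* The product of [x_i^Q] and the integral from 0 to [x_n] of
   [t^(c - Q - 1) prod_(j <> i) (t^r - X_j)]; for [i <> n] the factor
   [t^r - X_n] of the integrand contributes the [x_n^r]. *)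
Definition Phi n i : S := gw r kz_weight 0 (kz_mult i) n *
  (if i == n then x n ^+ c else x i ^+ Q * x n ^+ (r + c - Q)).

Definition kz_int n (P : {poly S}) : S := wev (fun q => (kz_weight q)%:MP) (x n ^+ r) P.

Definition others i : {poly S} := \prod_(k < l | k != i) ('X - (x k ^+ r)%:P).

Lemma kz_int_others n i :
  kz_int n (others i) = (x n ^+ r) ^+ kz_mult i n * gw r kz_weight 0 (kz_mult i) n.
Proof.
have := gw_int r kz_weight 0 (kz_mult i) n; rewrite add0n expr0 mul1r => <-.
congr wev; rewrite /others big_mkcond; apply: eq_bigr => k _.
by rewrite /kz_mult; case: eqP => _; rewrite ?expr0 ?expr1.
Qed.

(** The factor x_n^Q avoids the exponent c - Q, which may be negative. *)
Lemma Phi_int n i : x n ^+ Q * Phi n i = x i ^+ Q * x n ^+ c * kz_int n (others i).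
Proof.
rewrite kz_int_others /Phi /kz_mult; move: (gw _ _ _ _ _) => g.
case: (eqVneq i n) => [->|ni].
  by rewrite /= expr0 mul1r [g * _]mulrC mulrA.
have ac (R : comNzRingType) (a b d g' : R) : a * (g' * (b * d)) = b * (a * d) * g' by ring.
rewrite ac /= expr1 [RHS]mulrA; congr (_ * _); rewrite -[RHS]mulrA -!exprD.
by congr (_ * _ ^+ _); lia.
Qed.

Lemma Phi_homog n i : Phi n i \is (c + r * l.-1)%N.-homog.
Proof.
rewrite /Phi [(c + r * _)%N]addnC; case: (eqVneq i n) => [->|ni].
  apply: homogM; last exact: homogUX.
  apply: gw_homog; congr (_ * _)%N; rewrite -(card_neq n) -sum1_card.
  by apply: eq_bigr => k; rewrite /kz_mult => ->.
have e : (\sum_(k < l | k != n) kz_mult i k = l.-1 - 1)%N.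
  have kz0 : kz_mult i i = 0%N by rewrite /kz_mult eqxx.
  rewrite (bigD1 i ni) /= kz0 add0n -(card_neq n) -sum1_card [in RHS](bigD1 i ni) /= addKn.
  by apply: eq_bigr => k /andP[_]; rewrite /kz_mult => ->.
have l1 : (0 < l.-1)%N.
  rewrite -(card_neq n); apply/card_gt0P; exists i; rewrite inE //.
have -> : (r * l.-1 + c = r * (l.-1 - 1) + (Q + (r + c - Q)))%N by nia.
apply: homogM; first by apply: gw_homog; rewrite e.
by apply: homogM; exact: homogUX.
Qed.

(** Leibniz's rule: the derivative under the integral sign and, for n = j, the effect of the upper
    limit, rewritten with the equation of the weights. *)
Lemma Xmderiv_kz_int n j (P : {poly S}) :
  x j * (kz_int n P)^`M(j) = kz_int n (x j *: pderiv j P) +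
    (n == j)%:R * (P.[x n ^+ r] - (c%:R - Q%:R)%:MP * kz_int n P).
Proof.
have sz : (size (x j *: pderiv j P) <= size P)%N.
  rewrite (leq_trans (size_scale_leq _ _)) // /pderiv map_polyE.
  by rewrite (leq_trans (size_Poly _)) // size_map.
rewrite {2}/kz_int (wevE _ _ sz) {1 2}/kz_int {1 2}/wev horner_coef raddf_sum !mulr_sumr.
rewrite -sumrB mulr_sumr -big_split; apply: eq_bigr => q _ /=.
rewrite mderiv_mulC mulrCA XmderivM -exprM XmderivX coefZ coef_pderiv.
have : (kz_weight q)%:MP * (c%:R - Q%:R + r%:R * q%:R)%:MP = 1 :> S.
  by rewrite -mpolyCM kz_weightP mpolyC1.
rewrite mpolyCD natrM -mul_mpolyC !mpolyCM !mpolyC_nat.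
have ac (R : comNzRingType) (a u b d y rq e : R) : a * (u + rq) = 1 ->
   a * (d * y + b * (rq * e * y)) = a * (d * y) + e * (b * y - u * (a * (b * y))).
  move=> h; have -> : b * y - u * (a * (b * y)) = (a * (u + rq)) * (b * y) - u * (a * (b * y)).
    by rewrite h mul1r.
  by ring.
by move=> h; apply: ac.
Qed.

Definition others2 i j : {poly S} := \prod_(k < l | (k != i) && (k != j)) ('X - (x k ^+ r)%:P).

Lemma othersE i j : j != i -> others i = ('X - (x j ^+ r)%:P) * others2 i j.
Proof. by move=> ji; rewrite /others (bigD1 j). Qed.

Lemma others2C i j : others2 i j = others2 j i.
Proof. by apply: eq_bigl => k; rewrite andbC. Qed.

Lemma pderiv_others i j : j != i ->
  x j *: pderiv j (others i) = - ((r%:R * x j ^+ r) *: others2 i j).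
Proof.
move=> ji; rewrite (othersE ji) pderivM pderiv_XsubC.
rewrite [pderiv j (others2 i j)]pderiv_prod0 => [|k /andP[_ kj]]; last first.
  by rewrite pderiv_XsubC mderivXn (negPf kj) mulr0 scale0r polyC0 oppr0.
rewrite mulr0 addr0 -polyCN mul_polyC scalerA mulrN XmderivX eqxx mulr1 scaleNr.
by rewrite -mul_mpolyC mpolyC_nat.
Qed.

Lemma kz_int_diff n i j : j != i ->
  (x i ^+ r - x j ^+ r) * kz_int n (others2 i j) = kz_int n (others i) - kz_int n (others j).
Proof.
move=> ji; have ij : i != j by rewrite eq_sym.
rewrite (othersE ji) (othersE ij) (others2C j i); exact: wev_XsubC_diff.
Qed.

Lemma Xmderiv_kz_others n i j : j != i ->
  x j * (kz_int n (others i))^`M(j) = - (r%:R * x j ^+ r * kz_int n (others2 i j)) -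
    (n == j)%:R * ((c%:R - Q%:R) * kz_int n (others i)).
Proof.
move=> ji; rewrite Xmderiv_kz_int (pderiv_others ji) mpolyCB !mpolyC_nat; congr (_ + _).
  by rewrite -scaleNr /kz_int wevZ mulNr.
case: (eqVneq n j) => [->|_]; last by rewrite mulr0n !mul0r oppr0.
by rewrite (othersE ji) hornerM hornerXsubC subrr mul0r sub0r mulrN.
Qed.

Lemma XmderivXn n j q : x j * (x n ^+ q)^`M(j) = q%:R * (n == j)%:R * x n ^+ q.
Proof. by rewrite XmderivX -mul_mpolyC mpolyCM !mpolyC_nat. Qed.

Lemma Xmderiv_Phi n i j : j != i ->
  x n ^+ Q * (x j * (Phi n i)^`M(j)) =
    - (x i ^+ Q * x n ^+ c * (r%:R * x j ^+ r * kz_int n (others2 i j))).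
Proof.
move=> ji; apply: (@cross_ring _ (n == j)%:R Q%:R c%:R _ _ _ _ _ _ _ (Phi_int n i)); rewrite -(XmderivXn n j Q) -(XmderivXn n j c).
rewrite -XmderivM; rewrite (congr1 (fun P => x j * P^`M(j)) (Phi_int n i)).
have ij : (i == j) = false by rewrite eq_sym (negPf ji).
have <- : x j * (x i ^+ Q)^`M(j) = 0 by rewrite XmderivXn ij mulr0 mul0r.
by rewrite -XmderivM -Xmderiv_kz_others // -XmderivM.
Qed.

(** The derivative is an integral with two factors missing; times X_i - X_j it is a difference of
    integrals with one factor missing ([kz_int_diff]), that is, of components i and j. *)
Lemma Phi_deriv_cross n i j : j != i ->
  (x i ^+ r - x j ^+ r) * (Phi n i)^`M(j) =
  - (r%:R * (x j ^+ r.-1 * Phi n i - x j ^+ (r.-1 - Q) * x i ^+ Q * Phi n j)).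
Proof.
move=> ji; apply: (cross_ring2 _ _ _ _ (kz_int_diff n ji) (Phi_int n i) (Phi_int n j) (Xmderiv_Phi n ji)).
- by rewrite expf_neq0 // mpolyX_neq0.
- exact: mpolyX_neq0.
- by rewrite -exprS prednK // (ltn_trans Q0 Qr).
- by rewrite -exprS -exprD; congr (_ ^+ _); lia.
Qed.

Definition vdm i : S := \prod_(j < l | j != i) (x i ^+ r - x j ^+ r).
Definition vdm2 i j : S := \prod_(k < l | (k != i) && (k != j)) (x i ^+ r - x k ^+ r).

Lemma vdmE i j : j != i -> vdm i = (x i ^+ r - x j ^+ r) * vdm2 i j.
Proof. by move=> ji; rewrite /vdm (bigD1 j). Qed.

Definition cross_form n i j : S :=
  r%:R * (x i ^+ r.-1 * Phi n i - x j ^+ (r - Q) * x i ^+ Q.-1 * Phi n j).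

(** Euler's formula in degree c + r(l-1) gives the diagonal derivative from the others; the summand
    r(l-1) is spread over the indices j <> i. *)
Lemma Phi_euler n i : x i * (Phi n i)^`M(i) =
  c%:R * Phi n i + \sum_(j < l | j != i) (r%:R * Phi n i - x j * (Phi n i)^`M(j)).
Proof.
have := euler_homog (Phi_homog n i).
rewrite /euler (bigD1 i) //= => /(canRL (addrK _)) ->.
rewrite sumrB sumr_const card_neq addrA; congr (_ - _).
by rewrite natrD natrM mulrDl; congr (_ + _); rewrite mulrAC mulr_natr.
Qed.

(* Not divided by [x_i], which may vanish at a regular point when [c = 0]. *)
Lemma Phi_deriv_diag n i :
  x i * (vdm i * (Phi n i)^`M(i) - \sum_(j < l | j != i) vdm2 i j * cross_form n i j) =
  c%:R * vdm i * Phi n i.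
Proof.
rewrite mulrBr; apply: diag_ring2.
rewrite -mulrA Phi_euler mulrDr !big_distrr /=.
congr (_ + _); apply: eq_bigr => j ji; rewrite (vdmE ji).
apply: (diag_ring _ _ _ _ _ (Phi_deriv_cross n ji)); rewrite -exprS; congr (_ ^+ _); lia.
Qed.

End KZ.
End KZ.

(** * Sums over roots of unity and residues of the system *)

Section RootSums.
Variables (K : fieldType) (r : nat) (z : K).
Hypothesis zP : r.-primitive_root z.

Lemma sum_prim_root n : \sum_(k < r) z ^+ (k * n) = if (r %| n)%N then r%:R else 0.
Proof.
under eq_bigr do rewrite mulnC exprM.
case: ifPn => rn.
  rewrite (eqP (_ : z ^+ n == 1)) -?(prim_order_dvd zP) //.
  by under eq_bigr do rewrite expr1n; rewrite sumr_const card_ord.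
have zn1 : z ^+ n - 1 != 0 by rewrite subr_eq0 -(prim_order_dvd zP).
apply: (mulfI zn1); rewrite mulr0 -subrX1 -exprM mulnC exprM (prim_expr_order zP).
by rewrite expr1n subrr.
Qed.

(** Each 1/(a - z^k b) is a geometric sum over a^r - b^r; summing over k keeps only the term of
    index r - s. *)
Lemma partial_fractions (a b : K) s : (0 < s <= r)%N -> a ^+ r != b ^+ r ->
  \sum_(k < r) z ^+ (k * s) / (a - z ^+ k * b) =
  r%:R * a ^+ s.-1 * b ^+ (r - s) / (a ^+ r - b ^+ r).
Proof.
move=> /andP[s0 sr] ab; have ab0 : a ^+ r - b ^+ r != 0 by rewrite subr_eq0.
have inv k : (a - z ^+ k * b)^-1 =
    (\sum_(t < r) a ^+ (r.-1 - t) * (z ^+ k * b) ^+ t) / (a ^+ r - b ^+ r).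
  have h : a ^+ r - b ^+ r = (a - z ^+ k * b) * \sum_(t < r) a ^+ (r.-1 - t) * (z ^+ k * b) ^+ t.
    rewrite -{1}[b ^+ r]mul1r -(expr1n _ k) -{1}(prim_expr_order zP) -exprM mulnC exprM -exprMn.
    rewrite subrXX; congr (_ * _); apply: eq_bigr => t _; congr (_ ^+ _ * _); lia.
  have k0 : a - z ^+ k * b != 0 by apply: contraNneq ab0 => e; rewrite h e mul0r.
  by apply: (mulfI k0); rewrite mulfV // mulrA -h mulfV.
under eq_bigr do rewrite inv mulrA; rewrite -mulr_suml; congr (_ / _).
under eq_bigr do rewrite mulr_sumr; rewrite exchange_big /=.
have rs : (r - s < r)%N by lia.
have step (t : 'I_r) : \sum_(k < r) z ^+ (k * s) * (a ^+ (r.-1 - t) * (z ^+ k * b) ^+ t) =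
    a ^+ (r.-1 - t) * b ^+ t * (if (r %| s + t)%N then r%:R else 0).
  rewrite -(sum_prim_root (s + t)) mulr_sumr; apply: eq_bigr => k _.
  by rewrite exprMn -!exprM mulnDr exprD; ring.
under eq_bigr do rewrite step; rewrite (bigD1 (Ordinal rs)) //= subnKC // dvdnn big1 => [|t tn].
  rewrite addr0 mulrC mulrA; congr (_ * _ ^+ _ * _); lia.
case: ifPn => [/dvdnP[q e]|_]; last by rewrite mulr0.
case/eqP: tn; apply/val_inj => /=.
have := ltn_ord t; case: q e => [|[|q]] e; nia.
Qed.

End RootSums.

Module Residues.
Import Saito Freeness MonomialW FreeArr PowerRepr.

Section Residues.
Variables (K : numClosedFieldType) (r p l : nat).
Variables (gT : finGroupType) (W : {group gT}) (V : mx_representation K W l) (z : K).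
Hypotheses (zP : r.-primitive_root z) (r2 : (2 <= r)%N) (l2 : (2 <= l)%N).
Hypotheses (p0 : (0 < p)%N) (pr : (p %| r)%N) (Vfaith : mx_faithful V).
Hypothesis hW : forall g : 'M[K]_l,
  in_monomial_group r p g <-> exists2 w, w \in W & V w = g.
Implicit Types (i j k : 'I_l) (g h : gT).
Local Notation c := (axis_order r p).
Local Notation lrow := (@lrow K l z).
Local Notation erow i := (delta_mx 0 i : 'rV[K]_l).
Variables (q : nat).
Hypothesis cq : (p < r)%N -> ~~ (r %/ p %| q.+1)%N.
Local Notation U := (pow_repr r2 hW q).
Implicit Types (f v u : 'cV[K]_l).

Lemma lrow_val i j (k : nat) v : (lrow i j k *m v) 0 0 = v i 0 - z ^+ k * v j 0.
Proof. by rewrite mulmxBl -scalemxAl -!rowE !mxE. Qed.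

Lemma sub_pow_mul g (t : 'S_l) ga f m : V g = mono t ga ->
  ((1%:M - U g) *m f) m 0 = f m 0 - ga m ^+ q.+1 * f (t m) 0.
Proof.
move=> hg; rewrite -(mono_mul t (fun i => ga i ^+ q.+1)) -(pow_mono q hg) mulmxBl mul1mx mxE.
by rewrite [X in _ + X]mxE.
Qed.

Lemma residue_swap i j (k : nat) f m : i != j ->
  (residue V U (form_ker (lrow i j k)) *m f) m 0 =
    (m == i)%:R * (f i 0 - z ^+ (k * q.+1) * f j 0) +
    (m == j)%:R * (f j 0 - z ^- (k * q.+1) * f i 0).
Proof.
move=> ij; have [wW hw] := w_swapP zP r2 hW k ij.
rewrite /residue (stab_lrow zP r2 Vfaith hW k ij).
have -> : [set 1%g; w_swap V z i j k] :\ 1%g = [set w_swap V z i j k].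
  apply/setP => g; rewrite !inE; case: eqP => //= ->.
  by apply/esym/negbTE; rewrite eq_sym (w_swap_neq1 zP r2 hW k ij).
rewrite big_set1 (sub_pow_mul _ _ hw) /ga_swap exprM.
case: (eqVneq m i) => [->|mi]; first by rewrite tpermL (negPf ij) mul1r mul0r addr0.
case: (eqVneq m j) => [->|mj]; first by rewrite tpermR mul0r mul1r add0r exprVn.
by rewrite tpermD 1?eq_sym // expr1n mul1r subrr !mul0r addr0.
Qed.

(** By [cq] the stabilizer acts on the i-th coordinate through a nontrivial character, whose values
    sum to 0. *)
Lemma residue_scale i f m : (p < r)%N ->
  (residue V U (form_ker (erow i)) *m f) m 0 = (m == i)%:R * (r %/ p)%:R * f i 0.
Proof.
move=> plr; rewrite /residue (stab_erowE zP r2 p0 pr Vfaith hW).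
set A := [set _ | _ : _]; have -> : \sum_(w in A :\ 1%g) (1%:M - U w) = \sum_(w in A) (1%:M - U w).
  case: (boolP (1%g \in A)) => A1; last by apply: eq_bigl => w; rewrite !inE; case: eqP A1 => //= -> /negPf.
  by rewrite [RHS](big_setD1 _ A1) repr_mx1 subrr /= add0r.
rewrite big_imset /=; last by move=> k k' _ _; apply: (w_scale_inj zP r2 p0 pr hW).
have hk (k : 'I_(r %/ p)) : ((1%:M - U (w_scale p V z i k)) *m f) m 0 =
    (m == i)%:R * (1 - (z ^+ p) ^+ (k * q.+1)) * f i 0.
  have [wW hw] := w_scaleP zP r2 pr hW i k.
  rewrite (sub_pow_mul _ _ hw) perm1 /ga_scale.
  case: (eqVneq m i) => [->|mi]; last by rewrite expr1n mul1r subrr !mul0r.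
  by rewrite mul1r mulrBl mul1r -!exprM !mulnA.
rewrite mulmx_suml summxE; under eq_bigr do rewrite hk.
rewrite -mulr_suml -mulr_sumr sumrB (sum_prim_root (zp_prim zP r2 p0 pr)) (negPf (cq plr)) subr0.
by rewrite sumr_const card_ord.
Qed.

Lemma alpha_ratio (a : 'rV[K]_l) u v : a != 0 ->
  (alpha (form_ker a) *m u) 0 0 / (alpha (form_ker a) *m v) 0 0 = (a *m u) 0 0 / (a *m v) 0 0.
Proof.
move=> /alpha_form_ker[d d0 ->]; rewrite -!scalemxAl !mxE.
by rewrite -mulf_div divff // mul1r.
Qed.

Definition swap_term f u v i j (k : nat) : K :=
  (u i 0 - z ^+ k * u j 0) / (v i 0 - z ^+ k * v j 0) * (f i 0 - z ^+ (k * q.+1) * f j 0).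

(** The hyperplane x_i = z^k x_j is x_j = z^(-k) x_i, so the sum is reindexed by k -> -k modulo
    r. *)
Lemma swap_term_opp f u v i j :
  \sum_(k < r) (u i 0 - z ^+ k * u j 0) / (v i 0 - z ^+ k * v j 0) *
     (f j 0 - z ^- (k * q.+1) * f i 0) = \sum_(k < r) swap_term f u v j i k.
Proof.
have r0 : (0 < r)%N := ltnW r2.
pose neg (k : 'I_r) : 'I_r := Ordinal (ltn_pmod (r - k) r0).
have negE (k : 'I_r) : neg k = (if k == 0%N :> nat then 0 else r - k)%N :> nat.
  rewrite /neg /=; case: eqP => [->|k0]; first by rewrite subn0 modnn.
  by rewrite modn_small //; have := ltn_ord k; lia.
have negK : involutive neg.
  move=> k; apply: val_inj; change (neg (neg k) = k :> nat); rewrite !negE.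
  by have := ltn_ord k; case: (nat_of_ord k) => [|n] nr //=; case: eqP; lia.
rewrite [RHS](reindex_inj (inv_inj negK)) /=; apply: eq_bigr => k _.
have z0 : z ^+ k != 0 := zX_neq0 zP k.
have zn : z ^+ neg k = (z ^+ k)^-1.
  apply: (mulIf z0); rewrite mulVf // -exprD /= -(prim_expr_mod zP) modnDml subnK; last exact: ltnW.
  by rewrite modnn.
rewrite /swap_term !exprM zn exprVn; congr (_ * _).
have flip (a b : K) : a - z ^+ k * b = - z ^+ k * (b - (z ^+ k)^-1 * a).
  by rewrite mulrBr !mulNr mulVKf // opprK addrC.
by rewrite !flip -mulf_div divff ?mul1r // oppr_eq0.
Qed.

Lemma kz_rhs f u v m :
  (\sum_(H <- reflection_arrangement V)
     ((alpha H *m u) 0 0 / (alpha H *m v) 0 0) *: (residue V U H *m f)) m 0 =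
  c%:R * f m 0 * u m 0 / v m 0 + \sum_(j < l | j != m) \sum_(k < r) swap_term f u v m j k.
Proof.
rewrite (perm_big _ (arrangement_perm zP r2 p0 pr hW)) big_map big_filter summxE big_mkcond.
rewrite big_sumType /=; congr (_ + _).
  rewrite (bigD1 m) //= big1 ?addr0 => [|i im].
    rewrite /idx_hyper /axis_order /=; case: ifP => plr; last by rewrite !mul0r.
    rewrite mxE (alpha_ratio _ _ (delta_neq0 K m)) residue_scale // -!rowE !mxE eqxx mul1r.
    by rewrite mulrC -mulrA mulrA.
  rewrite /idx_hyper /=; case: ifP => // plr.
  by rewrite mxE residue_scale // eq_sym (negPf im) !mul0r mulr0.
pose T i j := \sum_(k < r) swap_term f u v i j k.
(* A hyperplane with i < j contributes to both components i and j; for the component m the two kinds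
   of contributions cover all j <> m. *)
transitivity (\sum_(i < l) \sum_(j < l | (i < j)%N) ((m == i)%:R * T i j + (m == j)%:R * T j i)).
  rewrite [RHS](eq_bigr (fun i => \sum_(j < l) \sum_(k < r) if (i < j)%N then
     (m == i)%:R * swap_term f u v i j k + (m == j)%:R * ((u i 0 - z ^+ k * u j 0) / (v i 0 - z ^+ k * v j 0) *
     (f j 0 - z ^- (k * q.+1) * f i 0)) else 0)) => [|i _].
    rewrite pair_bigA pair_bigA /=; apply: eq_bigr => -[[i j] k] _.
    rewrite /idx_hyper /= andbT; case: ifP => // ij.
    have nij : i != j by apply: contraTneq ij => ->; rewrite ltnn.
    rewrite mxE (alpha_ratio _ _ (lrow_neq0 _ _ nij)) !lrow_val residue_swap // mulrDr.
    by rewrite mulrCA [X in _ + X]mulrCA.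
  rewrite [LHS]big_mkcond; apply: eq_bigr => j _; case: ifP => ij; last by rewrite big1.
  by rewrite big_split -!mulr_sumr swap_term_opp.
have -> : \sum_(j < l | j != m) T m j = \sum_(j < l | (m < j)%N) T m j + \sum_(j < l | (j < m)%N) T m j.
  rewrite (bigID (fun j : 'I_l => (m < j)%N)) /=; congr (_ + _); apply: eq_bigl => j;
    by rewrite -val_eqE /=; case: ltngtP.
under eq_bigr do rewrite big_split; rewrite big_split /=; congr (_ + _).
  rewrite (bigD1 m) //= [X in _ + X]big1 ?addr0 => [|i im].
    by apply: eq_bigr => j _; rewrite eqxx mul1r.
  by apply: big1 => j _; rewrite eq_sym (negPf im) mul0r.
rewrite [RHS]big_mkcond; apply: eq_bigr => i _; case: ifP => im; last first.
  by apply: big1 => j ij; case: eqP ij im => [->|_]; rewrite ?mul0r // => ->.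
rewrite (bigD1 m) //= eqxx mul1r big1 ?addr0 // => j /andP[_ jm].
by rewrite eq_sym (negPf jm) mul0r.
Qed.

End Residues.
End Residues.

(** * The differential system at a regular point *)

Module Solutions.
Import mpoly PolyDefs Saito Freeness Bases MonomialW FreeArr Coinvariants PowerRepr KZ Residues.

Section Evaluation.
Variables (K : numClosedFieldType) (r l : nat) (z : K).
Hypotheses (zP : r.-primitive_root z) (r2 : (2 <= r)%N).
Variables (q c : nat).
Local Notation Q := (q.+1 %% r)%N.
Hypotheses (Q0 : (0 < Q)%N) (cr : (c <= r)%N) (cQ : ~~ (r %| Q + (r - c))%N).
Local Notation S := {mpoly K[l]}.
Implicit Types (i j k n : 'I_l) (P : S) (u v : 'cV[K]_l).
Local Notation Phi := (@Phi K r l Q c).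
Let Qr : (Q < r)%N. Proof. by rewrite ltn_mod ltnW. Qed.

Definition ev v P : K := P.@[fun i => v i 0].

Definition Phi_col n v : 'cV[K]_l := \col_i ev v (Phi n i).

Variables (v : 'cV[K]_l) (n : 'I_l).
Hypothesis vdiff : forall i j, i != j -> v i 0 ^+ r != v j 0 ^+ r.
Hypothesis vneq0 : (0 < c)%N -> forall i, v i 0 != 0.
Local Notation f i := (ev v (Phi n i)).
Local Notation y i := (v i 0).

Lemma ev_deriv_cross i j : j != i ->
  ev v (Phi n i)^`M(j) =
    - (r%:R * (y j ^+ r.-1 * f i - y j ^+ (r.-1 - Q) * y i ^+ Q * f j) / (y i ^+ r - y j ^+ r)).
Proof.
move=> ji; have d0 : y i ^+ r - y j ^+ r != 0 by rewrite subr_eq0 vdiff // eq_sym.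
apply: (mulfI d0); rewrite mulrN [X in _ = - X]mulrC divfK //.
have := congr1 (ev v) (Phi_deriv_cross zP r2 Q0 Qr cr cQ n ji).
rewrite /ev mevalN !mevalM !mevalB !mevalM -mpolyC_nat mevalC !rmorphXn /= !mevalXU => <-.
by rewrite mulrC.
Qed.

Lemma ev_deriv_diag i :
  ev v (Phi n i)^`M(i) = c%:R * f i / y i +
    \sum_(j < l | j != i) r%:R * (y i ^+ r.-1 * f i - y j ^+ (r - Q) * y i ^+ Q.-1 * f j) /
       (y i ^+ r - y j ^+ r).
Proof.
have cross j : ev v (cross_form K r Q c n i j) =
    r%:R * (y i ^+ r.-1 * f i - y j ^+ (r - Q) * y i ^+ Q.-1 * f j).
  by rewrite /ev !mevalM !mevalB !mevalM -mpolyC_nat mevalC !rmorphXn /= !mevalXU.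
have evP : ev v (vdm K r i) = \prod_(j < l | j != i) (y i ^+ r - y j ^+ r).
  rewrite /ev rmorph_prod; apply: eq_bigr => j _.
  by rewrite /= mevalB !rmorphXn /= !mevalXU.
have P0 : ev v (vdm K r i) != 0.
  by rewrite evP; apply/prodf_neq0 => j ji; rewrite subr_eq0 vdiff // eq_sym.
pose rest := \sum_(j < l | j != i) vdm2 K r i j * cross_form K r Q c n i j.
have key : ev v (vdm K r i) * ev v (Phi n i)^`M(i) =
    ev v (vdm K r i) * (c%:R * f i / y i) + ev v rest.
  have h := Phi_deriv_diag zP r2 Q0 Qr cr cQ n i; rewrite -/rest in h.
  (* If c = 0 the coordinate may be 0, so x_i is cancelled in the polynomial identity, before
     evaluation. *)
  case: (posnP c) => [c0|/vneq0/(_ i) yi0].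
    have e : vdm K r i * (Phi n i)^`M(i) = rest.
      apply/eqP; rewrite -subr_eq0; apply/eqP; apply: (mulfI (mpolyX_neq0 K i)).
      by rewrite h {1}c0 !mul0r mulr0.
    have cK : c%:R = 0 :> K by rewrite c0.
    by rewrite cK !mul0r mulr0 add0r -e /ev mevalM.
  have := congr1 (ev v) h.
  rewrite /ev !mevalM mevalB mevalM -mpolyC_nat mevalC mevalXU => e.
  apply: (mulfI yi0); rewrite mulrDr -[LHS](subrK (y i * rest.@[fun j => y j])) -mulrBr e.
  by congr (_ + _); field.
apply: (mulfI P0); rewrite key mulrDr; congr (_ + _).
rewrite /rest /ev raddf_sum mulr_sumr; apply: eq_bigr => j ji /=.
have d0 : y i ^+ r - y j ^+ r != 0 by rewrite subr_eq0 vdiff // eq_sym.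
have := cross j; rewrite /ev => crossj.
rewrite (vdmE K r ji) (mevalM _ (vdm2 _ _ _ _)) (mevalM _ (_ - _)) crossj mevalB !rmorphXn /= !mevalXU.
by field.
Qed.

Lemma swap_sum u i j : j != i ->
  \sum_(k < r) swap_term z q (Phi_col n v) u v i j k =
  u i 0 * (r%:R * (y i ^+ r.-1 * f i - y j ^+ (r - Q) * y i ^+ Q.-1 * f j) / (y i ^+ r - y j ^+ r))
  - u j 0 * (r%:R * (y j ^+ r.-1 * f i - y j ^+ (r.-1 - Q) * y i ^+ Q * f j) / (y i ^+ r - y j ^+ r)).
Proof.
move=> ji; have d : y i ^+ r != y j ^+ r by rewrite vdiff // eq_sym.
have r0 := ltnW r2.
pose F s : K := \sum_(k < r) z ^+ (k * s) / (y i - z ^+ k * y j).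
have FE s : (0 < s <= r)%N -> F s = r%:R * y i ^+ s.-1 * y j ^+ (r - s) / (y i ^+ r - y j ^+ r).
  by move=> sr; apply: (partial_fractions zP).
(* The four root sums have exponents 0, Q, 1 and Q + 1; exponent 0 is written as r to fit the range
   0 < s <= r. *)
transitivity (u i 0 * (f i * F r - f j * F Q) - u j 0 * (f i * F 1%N - f j * F Q.+1)).
  rewrite /F !mulr_sumr -!sumrB !mulr_sumr -sumrB; apply: eq_bigr => k _.
  have zr : z ^+ (k * r) = 1 by rewrite mulnC exprM (prim_expr_order zP) expr1n.
  have zq : z ^+ (k * q.+1) = z ^+ (k * Q) by rewrite -[LHS](prim_expr_mod zP) -modnMmr (prim_expr_mod zP).
  rewrite /swap_term !mxE zr zq muln1 mulnS exprD; move: (_^-1) => a; ring.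
rewrite !FE ?r0 ?leqnn ?Q0 //=; last exact: ltnW.
rewrite subnn !expr0 !mulr1 subn1.
have -> : (r - Q.+1 = r.-1 - Q)%N by lia.
by move: (_^-1) => a; ring.
Qed.

Lemma ode_eval u i :
  \sum_j u j 0 * ev v (Phi n i)^`M(j) =
  c%:R * Phi_col n v i 0 * u i 0 / v i 0 +
  \sum_(j < l | j != i) \sum_(k < r) swap_term z q (Phi_col n v) u v i j k.
Proof.
rewrite (bigD1 i) //= ev_deriv_diag mulrDr -addrA; congr (_ + _); first by rewrite mxE mulrC mulrAC.
rewrite mulr_sumr -big_split; apply: eq_bigr => j ji /=.
by rewrite ev_deriv_cross // (swap_sum u ji) mulrN.
Qed.

End Evaluation.
End Solutions.

(** * Regular points, equivariance and nonvanishing *)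

Module Equivariance.
Import mpoly PolyDefs Saito Freeness Bases MonomialW FreeArr Coinvariants PowerRepr KZ Residues Solutions.

Section RegularPoints.
Variables (K : numClosedFieldType) (r p l : nat).
Variables (gT : finGroupType) (W : {group gT}) (V : mx_representation K W l) (z : K).
Hypotheses (zP : r.-primitive_root z) (r2 : (2 <= r)%N) (l2 : (2 <= l)%N).
Hypotheses (p0 : (0 < p)%N) (pr : (p %| r)%N) (Vfaith : mx_faithful V).
Hypothesis hW : forall g : 'M[K]_l,
  in_monomial_group r p g <-> exists2 w, w \in W & V w = g.
Local Notation S := {mpoly K[l]}.
Implicit Types (i j k n : 'I_l) (v : 'cV[K]_l).

Definition generic v : Prop := (forall i j, i != j -> v i 0 ^+ r != v j 0 ^+ r) /\
  ((p < r)%N -> forall i, v i 0 != 0).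

(** The regular points are those where it does not vanish; this shows that they form an open set
    ([regular_near]). *)
Definition discriminant : S :=
  \prod_(i < l) \prod_(j < l | j != i) ('X_i ^+ r - 'X_j ^+ r) * \prod_(i < l) (if (p < r)%N then 'X_i else 1).

Lemma ev_discriminant v : generic v <-> ev v discriminant != 0.
Proof.
have e : ev v discriminant = (\prod_(i < l) \prod_(j < l | j != i) (v i 0 ^+ r - v j 0 ^+ r)) *
    \prod_(i < l) (if (p < r)%N then v i 0 else 1).
  rewrite /ev mevalM !rmorph_prod; congr (_ * _); apply: eq_bigr => i _ /=.
    by rewrite rmorph_prod; apply: eq_bigr => j _ /=; rewrite mevalB !rmorphXn /= !mevalXU.
  by case: (p < r)%N; rewrite ?mevalXU ?rmorph1.
rewrite e mulf_eq0 negb_or; split=> [[h1 h2]|/andP[/prodf_neq0 h1 /prodf_neq0 h2]].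
  apply/andP; split; apply/prodf_neq0 => i _.
    by apply/prodf_neq0 => j ji; rewrite subr_eq0 h1 // eq_sym.
  by case: ifP (oner_neq0 K) => // /h2.
split=> [i j ij|plr i]; last by have := h2 i isT; rewrite plr.
by have /prodf_neq0/(_ j) := h1 i isT; rewrite subr_eq0 eq_sym; apply.
Qed.

Lemma regular_pointP v : regular_point V v <-> generic v.
Proof.
have arr := mem_arrangement zP r2 p0 pr hW.
split=> [hv|[h1 h2] H /arr[[i [j [k [ij ->]]]]|[plr [i ->]]]]; last 2 first.
- have nij : i != j by apply: contraTneq ij => ->; rewrite ltnn.
  apply/negP; rewrite mem_form_ker lrow_mul => /eqP e; move: (h1 i j nij).
  by rewrite e exprMn (unityX zP) mul1r eqxx.
- by apply/negP; rewrite mem_form_ker erow_mul; apply/negP/h2.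
split=> [i j ij|plr i]; last first.
  have /hv/negP : form_ker (delta_mx 0 i) \in reflection_arrangement V.
    by apply/arr; right; split=> //; exists i.
  by rewrite mem_form_ker erow_mul => /negP.
wlog ltij : i j ij / (i < j)%N => [th|].
  case: (ltngtP i j) => [lt|gt|e]; [exact: th|by rewrite eq_sym th // eq_sym|].
  by case/eqP: ij; apply: val_inj.
apply/eqP => e; suff [k ek] : exists k : nat, v i 0 = z ^+ k * v j 0.
  have /hv : form_ker (Freeness.lrow z i j k) \in reflection_arrangement V.
    by apply/arr; left; exists i, j, k.
  by move/negP; rewrite mem_form_ker lrow_mul ek eqxx.
have r0 := ltnW r2.
case: (eqVneq (v j 0) 0) => [vj0|vj0].
  exists 0%N; rewrite vj0 mulr0; apply/eqP.
  by have := expf_eq0 (v i 0) r; rewrite e vj0 expr0n eqn0Ngt r0 /= eqxx => <-.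
have /(prim_rootP zP)[k hk] : (v i 0 / v j 0) ^+ r = 1.
  by rewrite exprMn exprVn e mulfV // expf_neq0.
by exists k; rewrite -hk divfK.
Qed.

End RegularPoints.

Section Twisting.
Variables (K : numClosedFieldType) (r l : nat).
Hypothesis r2 : (2 <= r)%N.
Implicit Types (i j k n : 'I_l) (v : 'cV[K]_l).

Lemma ev_gw (w : nat -> K) v mm i : ev v (gw r w 0 mm i) =
  wev w 1 (('X - 1) ^+ mm i * \prod_(k < l | k != i) (v i 0 ^+ r *: 'X - (v k 0 ^+ r)%:P) ^+ mm k).
Proof.
rewrite /gw /ev rmorph_wev rmorph1 expr0 mul1r rmorphM rmorphXn rmorphB /= map_polyX rmorph1 rmorph_prod.
rewrite (eq_wev (w' := w)) => [|t /=]; last by rewrite mevalC.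
congr (wev _ _ (_ * _)); apply: eq_bigr => k _; rewrite rmorphXn rmorphB /= map_polyC /=.
by rewrite linearZ_LR /= map_polyX !rmorphXn /= !mevalXU.
Qed.

Section Twist.
Variables (q q' c : nat).
Local Notation Q := (q.+1 %% r)%N.
Hypotheses (cr : (c <= r)%N) (qq : q'.+1 + c = q.+1 %[mod r]).
Local Notation Phi := (@Phi K r l Q c).
Local Notation kzw := (kz_weight K r Q c).

(** The integrals depend only on r-th powers of coordinates and are unaffected; the monomial factors
    x_i^Q and x_m^(c-Q) produce the powers of [ga]. *)
Lemma Phi_twist v v' (s : 'S_l) (ga : 'I_l -> K) m i : (forall k, ga k ^+ r = 1) ->
  (forall k, v' (s k) 0 = (ga k)^-1 * v k 0) ->
  ga m ^+ q'.+1 * ev v (Phi m i) = ga i ^+ q.+1 * ev v' (Phi (s m) (s i)).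
Proof.
move=> g1 hv; have g0 k := unity_neq0 r2 (g1 k).
have vr k : v' (s k) 0 ^+ r = v k 0 ^+ r by rewrite hv exprMn exprVn g1 invr1 mul1r.
have gmod k a b : a = b %[mod r] -> ga k ^+ a = ga k ^+ b.
  by move=> e; rewrite -(expr_mod a (g1 k)) e expr_mod.
have inj : injective s := perm_inj.
rewrite /KZ.Phi /ev !mevalM -!/(ev _ _).
have -> : ev v' (gw r kzw 0 (kz_mult (s i)) (s m)) = ev v (gw r kzw 0 (kz_mult i) m).
  rewrite !ev_gw (reindex_inj inj) /= /kz_mult (inj_eq inj); congr (wev _ _ (_ * _)).
  by apply: eq_big => k; rewrite !(inj_eq inj) // !vr.
rewrite (inj_eq inj) [LHS]mulrCA [RHS]mulrCA; congr (_ * _).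
case: (eqVneq i m) => [->|im]; rewrite /ev ?mevalM !rmorphXn /= !mevalXU !hv.
  by rewrite exprMn mulrA exprVn -(gmod m _ _ qq) exprD mulfK // expf_neq0.
rewrite !exprMn !exprVn -(gmod i Q); last by rewrite modn_mod.
have -> : ga m ^+ q'.+1 = ga m ^- (r + c - Q).
  have Qr : (Q < r)%N by rewrite ltn_mod ltnW.
  apply: (mulIf (expf_neq0 (r + c - Q) (g0 m))); rewrite mulVf ?expf_neq0 //.
  apply: (mulIf (expf_neq0 Q (g0 m))); rewrite mul1r -!exprD.
  have -> : (q'.+1 + (r + c - Q) + Q = q'.+1 + c + r)%N by lia.
  by rewrite exprD g1 mulr1; apply: gmod; rewrite qq modn_mod.
have a0 : ga i ^+ Q != 0 by rewrite expf_neq0.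
have b0 : ga m ^+ (r + c - Q) != 0 by rewrite expf_neq0.
by field; rewrite a0 b0.
Qed.

End Twist.

(** With the other coordinates fixed, the value is x_n^c times a polynomial in y = x_n^r whose
    leading coefficient is a weight. The extra factor [E] keeps [y] away from the other r-th
    powers. *)
Lemma nonvanishing_point (p Q c : nat) n : (forall t, kz_weight K r Q c t != 0) ->
  exists2 v, generic r p v & ev v (KZ.Phi K r Q c n n) != 0.
Proof.
move=> w0; pose b k : K := (k : 'I_l).+1%:R ^+ r.
have r0 := ltnW r2.
pose E : {poly K} := \prod_(k < l | k != n) ('X - (b k)%:P).
have Emon : E \is monic by apply: monic_prod => k _; rewrite monicXsubC.
pose G := \poly_(t < size E) (kz_weight K r Q c t * E`_t).
have Ge y : G.[y] = wev (kz_weight K r Q c) y E.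
  by rewrite horner_poly /wev; apply: eq_bigr => t _; rewrite mulrA.
have G0 : G != 0.
  apply/eqP => /(congr1 (fun P : {poly K} => P`_(size E).-1)); rewrite coef_poly coef0.
  have sE : (0 < size E)%N by rewrite size_poly_gt0 monic_neq0.
  rewrite ltn_predL sE -lead_coefE (monicP Emon) mulr1 => /eqP.
  by rewrite (negPf (w0 _)).
have [y y0] := nonzero_eval_neq0 (mulf_neq0 G0 (monic_neq0 Emon)).
rewrite hornerM mulf_eq0 negb_or => /andP[Gy Ey].
pose v : 'cV[K]_l := \col_k (if k == n then r.-root y else (k : nat).+1%:R).
have vn : v n 0 ^+ r = y by rewrite mxE eqxx rootCK.
have vk k : k != n -> v k 0 ^+ r = b k by rewrite mxE => /negPf ->.
have yb k : k != n -> y != b k.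
  move=> kn; apply: contraNneq Ey => ->; rewrite horner_prod (bigD1 k) //=.
  by rewrite hornerXsubC subrr mul0r.
have natI k j : b k = b j -> k = j.
  by move=> /eqP; rewrite /b -!natrX eqr_nat eqn_exp2r // => /eqP[] /val_inj.
have vnz k : v k 0 != 0.
  case: (eqVneq k n) => [->|kn]; last by rewrite mxE (negPf kn) pnatr_eq0.
  by rewrite mxE eqxx rootC_eq0.
exists v.
  split=> [i j ij|_ k]; last exact: vnz.
  case: (eqVneq i n) ij => [->|ni] ij; first by rewrite vn vk ?yb // eq_sym.
  case: (eqVneq j n) => [->|nj]; first by rewrite vn vk // eq_sym yb.
  by rewrite !vk //; apply: contraNneq ij => /natI ->.
rewrite /KZ.Phi eqxx /ev mevalM -/(ev v _) ev_gw /kz_mult eqxx expr0 mul1r.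
rewrite mulf_neq0 //; last by rewrite rmorphXn /= mevalXU expf_neq0.
suff -> : wev (kz_weight K r Q c) 1 (\prod_(k < l | k != n) (v n 0 ^+ r *: 'X - (v k 0 ^+ r)%:P) ^+ (k != n)) =
  G.[y] by [].
rewrite Ge [RHS]wev_dilate; congr (wev _ _ _).
rewrite rmorph_prod; apply: eq_bigr => k kn /=.
by rewrite kn expr1 comp_polyB comp_polyX comp_polyC vn vk.
Qed.

End Twisting.
End Equivariance.

From mathcomp Require Import boolp classical_sets functions filter topology.
From mathcomp Require Import normedtype landau derive.
Import Order.TTheory GRing.Theory Num.Theory.
Import numFieldNormedType.Exports numFieldTopology.Exports.

(** * Differentiability of polynomial maps *)

Section Differentials.
Variables (K : numFieldType) (V W : normedModType K).

(** Used because a solution, being 0 off the regular points, agrees with a polynomial map only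
    locally. *)
Lemma is_diff_near (f g df : V -> W) (x : V) :
  is_diff x f df -> (\forall y \near x, f y = g y) -> is_diff x g df.
Proof.
move=> fdf fg; have fgx : f x = g x := nbhs_singleton fg.
have [fx dfx] := fdf.
have fc : continuous ('d f x) := diff_continuous fx.
have hg : g \o shift x = cst (g x) + 'd f x +o_ 0 id.
  apply/eqaddoP => e e0; have /eqaddoP/(_ e e0) hf := diff_locally fx.
  near=> y; have : `|((f \o shift x) - (cst (f x) + 'd f x)) y| <= e * `|y| by near: y.
  suff e1 : f (y + x) = g (y + x) by rewrite /= !fctE /= e1 fgx.
  near: y.
  by move: fg; rewrite (near_shift 0) subr0; apply: filterS => y.
by apply: DiffDef; [apply/diff_locallyP; rewrite (diff_unique fc hg)|rewrite (diff_unique fc hg)].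
Unshelve. all: by end_near. Qed.

Lemma is_diff_bigsum (I : Type) (s : seq I) (f df : I -> V -> W) (x : V) :
  (forall i, is_diff x (f i) (df i)) ->
  is_diff x (fun y => \sum_(i <- s) f i y) (fun y => \sum_(i <- s) df i y).
Proof.
move=> h; elim: s => [|i s IH].
  have -> : (fun y : V => \sum_(i <- [::]) f i y) = cst 0 by apply/funext => y; rewrite big_nil.
  by apply: is_diff_eq; apply/funext => y; rewrite big_nil.
have -> : (fun y => \sum_(j <- i :: s) f j y) = f i + (fun y => \sum_(j <- s) f j y).
  by apply/funext => y; rewrite big_cons.
by apply: is_diff_eq; apply/funext => y; rewrite big_cons.
Qed.

Lemma is_diff_Zl (f df : V -> K) (w : W) (x : V) :
  is_diff x (f : V -> K^o) (df : V -> K^o) -> is_diff x (fun y => f y *: w) (fun y => df y *: w).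
Proof. by move=> [fx <-]; apply: DiffDef; [exact: differentiableZl|rewrite diffZl]. Qed.

End Differentials.

Module PolyDiff.
Import -(notations) mpoly.
Import Saito Freeness Solutions.

Section PolyDiff.
Variables (K : numClosedFieldType) (l : nat).
Local Notation S := (mpoly.mpoly l K).

Lemma evD (v : 'cV[K]_l) (P Q : S) : ev v (P + Q) = ev v P + ev v Q.
Proof. exact: mevalD. Qed.

Lemma evM (v : 'cV[K]_l) (P Q : S) : ev v (P * Q) = ev v P * ev v Q.
Proof. exact: mevalM. Qed.

Lemma is_diff_coord (v : 'cV[K]_l) i :
  is_diff v (fun u : 'cV[K]_l => u i 0 : K^o) (fun u => u i 0).
Proof.
have @f : {linear 'cV[K]_l -> K^o}.
  by exists (fun N : 'cV[K]_l => N i 0); do 2![eexists]; do ?[constructor];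
     rewrite ?mxE// => ? *; rewrite ?mxE//; move=> ?; rewrite !mxE.
have -> : (fun u : 'cV[K]_l => u i 0 : K^o) = f by [].
have fc : continuous f := @coord_continuous _ _ _ _ _.
by apply: DiffDef; [exact: linear_differentiable|rewrite diff_lin].
Qed.

Lemma is_diff_ev (P : S) (v : 'cV[K]_l) :
  is_diff v (fun u => ev u P : K^o) (fun u => \sum_j u j 0 * ev v (mderiv j P)).
Proof.
elim/mpoly_ring_ind: P => [d|k|P Q hP hQ|P Q hP hQ].
- have -> : (fun u : 'cV[K]_l => ev u (mpolyC l d) : K^o) = cst d.
    by apply/funext => u; rewrite /ev mevalC.
  apply: is_diff_eq; apply/funext => u; rewrite big1 // => j _.
  by rewrite mderivC /ev meval0 mulr0.
- have -> : (fun u : 'cV[K]_l => ev u (mpolyX K (mnm1 k)) : K^o) = (fun u => u k 0).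
    by apply/funext => u; rewrite /ev mevalXU.
  apply: (is_diff_eq (is_diff_coord v k)); apply/funext => u.
  rewrite (bigD1 k) //= big1 ?addr0 => [|j jk]; rewrite mderivU.
    by rewrite eqxx /ev -mpolyC1 mevalC mulr1.
  by rewrite (negPf jk) /ev meval0 mulr0.
- have -> : (fun u : 'cV[K]_l => ev u (P + Q) : K^o) = (fun u => ev u P : K^o) + (fun u => ev u Q).
    by apply/funext => u; rewrite /ev mevalD.
  apply: is_diff_eq; apply/funext => u /=; rewrite /= -[LHS]/(_ + _) -big_split.
  by apply: eq_bigr => j _; rewrite /= mderivD /ev mevalD mulrDr.
have -> : (fun u : 'cV[K]_l => ev u (P * Q) : K^o) = (fun u => ev u P : K^o) * (fun u => ev u Q : K^o).
  by apply/funext => u; rewrite /ev mevalM.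
apply: is_diff_eq; apply/funext => u /=.
rewrite -[LHS]/(ev v P * (\sum_j u j 0 * ev v (mderiv j Q)) + ev v Q * (\sum_j u j 0 * ev v (mderiv j P))).
rewrite !mulr_sumr -big_split; apply: eq_bigr => j _ /=.
by rewrite mderivM evD !evM; ring.
Qed.

End PolyDiff.
End PolyDiff.

(** * The space of explicit solutions *)

Module KZSolutions.
Import -(notations) mpoly.
Import PolyDefs Saito Freeness MonomialW FreeArr Coinvariants PowerRepr KZ Residues Solutions Equivariance PolyDiff.

Section Solutions.
Variables (K : numClosedFieldType) (r p l : nat).
Variables (gT : finGroupType) (W : {group gT}) (V : mx_representation K W l) (z : K).
Hypotheses (zP : r.-primitive_root z) (r2 : (2 <= r)%N) (l2 : (2 <= l)%N).
Hypotheses (p0 : (0 < p)%N) (pr : (p %| r)%N) (Vfaith : mx_faithful V).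
Hypothesis hW : forall g : 'M[K]_l,
  in_monomial_group r p g <-> exists2 w, w \in W & V w = g.
Local Notation S := (mpoly.mpoly l K).
Local Notation c := (axis_order r p).
Implicit Types (i j k n : 'I_l) (v : 'cV[K]_l).

Section Twist.
Variables (q q' : nat).
Hypotheses (cq : (p < r)%N -> ~~ (r %/ p %| q.+1)%N) (rq : ~~ (r %| q.+1)%N).
Hypothesis qq : q'.+1 + c = q.+1 %[mod r].
Local Notation Q := (q.+1 %% r)%N.
Local Notation U := (pow_repr r2 hW q).
Local Notation U' := (pow_repr r2 hW q').

Lemma Q_gt0 : (0 < Q)%N. Proof. by rewrite lt0n. Qed.

Lemma axis_le : (c <= r)%N.
Proof. by rewrite /axis_order; case: ifP => // _; exact: leq_div. Qed.

Lemma axis_gt0 : (0 < c)%N -> (p < r)%N.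
Proof. by rewrite /axis_order; case: ifP. Qed.

(** If p < r, then r/p = c would divide Q and hence q + 1, against [cq]; if p = r, then c = 0 and
    [rq] applies. *)
Lemma shifted_ndvd : ~~ (r %| Q + (r - c))%N.
Proof.
have Qr : (Q < r)%N by rewrite ltn_mod ltnW.
rewrite /axis_order; case: (ltnP p r) => [plr|_]; last first.
  by rewrite subn0 dvdn_addl // /dvdn modn_mod.
have dr : (r %/ p %| r)%N by rewrite -{2}(divnK pr) dvdn_mulr.
apply: contra (cq plr) => /(dvdn_trans dr); rewrite dvdn_addl ?dvdn_sub //.
by rewrite /dvdn modn_dvdm.
Qed.

Lemma kz_weight_neq0 t : kz_weight K r Q c t != 0.
Proof.
have := kz_weightP zP r2 Q_gt0 (ltn_pmod _ (ltnW r2)) axis_le shifted_ndvd t.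
by move=> h; apply: contra_eq_neq h => ->; rewrite mul0r eq_sym oner_neq0.
Qed.

(** The equivariant map from M_{k-c} to the solutions for M_k, where k = q + 1; [u] holds the
    coefficients. *)
Definition Theta (u : 'cV[K]_l) v : 'cV[K]_l :=
  if `[< regular_point V v >] then \sum_n u n 0 *: Phi_col r q c n v else 0.

Lemma Theta_linear a u u' v : Theta (a *: u + u') v = a *: Theta u v + Theta u' v.
Proof.
rewrite /Theta; case: asboolP => _; last by rewrite scaler0 addr0.
rewrite scaler_sumr -big_split; apply: eq_bigr => n _ /=.
by rewrite !mxE scalerDl scalerA.
Qed.

Lemma regular_near v : regular_point V v -> \forall y \near v, regular_point V y.
Proof.
have reg y : regular_point V y <-> ev y (discriminant K r p l) != 0.
  rewrite -ev_discriminant; exact: (regular_pointP zP).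
move=> /reg h; have dD := is_diff_ev (discriminant K r p l) v.
have dd : differentiable (fun y => ev y (discriminant K r p l) : K^o) v by exact: ex_diff.
have := @cvgr_neq0 _ _ _ _ _ _ _ (differentiable_continuous dd) h.
by move=> /(_ (nbhs_filter v)); apply: filterS => y hy; apply/reg.
Qed.

Lemma Theta_solution u : is_solution V U (Theta u).
Proof.
split=> [v hv|v hv]; last by rewrite /Theta; case: asboolP.
have [h1 h2] : generic r p v by apply/(regular_pointP zP r2 p0 pr hW).
pose P i : S := \sum_n u n 0 *: KZ.Phi K r Q c n i.
have sumE (a : 'I_l -> K) m : (\sum_i a i *: (delta_mx i 0 : 'cV_l)) m 0 = a m.
  rewrite summxE (bigD1 m) //= big1 ?addr0 => [|i im]; first by rewrite !mxE !eqxx mulr1.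
  by rewrite !mxE eq_sym (negPf im) mulr0.
have evP y (F : 'I_l -> S) : ev y (\sum_n u n 0 *: F n) = \sum_n u n 0 * ev y (F n).
  by rewrite /ev raddf_sum; apply: eq_bigr => n _; rewrite /= mevalZ.
have F1 y : \sum_i ev y (P i) *: (delta_mx i 0 : 'cV_l) = \sum_n u n 0 *: Phi_col r q c n y.
  apply/matrixP => i j; rewrite ord1 sumE evP summxE.
  by apply: eq_bigr => n _; rewrite !mxE.
(* Near [v] the map [Theta u] is polynomial. *)
apply: (@is_diff_near _ _ _ (fun y => \sum_i ev y (P i) *: (delta_mx i 0 : 'cV_l))); last first.
  by apply: filterS (regular_near hv) => y hy; rewrite F1 /Theta; case: asboolP.
apply: is_diff_eq.
  by apply: is_diff_bigsum => i; apply: is_diff_Zl; exact: is_diff_ev.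
apply/funext => w; apply/matrixP => m j; rewrite ord1 sumE {j}.
have dP j : ev v (mderiv j (P m)) = \sum_n u n 0 * ev v (mderiv j (KZ.Phi K r Q c n m)).
  by rewrite -evP raddf_sum; congr (ev v _); apply: eq_bigr => n _; rewrite /= mderivZ.
under eq_bigr do rewrite dP mulr_sumr; rewrite exchange_big /=.
transitivity (\sum_n u n 0 * (\sum_(H <- reflection_arrangement V)
    ((alpha H *m w) 0 0 / (alpha H *m v) 0 0) *: (residue V U H *m Phi_col r q c n v)) m 0).
  apply: eq_bigr => n _; rewrite (kz_rhs zP r2 l2 p0 pr Vfaith hW cq).
  rewrite -(ode_eval zP r2 Q_gt0 axis_le shifted_ndvd n h1 (fun hc => h2 (axis_gt0 hc))) mulr_sumr.
  by apply: eq_bigr => j _; rewrite mulrCA.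
rewrite /Theta; case: asboolP => // _; rewrite !summxE.
under eq_bigr do rewrite summxE mulr_sumr; rewrite exchange_big /=; apply: eq_bigr => H _.
rewrite mulmx_sumr scaler_sumr summxE; apply: eq_bigr => n _.
rewrite -scalemxAr; set a := _ / _.
by rewrite [in LHS]mxE [RHS]mxE [X in _ = _ * X]mxE mulrCA.
Qed.

Lemma generic_inv v v' (s : 'S_l) (ga : 'I_l -> K) : (forall k, ga k ^+ r = 1) ->
  (forall k, v k 0 = ga k * v' (s k) 0) -> generic r p v <-> generic r p v'.
Proof.
move=> g1 hv; have vr k : v k 0 ^+ r = v' (s k) 0 ^+ r by rewrite hv exprMn g1 mul1r.
have v0 k : (v k 0 == 0) = (v' (s k) 0 == 0).
  by rewrite hv mulf_eq0 (negPf (unity_neq0 r2 (g1 k))).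
split=> -[h1 h2]; split=> [i j ij|plr i].
- have := h1 (s^-1 i)%g (s^-1 j)%g; rewrite !vr !permKV; apply.
  by apply: contraNneq ij => /perm_inj ->.
- by have := h2 plr (s^-1 i)%g; rewrite v0 permKV.
- by rewrite !vr h1 // (inj_eq perm_inj).
by rewrite v0 h2.
Qed.

Lemma Theta_equivariant w u v : w \in W ->
  Theta (U' w *m u) v = U w *m Theta u (V w^-1%g *m v).
Proof.
move=> wW; have [s [ga [hw g1 _]]] := V_mono r2 hW wW.
set v' := V w^-1%g *m v.
have hv k : v k 0 = ga k * v' (s k) 0.
  by rewrite -mono_mul -hw /v' mulmxA -repr_mxM ?groupV // mulgV repr_mx1 mul1mx.
have hv' k : v' (s k) 0 = (ga k)^-1 * v k 0 by rewrite hv mulKf // (unity_neq0 r2).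
have rv : regular_point V v <-> regular_point V v'.
  by rewrite !(regular_pointP zP r2 p0 pr hW); exact: generic_inv hv.
rewrite /Theta (asbool_equiv_eq rv); case: asboolP => _; last by rewrite mulmx0.
apply/matrixP => i j; rewrite ord1 {j} [RHS](_ : _ = ga i ^+ q.+1 * (\sum_n u n 0 *: Phi_col r q c n v') (s i) 0); last first.
  by rewrite -(mono_mul s (fun k => ga k ^+ q.+1)) -(pow_mono q hw).
rewrite !summxE mulr_sumr [RHS](reindex_inj (@perm_inj _ s)) /=; apply: eq_bigr => n _.
rewrite mxE [(U' w *m u) n 0](_ : _ = ga n ^+ q'.+1 * u (s n) 0); last first.
  by rewrite -(mono_mul s (fun k => ga k ^+ q'.+1)) -(pow_mono q' hw).
transitivity (u (s n) 0 * (ga n ^+ q'.+1 * ev v (KZ.Phi K r Q c n i))).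
  by rewrite mxE -mulrA mulrCA.
by rewrite (Phi_twist r2 axis_le qq n i g1 hv') !mxE mulrCA.
Qed.

Lemma Theta_neq0 : exists u v, Theta u v != 0.
Proof.
pose n : 'I_l := Ordinal (ltnW l2).
have [v gv nz] := nonvanishing_point r2 p n kz_weight_neq0.
have rv : regular_point V v by apply/(regular_pointP zP r2 p0 pr hW).
exists (delta_mx n 0), v; apply: contra_neq nz => e.
have <- : (Theta (delta_mx n 0) v) n 0 = ev v (KZ.Phi K r (q.+1 %% r) c n n); last by rewrite e mxE.
rewrite /Theta asboolT // summxE (bigD1 n) //= big1 ?addr0 => [|m mn]; first by rewrite !mxE !eqxx mul1r.
by rewrite !mxE (negPf mn) mul0r.
Qed.

End Twist.
End Solutions.
End KZSolutions.

(** * Transport of solutions and Schur's lemma *)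

Section SolutionTransport.
Variables (K : numClosedFieldType) (l : nat) (gT : finGroupType) (W : {group gT}).
Variable V : mx_representation K W l.
Variables (d d' : nat) (U : mx_representation K W d) (U' : mx_representation K W d').

Lemma is_diff_mulmx (B : 'M[K]_(d', d)) (f df : 'cV[K]_l -> 'cV[K]_d) v :
  is_diff v f df -> is_diff v (fun y => B *m f y) (fun y => B *m df y).
Proof.
move=> fdf.
have BE (x : 'cV[K]_d) : B *m x = \sum_i x i 0 *: col i B.
  apply/matrixP => a b; rewrite ord1 !mxE summxE; apply: eq_bigr => i _.
  by rewrite !mxE mulrC.
have -> : (fun y => B *m f y) = (fun y => \sum_i f y i 0 *: col i B) by apply/funext => y.
have -> : (fun y => B *m df y) = (fun y => \sum_i df y i 0 *: col i B) by apply/funext => y.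
apply: is_diff_bigsum => i; apply: is_diff_Zl.
exact: (is_diff_comp fdf (PolyDiff.is_diff_coord (f v) i)).
Qed.

Lemma is_solution_mulmx (B : 'M[K]_(d', d)) f :
  (forall w, w \in W -> U' w *m B = B *m U w) -> is_solution V U f ->
  is_solution V U' (fun v => B *m f v).
Proof.
move=> hB [h1 h2]; split=> v hv; last by rewrite h2 // mulmx0.
apply: is_diff_eq (is_diff_mulmx B (h1 v hv)) _; apply/funext => u.
rewrite mulmx_sumr; apply: eq_bigr => H _; rewrite -scalemxAr; congr (_ *: _).
rewrite !mulmxA; congr (_ *m _); rewrite /residue mulmx_sumr mulmx_suml.
apply: eq_bigr => w; rewrite !inE => /andP[_ /andP[wW _]].
by rewrite mulmxBl mulmxBr mul1mx mulmx1 hB.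
Qed.

End SolutionTransport.

(** Schur's lemma: the kernel and the image of [M] are submodules. *)
Lemma irreducible_hom_rsim (K : fieldType) (gT : finGroupType) (W : {group gT}) d d'
    (U : mx_representation K W d) (U' : mx_representation K W d') (M : 'M[K]_(d, d')) :
  mx_irreducible U -> mx_irreducible U' -> M != 0 ->
  (forall w, w \in W -> U w *m M = M *m U' w) -> mx_rsim U U'.
Proof.
move=> /mx_irrP[_ irr] /mx_irrP[_ irr'] M0 hM.
have free : row_free M.
  rewrite -kermx_eq0; apply: contraT => k0.
  have mod : mxmodule U (kermx M).
    by apply/mxmoduleP => w wW; apply/sub_kermxP; rewrite -mulmxA hM // mulmxA mulmx_ker mul0mx.
  have := irr _ mod k0; rewrite -sub1mx => /sub_kermxP; rewrite mul1mx => e.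
  by rewrite e eqxx in M0.
have full : row_full M.
  have mod : mxmodule U' <<M>>%MS.
    apply/mxmoduleP => w wW; rewrite genmxE (eqmxMr _ (genmxE M)) -hM //.
    exact: submxMl.
  have := irr' _ mod; rewrite -mxrank_eq0 genmxE mxrank_eq0 => /(_ M0).
  by rewrite /row_full genmxE.
by apply: (MxReprSim _ free hM); rewrite -(eqP free) (eqP full).
Qed.

Lemma family_sum (K : fieldType) d e (X : Type) (F : 'cV[K]_d -> X -> 'cV[K]_e) :
  (forall a u u', F (a *: u + u') =1 fun v => a *: F u v + F u' v) ->
  forall n (a : 'I_n -> K) (y : 'I_n -> 'cV[K]_d) v,
    F (\sum_i a i *: y i) v = \sum_i a i *: F (y i) v.
Proof.
move=> lin n a y v; have F0 : F 0 v = 0.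
  by have := lin (-1) 0 0 v; rewrite scaler0 addr0 scaleN1r addNr.
elim/big_rec2: _ => [|i u u' _ IH]; first exact: F0.
by rewrite lin IH.
Qed.

Lemma eq_mulmx_cV (K : fieldType) d e (X Y : 'M[K]_(e, d)) :
  (forall u : 'cV_d, X *m u = Y *m u) -> X = Y.
Proof.
move=> h; apply/matrixP => i j; have := congr1 (fun M : 'cV_e => M i 0) (h (delta_mx j 0)).
by rewrite -!colE !mxE.
Qed.

Section Duality.
Variables (K : decFieldType) (l : nat) (gT : finGroupType) (W : {group gT}).
Variable V : mx_representation K W l.

(** The annihilator of a submodule of the dual is a submodule of [V]. *)
Lemma dual_irreducible : mx_irreducible V -> mx_irreducible (dual_repr V).
Proof.
move=> /mx_irrP[l0 irr]; apply/mx_irrP; split=> // U modU U0.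
have mod : mxmodule V (kermx U^T).
  apply/mxmoduleP => w wW; apply/sub_kermxP.
  have /submxP[B hB] := mxmoduleP modU w^-1%g (groupVr wW).
  have e : V w *m U^T = U^T *m B^T by rewrite -trmx_mul -hB trmx_mul /= invgK trmxK.
  by rewrite -mulmxA e mulmxA mulmx_ker mul0mx.
have [k0|k0] := eqVneq (kermx U^T) 0.
  by rewrite /row_full -mxrank_tr; move/eqP: k0; rewrite kermx_eq0 /row_free.
have := irr _ mod k0; rewrite -sub1mx => /sub_kermxP; rewrite mul1mx => /eqP.
by rewrite -trmx0 (inj_eq trmx_inj) (negPf U0).
Qed.

End Duality.

(** * The permutation Psi *)

Module PsiChain.
Import -(notations) mpoly.
Import PolyDefs Saito Freeness MonomialW FreeArr Coinvariants PowerRepr KZSolutions.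

Section PsiChain.
Variables (K : numClosedFieldType) (r p l : nat).
Variables (gT : finGroupType) (W : {group gT}) (V : mx_representation K W l) (z : K).
Hypotheses (zP : r.-primitive_root z) (r2 : (2 <= r)%N) (l2 : (2 <= l)%N).
Hypotheses (p0 : (0 < p)%N) (pr : (p %| r)%N) (Vfaith : mx_faithful V).
Hypothesis hW : forall g : 'M[K]_l,
  in_monomial_group r p g <-> exists2 w, w \in W & V w = g.
Hypothesis Virr : mx_irreducible V.
Local Notation c := (axis_order r p).
Local Notation pow := (pow_repr r2 hW).

(** Each explicit solution has a unique preimage under [Phi]. Those of the basis vectors are the
    columns of [M], which intertwines by uniqueness and is nonzero because [Theta] is; Schur's lemma
    concludes. *)
Lemma solutions_iso_pow q q' d d' (U : mx_representation K W d) (U' : mx_representation K W d') :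
  ((p < r)%N -> ~~ (r %/ p %| q.+1)%N) -> ~~ (r %| q.+1)%N -> q'.+1 + c = q.+1 %[mod r] ->
  mx_rsim (pow q) U -> mx_irreducible (pow q') -> mx_irreducible U' ->
  solutions_iso V U U' -> mx_rsim U' (pow q').
Proof.
move=> cq rq qq /mx_rsim_sym[B ed Bfree hB] irrq irrU' [Phi [Plin Psol Puniq Pequi]].
subst d.
pose T u v := B *m Theta r p V q u v.
have Tsol u : is_solution V U (T u).
  apply: is_solution_mulmx hB _; exact: (Theta_solution zP r2 l2 p0 pr Vfaith hW cq rq).
have Tlin a u u' : T (a *: u + u') =1 fun v => a *: T u v + T u' v.
  by move=> v; rewrite /T Theta_linear mulmxDr scalemxAr.
have ex n : exists x, Phi x =1 T (delta_mx n 0).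
  by have [x [hx _]] := Puniq _ (Tsol (delta_mx n 0)); exists x.
have [x hx] := boolp.choice ex.
have inj y y' : Phi y =1 Phi y' -> y = y'.
  by move=> e; have [x0 [_ h]] := Puniq _ (Psol y'); rewrite -(h y) // -(h y').
pose M : 'M[K]_(d', l) := \matrix_(i, n) x n i 0.
have PM u : Phi (M *m u) =1 T u.
  move=> v; have -> : M *m u = \sum_n u n 0 *: x n.
    apply/matrixP => i j; rewrite ord1 mxE summxE; apply: eq_bigr => n _.
    by rewrite !mxE mulrC.
  rewrite (family_sum Plin); have {2}-> : u = \sum_n u n 0 *: delta_mx n 0.
    by rewrite {1}[u]matrix_sum_delta; apply: eq_bigr => n _; rewrite big_ord1.
  by rewrite (family_sum Tlin); apply: eq_bigr => n _; rewrite hx.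
apply: (irreducible_hom_rsim irrU' irrq (M := M)) => [|w wW].
  have [u [v nz]] := Theta_neq0 zP r2 l2 p0 pr hW cq rq.
  apply: contra_neq nz => M0; have F0 : Phi 0 v = 0.
    by have := Plin (-1) 0 0 v; rewrite scaler0 addr0 scaleN1r addNr.
  have := PM u v; rewrite M0 mul0mx F0 /T => /(congr1 (mulmx (invmx B))).
  by rewrite mulmx0 mulKmx // -row_free_unit.
apply: eq_mulmx_cV => u; rewrite -!mulmxA; apply: inj => v.
rewrite Pequi // !PM /T mulmxA hB // -mulmxA; congr (_ *m _).
by rewrite (Theta_equivariant zP r2 p0 pr hW qq).
Qed.

Lemma rsim_on d (U U' : mx_representation K W d) :
  (forall w, w \in W -> U w = U' w) -> mx_rsim U U'.
Proof.
move=> h; apply: (MxReprSim (B := 1%:M)) => // [|w wW]; first by rewrite row_free_unit unitmx1.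
by rewrite mulmx1 mul1mx h.
Qed.

(** The inverse of an r-th root of unity is its (r-1)-th power, and q + 1 is congruent to -1
    here. *)
Lemma dual_powE q w : (r %| q.+2)%N -> w \in W -> dual_repr V w = pow q w.
Proof.
move=> rq wW; have [s [ga [hw g1 _]]] := V_mono r2 hW wW.
have g0 k := unity_neq0 r2 (g1 k).
rewrite [RHS](pow_mono q hw) /= repr_mxV // hw mono_inv //; apply/matrixP => i j; rewrite !mxE.
have -> : (i == (s^-1)%g j) = (j == s i) by apply/eqP/eqP => ->; rewrite ?permKV ?permK.
case: eqP => // ->; rewrite permK; apply: (mulfI (g0 i)); rewrite mulfV // -exprS.
by rewrite -(divnK rq) mulnC exprM g1 expr1n.
Qed.

(** If a vector has nonzero i-th entry, subtracting it from its image under a scaling of x_i leaves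
    a nonzero multiple of e_i; swaps carry e_i to every e_j. *)
Lemma pow_irreducible_scaled q : (p < r)%N -> ~~ (r %/ p %| q.+1)%N -> mx_irreducible (pow q).
Proof.
move=> plr cq; apply/mx_irrP; split=> [|U modU U0]; first exact: ltnW.
have /matrix0Pn[a [i ai]] := U0.
have stable (x : 'rV_l) w : w \in W -> (x <= U)%MS -> (x *m pow q w <= U)%MS.
  by move=> wW xU; apply: submx_trans (submxMr _ xU) (mxmoduleP modU w wW).
have ei : ((delta_mx 0 i : 'rV_l) <= U)%MS.
  have [wW hw] := w_scaleP zP r2 pr hW i 1; set w := w_scale _ _ _ _ _ in wW hw.
  have h : (row a U *m pow q w - row a U <= U)%MS.
    by rewrite addmx_sub ?eqmx_opp ?stable ?row_sub.
  have e : row a U *m pow q w - row a U = (U a i * ((z ^+ (p * 1)) ^+ q.+1 - 1)) *: delta_mx 0 i.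
    apply/rowP => j; rewrite (pow_mono q hw : pow q w = _) !mxE (bigD1 j) //= big1 ?addr0 => [|k kj].
      rewrite !mxE perm1 eqxx /ga_scale [j == i]eq_sym; case: (eqVneq i j) => [<-|_].
        by rewrite mulr1 mulrBr mulr1.
      by rewrite expr1n mulr1 mulr0 subrr.
    by rewrite !mxE perm1 eq_sym (negPf kj) mulr0.
  move: h; rewrite e (eqmx_scale _ _) // mulf_neq0 // subr_eq0 muln1.
  by rewrite -(prim_order_dvd (zp_prim zP r2 p0 pr)).
rewrite -sub1mx; apply/row_subP => j; rewrite row1.
case: (eqVneq i j) => [<-//|ij].
have [wW hw] := w_swapP zP r2 hW 0 ij; have := stable _ _ wW ei.
rewrite -rowE (pow_mono q hw : pow q _ = _).
suff -> : row i (mono (tperm i j) (fun k => ga_swap i j (z ^+ 0) k ^+ q.+1)) = delta_mx 0 j by [].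
apply/rowP => k; rewrite !mxE eqxx tpermL /ga_swap eqxx expr0 expr1n /=.
by case: eqP.
Qed.

(** Since [pow_repr q] is M_{q+1}, this encodes M_{mc-1} with r added to the exponent to keep it
    positive. *)
Definition psi_pow m : nat := (r - 2 + m * c)%N.

Lemma psi_pow_ndvd m : (p < r)%N -> ~~ (r %/ p %| (psi_pow m).+1)%N.
Proof.
move=> plr; have rp1 : (1 < r %/ p)%N by rewrite ltn_divRL // mul1n.
have dr : (r %/ p %| r)%N by rewrite -{2}(divnK pr) dvdn_mulr.
rewrite /psi_pow /axis_order plr -addSn dvdn_addl ?dvdn_mull //.
apply: contraL rp1 => h; rewrite -leqNgt dvdn_leq // -(dvdn_addr _ h).
by have -> : ((r - 2).+1 + 1 = r)%N by lia.
Qed.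

Lemma psi_pow_ndvdr m : ~~ (r %| (psi_pow m).+1)%N.
Proof.
case: (ltnP p r) => plr.
  have dr : (r %/ p %| r)%N by rewrite -{2}(divnK pr) dvdn_mulr.
  by apply: contra (psi_pow_ndvd m plr); exact: dvdn_trans.
rewrite /psi_pow /axis_order ltnNge plr /= muln0 addn0 gtnNdvd //; lia.
Qed.

(** If p = r then c = 0, and the module is the dual of [V] for every m. *)
Lemma psi_pow_irreducible m : mx_irreducible (pow (psi_pow m)).
Proof.
case: (ltnP p r) => plr; first exact/pow_irreducible_scaled/psi_pow_ndvd.
apply: mx_rsim_irr (dual_irreducible Virr); apply: rsim_on => w wW; apply: dual_powE => //.
by rewrite /psi_pow /axis_order ltnNge plr /= muln0 addn0; have -> : ((r - 2).+2 = r)%N by [lia|].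
Qed.

Lemma pchar_group : pgroup [pchar K]^' W.
Proof. by apply/pgroupP => a _ _; rewrite inE /= pchar_num. Qed.

Local Notation irr_pow m := (irr_comp (Irr K W) (pow (psi_pow m))).

Lemma Psi_pow (Psi : {perm Irr K W}) m : is_Psi V Psi -> Psi (irr_pow m.+1) = irr_pow m.
Proof.
move=> hPsi; have charW := pchar_group.
have h : mx_rsim (irr_repr (Psi (irr_pow m.+1))) (pow (psi_pow m)).
  apply: (solutions_iso_pow _ _ _ (rsim_irr_comp_pchar _ charW (psi_pow_irreducible m.+1))) (hPsi _).
  - exact: psi_pow_ndvd.
  - exact: psi_pow_ndvdr.
  - by rewrite /psi_pow mulSn; congr (_ %% _)%N; lia.
  - exact: psi_pow_irreducible.
  - exact: socle_irr.
by rewrite -(irr_comp_rsim_pchar _ charW h) irr_reprK_pchar.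
Qed.

Lemma Psi_dual (Psi : {perm Irr K W}) m : is_Psi V Psi ->
  (Psi^-1 ^+ m)%g (irr_comp (Irr K W) (dual_repr V)) = irr_pow m.
Proof.
move=> hPsi; have charW := pchar_group.
have -> : irr_comp (Irr K W) (dual_repr V) = irr_pow 0.
  apply: irr_comp_rsim_pchar => //; apply: rsim_on => w wW; apply: dual_powE => //.
  by rewrite /psi_pow mul0n addn0; have -> : ((r - 2).+2 = r)%N by [lia|].
elim: m => [|m IH]; first by rewrite expg0 perm1.
by rewrite expgSr permM IH -(Psi_pow m hPsi) permK.
Qed.

Theorem Psi_exponents (Psi : {perm Irr K W}) m : is_Psi V Psi ->
  exists2 ns : seq nat,
    U_exponents V (irr_repr ((Psi^-1 ^+ m)%g (irr_comp (Irr K W) (dual_repr V)))) ns &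
    free_with_exponents (reflection_arrangement V) (fun H => m * stab_order V H + 1)%N
      [seq (m * coxeter_number V + n)%N | n <- ns].
Proof.
move=> hPsi; pose es := [seq module_exponent r p m t | t <- enum 'I_l].
have eq_es : perm_eq (sort leq es) es by rewrite perm_sort.
exists (sort leq es); last exact: (free_odd zP r2 l2 p0 pr Vfaith hW eq_es).
(* The sum is r - 1 + mc + kappa, which is r (shift + 1) by [shiftE]. *)
have hq : (r %| (psi_pow m).+1 + kappa r p m)%N.
  have e := shiftE m r2 p0 pr; rewrite /psi_pow.
  apply/dvdnP; exists (shift r p m).+1; lia.
apply: (pow_exponents zP l2 p0 pr Vfaith hq _ (sort_sorted leq_total _) eq_es).
rewrite (Psi_dual m hPsi).
by apply: rsim_irr_comp_pchar; [exact: pchar_group|exact: psi_pow_irreducible].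
Qed.

End PsiChain.
End PsiChain.

Theorem theorem1p2 (R : realType) (r p l m : nat)
    (gT : finGroupType) (W : {group gT}) (V : mx_representation R[i] W l) :
  (2 <= r)%N -> (2 <= l)%N -> (0 < p)%N -> (p %| r)%N ->
  mx_faithful V ->
  (forall g : 'M[R[i]]_l,
     in_monomial_group r p g <-> exists2 w, w \in W & V w = g) ->
  mx_irreducible V ->
  let A := reflection_arrangement V in
  let h := coxeter_number V in
  let omega := stab_order V in
  free_with_exponents A (fun H => m * omega H)%N (nseq l (m * h)%N) /\
  (forall Psi : {perm Irr R[i] W}, is_Psi V Psi ->
     exists2 ns : seq nat,
       U_exponents V
         (irr_repr ((Psi^-1 ^+ m)%g (irr_comp (Irr R[i] W) (dual_repr V)))) ns &
       free_with_exponents A (fun H => m * omega H + 1)%N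
         [seq (m * h + n)%N | n <- ns]).
Proof.
move=> r2 l2 p0 pr Vfaith hW Virr /=.
have [z zP] := exists_prim_root R[i] (ltnW r2).
split; first exact: (FreeArr.free_even zP r2 l2 p0 pr Vfaith hW).
by move=> Psi; apply: (PsiChain.Psi_exponents zP r2 l2 p0 pr Vfaith hW Virr).
Qed.
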